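(* Let $\mathcal C$ be a symmetric skew monoidal 2-category whose coherence constraints $a,\ell,r$ are (componentwise) equivalences. Then $\mathcal C$ is a symmetric monoidal bicategory, with braiding components the composites $$AB\xrightarrow{\ \ell_A^*1_B\ }(IA)B\xrightarrow{\ s_{I,A,B}\ }(IB)A\xrightarrow{\ \ell_B1_A\ }BA,$$ where $\ell^*_A\colon A\to IA$ is an equivalence inverse of $\ell_A\colon IA\to A$.
   Context: A skew monoidal 2-category is a 2-category $\mathcal C$ with a 2-functor $\mathcal C\times\mathcal C\to\mathcal C$, $(X,Y)\mapsto XY$, an object $I$ and 2-natural transformations (not necessarily invertible) $a_{X,Y,Z}\colon (XY)Z\to X(YZ)$, $\ell_X\colon IX\to X$, $r_X\colon X\to XI$ satisfying strictly: $a_{A,B,CD}\,a_{AB,C,D}=(1_A a_{B,C,D})\,a_{A,BC,D}\,(a_{A,B,C}1_D)$; $\ell_{AB}\,a_{I,A,B}=\ell_A1_B$; $(1_A\ell_B)\,a_{A,I,B}\,(r_A1_B)=1_{AB}$; $a_{A,B,I}\,r_{AB}=1_Ar_B$; $\ell_I r_I=1_I$. If the components of $a,\ell,r$ are equivalences, $\mathcal C$ is in particular a monoidal bicategory (with this tensor product and unit). A symmetry on it is a 2-natural isomorphism $s_{X,A,B}\colon (XA)B\to (XB)A$ satisfying: (B1) $s_{XC,A,B}(s_{X,A,C}1_B)s_{XA,B,C}=(s_{X,B,C}1_A)s_{XB,A,C}(s_{X,A,B}1_C)$; (B2) $s_{X,A,BC}\,a_{XA,B,C}=(a_{X,B,C}1_A)s_{XB,A,C}(s_{X,A,B}1_C)$;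 (B3) $s_{X,AB,C}(a_{X,A,B}1_C)=a_{XC,A,B}(s_{X,A,C}1_B)s_{XA,B,C}$; (B4) $(1_Xs_{A,B,C})\,a_{X,AB,C}(a_{X,A,B}1_C)=a_{X,AC,B}(a_{X,A,C}1_B)s_{XA,B,C}$; (Sym) $s_{X,B,A}s_{X,A,B}=1$. ''Symmetric monoidal bicategory'' has its standard meaning: a monoidal bicategory with a pseudonatural equivalence $AB\to BA$ (the braiding), invertible modifications in place of the two hexagon axioms and of the symmetry axiom, subject to the usual coherence axioms. *)

(* Defs.v *)
(** [g ∘ f] is "[f], then [g]"; vertical composition
    [α • β] of 2-cells is "[α], then [β]"; horizontal composition [β ⋆ α] has
    [α] on the side of [f] in [g ∘ f]. *)

Set Implicit Arguments.
Unset Strict Implicit.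

Declare Scope bicat_scope.
Delimit Scope bicat_scope with bicat.
Open Scope bicat_scope.

Reserved Notation "g ∘ f" (at level 40, left associativity).
Reserved Notation "α • β" (at level 45, right associativity).
Reserved Notation "β ⋆ α" (at level 40, left associativity).

Record bicat := Bicat {
  ob :> Type;
  hom : ob -> ob -> Type;
  cell : forall x y : ob, hom x y -> hom x y -> Type;
  id1 : forall x, hom x x;
  comp1 : forall x y z, hom y z -> hom x y -> hom x z
    where "g ∘ f" := (comp1 g f);
  id2 : forall x y (f : hom x y), cell f f;
  vcomp : forall x y (f g h : hom x y), cell f g -> cell g h -> cell f h
    where "α • β" := (vcomp α β);
  hcomp : forall x y z (g g' : hom y z) (f f' : hom x y),
    cell g g' -> cell f f' -> cell (g ∘ f) (g' ∘ f')
    where "β ⋆ α" := (hcomp β α);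
  lunit : forall x y (f : hom x y), cell (id1 y ∘ f) f;
  lunit_inv : forall x y (f : hom x y), cell f (id1 y ∘ f);
  runit : forall x y (f : hom x y), cell (f ∘ id1 x) f;
  runit_inv : forall x y (f : hom x y), cell f (f ∘ id1 x);
  assoc : forall x y z w (h : hom z w) (g : hom y z) (f : hom x y),
    cell ((h ∘ g) ∘ f) (h ∘ (g ∘ f));
  assoc_inv : forall x y z w (h : hom z w) (g : hom y z) (f : hom x y),
    cell (h ∘ (g ∘ f)) ((h ∘ g) ∘ f);
  vcomp_id_l : forall x y (f g : hom x y) (α : cell f g), id2 f • α = α;
  vcomp_id_r : forall x y (f g : hom x y) (α : cell f g), α • id2 g = α;
  vcomp_assoc : forall x y (f g h k : hom x y)
    (α : cell f g) (β : cell g h) (γ : cell h k),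
    (α • β) • γ = α • (β • γ);
  hcomp_id : forall x y z (g : hom y z) (f : hom x y),
    id2 g ⋆ id2 f = id2 (g ∘ f);
  interchange : forall x y z (g g' g'' : hom y z) (f f' f'' : hom x y)
    (β : cell g g') (β' : cell g' g'') (α : cell f f') (α' : cell f' f''),
    (β • β') ⋆ (α • α') = (β ⋆ α) • (β' ⋆ α');
  lunitK : forall x y (f : hom x y), lunit f • lunit_inv f = id2 _;
  lunit_invK : forall x y (f : hom x y), lunit_inv f • lunit f = id2 _;
  runitK : forall x y (f : hom x y), runit f • runit_inv f = id2 _;
  runit_invK : forall x y (f : hom x y), runit_inv f • runit f = id2 _;
  assocK : forall x y z w (h : hom z w) (g : hom y z) (f : hom x y),
    assoc h g f • assoc_inv h g f = id2 _;
  assoc_invK : forall x y z w (h : hom z w) (g : hom y z) (f : hom x y),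
    assoc_inv h g f • assoc h g f = id2 _;
  lunit_nat : forall x y (f g : hom x y) (α : cell f g),
    (id2 (id1 y) ⋆ α) • lunit g = lunit f • α;
  runit_nat : forall x y (f g : hom x y) (α : cell f g),
    (α ⋆ id2 (id1 x)) • runit g = runit f • α;
  assoc_nat : forall x y z w (h h' : hom z w) (g g' : hom y z) (f f' : hom x y)
    (γ : cell h h') (β : cell g g') (α : cell f f'),
    ((γ ⋆ β) ⋆ α) • assoc h' g' f' = assoc h g f • (γ ⋆ (β ⋆ α));
  triangle : forall x y z (g : hom y z) (f : hom x y),
    assoc g (id1 y) f • (id2 g ⋆ lunit f) = runit g ⋆ id2 f;
  pentagon : forall v w x y z
    (k : hom y z) (h : hom x y) (g : hom w x) (f : hom v w),
    assoc (k ∘ h) g f • assoc k h (g ∘ f) =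
    (assoc k h g ⋆ id2 f) • assoc k (h ∘ g) f • (id2 k ⋆ assoc h g f)
}.

Arguments hom {b} x y.
Arguments cell {b x y} f g.
Arguments id1 {b} x.
Arguments comp1 {b x y z} g f.
Arguments id2 {b x y} f.
Arguments vcomp {b x y f g h} α β.
Arguments hcomp {b x y z g g' f f'} β α.
Arguments lunit {b x y} f.
Arguments lunit_inv {b x y} f.
Arguments runit {b x y} f.
Arguments runit_inv {b x y} f.
Arguments assoc {b x y z w} h g f.
Arguments assoc_inv {b x y z w} h g f.

Notation "g ∘ f" := (comp1 g f) : bicat_scope.
Notation "α • β" := (vcomp α β) : bicat_scope.
Notation "β ⋆ α" := (hcomp β α) : bicat_scope.

Record iso2 (C : bicat) (x y : C) (f g : hom x y) := Iso2 {
  fwd :> cell f g;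
  bwd : cell g f;
  fwdK : fwd • bwd = id2 f;
  bwdK : bwd • fwd = id2 g
}.

Definition iso_id (C : bicat) (x y : C) (f : hom x y) : iso2 f f :=
  Iso2 (vcomp_id_l (id2 f)) (vcomp_id_l (id2 f)).
Arguments iso_id {C x y} f.

Definition iso_inv (C : bicat) (x y : C) (f g : hom x y) (α : iso2 f g) :
  iso2 g f := Iso2 (bwdK α) (fwdK α).

Definition iso_comp (C : bicat) (x y : C) (f g h : hom x y)
  (α : iso2 f g) (β : iso2 g h) : iso2 f h.
Proof.
refine (@Iso2 C x y f h (α • β) (bwd β • bwd α) _ _).
- abstract (rewrite vcomp_assoc, <- (vcomp_assoc (fwd β)), fwdK, vcomp_id_l;
            apply fwdK).
- abstract (rewrite vcomp_assoc, <- (vcomp_assoc (bwd α)), bwdK, vcomp_id_l;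
            apply bwdK).
Defined.

Definition iso_hcomp (C : bicat) (x y z : C) (g g' : hom y z) (f f' : hom x y)
  (β : iso2 g g') (α : iso2 f f') : iso2 (g ∘ f) (g' ∘ f').
Proof.
refine (@Iso2 C x z _ _ (β ⋆ α) (bwd β ⋆ bwd α) _ _).
- abstract (now rewrite <- interchange, !fwdK, hcomp_id).
- abstract (now rewrite <- interchange, !bwdK, hcomp_id).
Defined.

Definition lunit_iso (C : bicat) (x y : C) (f : hom x y) :
  iso2 (id1 y ∘ f) f := Iso2 (lunitK f) (lunit_invK f).

Definition runit_iso (C : bicat) (x y : C) (f : hom x y) :
  iso2 (f ∘ id1 x) f := Iso2 (runitK f) (runit_invK f).

Definition assoc_iso (C : bicat) (x y z w : C)
  (h : hom z w) (g : hom y z) (f : hom x y) :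
  iso2 ((h ∘ g) ∘ f) (h ∘ (g ∘ f)) := Iso2 (assocK h g f) (assoc_invK h g f).

Definition equivalence_inverse (C : bicat) (x y : C)
  (f : hom x y) (g : hom y x) : Prop :=
  inhabited (iso2 (id1 x) (g ∘ f)) /\ inhabited (iso2 (f ∘ g) (id1 y)).

Definition is_equivalence (C : bicat) (x y : C) (f : hom x y) : Prop :=
  exists g : hom y x, equivalence_inverse f g.

(** A 2-cell is an identity when its source and target are equal 1-cells and
    it is the identity 2-cell transported along this equality. *)

Definition eq2 (C : bicat) (x y : C) (f g : hom x y) (e : f = g) : cell f g :=
  match e in _ = g return cell f g with eq_refl => id2 f end.

Definition is_id2 (C : bicat) (x y : C) (f g : hom x y) (α : cell f g) : Prop :=
  exists e : f = g, α = eq2 e.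

(** A 2-category is a bicategory whose associators and unitors are identities. *)
Record is_2category (C : bicat) : Prop := {
  strict_lunit : forall (x y : C) (f : hom x y), is_id2 (lunit f);
  strict_runit : forall (x y : C) (f : hom x y), is_id2 (runit f);
  strict_assoc : forall (x y z w : C)
    (h : hom z w) (g : hom y z) (f : hom x y), is_id2 (assoc h g f)
}.

(** The data of a pseudofunctor, functorial on 2-cells; the remaining laws are
    [is_pseudofunctor] below. *)
Record pfun (C D : bicat) := Pfun {
  F0 :> C -> D;
  F1 : forall x y : C, hom x y -> hom (F0 x) (F0 y);
  F2 : forall (x y : C) (f g : hom x y), cell f g -> cell (F1 f) (F1 g);
  F2_id : forall (x y : C) (f : hom x y), F2 (id2 f) = id2 (F1 f);
  F2_comp : forall (x y : C) (f g h : hom x y) (α : cell f g) (β : cell g h),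
    F2 (α • β) = F2 α • F2 β;
  Fcomp : forall (x y z : C) (g : hom y z) (f : hom x y),
    iso2 (F1 g ∘ F1 f) (F1 (g ∘ f));
  Fid : forall x : C, iso2 (id1 (F0 x)) (F1 (id1 x))
}.

Arguments F1 {C D} p {x y} f.
Arguments F2 {C D} p {x y f g} α.
Arguments Fcomp {C D} p {x y z} g f.
Arguments Fid {C D} p x.

Record is_pseudofunctor (C D : bicat) (F : pfun C D) : Prop := {
  Fcomp_nat : forall (x y z : C) (g g' : hom y z) (f f' : hom x y)
    (β : cell g g') (α : cell f f'),
    Fcomp F g f • F2 F (β ⋆ α) = (F2 F β ⋆ F2 F α) • Fcomp F g' f';
  Fcomp_assoc : forall (x y z w : C)
    (h : hom z w) (g : hom y z) (f : hom x y),
    (Fcomp F h g ⋆ id2 (F1 F f)) • Fcomp F (h ∘ g) f • F2 F (assoc h g f) =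
    assoc (F1 F h) (F1 F g) (F1 F f)
      • (id2 (F1 F h) ⋆ Fcomp F g f) • Fcomp F h (g ∘ f);
  Fcomp_lunit : forall (x y : C) (f : hom x y),
    (Fid F y ⋆ id2 (F1 F f)) • Fcomp F (id1 y) f • F2 F (lunit f) =
    lunit (F1 F f);
  Fcomp_runit : forall (x y : C) (f : hom x y),
    (id2 (F1 F f) ⋆ Fid F x) • Fcomp F f (id1 x) • F2 F (runit f) =
    runit (F1 F f)
}.

(** Between 2-categories these are the 2-functors. *)
Record is_2functor (C D : bicat) (F : pfun C D) : Prop := {
  twofunctor_pseudo : is_pseudofunctor F;
  strict_Fcomp : forall (x y z : C) (g : hom y z) (f : hom x y),
    is_id2 (Fcomp F g f);
  strict_Fid : forall x : C, is_id2 (Fid F x)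
}.

Definition F_iso (C D : bicat) (F : pfun C D) (x y : C) (f g : hom x y)
  (α : iso2 f g) : iso2 (F1 F f) (F1 F g).
Proof.
refine (@Iso2 D _ _ _ _ (F2 F α) (F2 F (bwd α)) _ _).
- abstract (now rewrite <- F2_comp, fwdK, F2_id).
- abstract (now rewrite <- F2_comp, bwdK, F2_id).
Defined.

Definition pf_id (C : bicat) : pfun C C :=
  @Pfun C C (fun x => x) (fun _ _ f => f) (fun _ _ _ _ α => α)
    (fun _ _ _ => eq_refl) (fun _ _ _ _ _ _ _ => eq_refl)
    (fun _ _ _ g f => iso_id (g ∘ f)) (fun x => iso_id (id1 x)).

Definition pf_const (K C : bicat) (c : C) : pfun K C :=
  @Pfun K C (fun _ => c) (fun _ _ _ => id1 c) (fun _ _ _ _ _ => id2 (id1 c))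
    (fun _ _ _ => eq_refl)
    (fun _ _ _ _ _ _ _ => eq_sym (vcomp_id_l (id2 (id1 c))))
    (fun _ _ _ _ _ => lunit_iso (id1 c)) (fun _ => iso_id (id1 c)).
Arguments pf_const {K C} c.

(** [G] after [F] *)
Definition pf_comp (B C D : bicat) (G : pfun C D) (F : pfun B C) : pfun B D.
Proof.
refine (@Pfun B D (fun x => G (F x)) (fun _ _ f => F1 G (F1 F f))
  (fun _ _ _ _ α => F2 G (F2 F α)) _ _
  (fun _ _ _ g f => iso_comp (Fcomp G (F1 F g) (F1 F f)) (F_iso G (Fcomp F g f)))
  (fun x => iso_comp (Fid G (F x)) (F_iso G (Fid F x)))).
- abstract (intros; cbn; now rewrite !F2_id).
- abstract (intros; cbn; now rewrite !F2_comp).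
Defined.

Definition bicat_prod (C D : bicat) : bicat.
Proof.
refine (@Bicat (C * D)
  (fun x y => (hom (fst x) (fst y) * hom (snd x) (snd y))%type)
  (fun _ _ f g => (cell (fst f) (fst g) * cell (snd f) (snd g))%type)
  (fun x => (id1 (fst x), id1 (snd x)))
  (fun _ _ _ g f => (fst g ∘ fst f, snd g ∘ snd f))
  (fun _ _ f => (id2 (fst f), id2 (snd f)))
  (fun _ _ _ _ _ α β => (fst α • fst β, snd α • snd β))
  (fun _ _ _ _ _ _ _ β α => (fst β ⋆ fst α, snd β ⋆ snd α))
  (fun _ _ f => (lunit (fst f), lunit (snd f)))
  (fun _ _ f => (lunit_inv (fst f), lunit_inv (snd f)))
  (fun _ _ f => (runit (fst f), runit (snd f)))
  (fun _ _ f => (runit_inv (fst f), runit_inv (snd f)))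
  (fun _ _ _ _ h g f =>
     (assoc (fst h) (fst g) (fst f), assoc (snd h) (snd g) (snd f)))
  (fun _ _ _ _ h g f =>
     (assoc_inv (fst h) (fst g) (fst f), assoc_inv (snd h) (snd g) (snd f)))
  _ _ _ _ _ _ _ _ _ _ _ _ _ _ _ _);
abstract (intros; cbn;
repeat match goal with α : prod _ _ |- _ => destruct α end; cbn;
f_equal;
first [ apply vcomp_id_l | apply vcomp_id_r | apply vcomp_assoc
      | apply hcomp_id | apply interchange
      | apply lunitK | apply lunit_invK | apply runitK | apply runit_invK
      | apply assocK | apply assoc_invK
      | apply lunit_nat | apply runit_nat | apply assoc_nat
      | apply triangle | apply pentagon ]).
Defined.

Notation "C × D" := (bicat_prod C D) (at level 40, left associativity)
  : bicat_scope.

Definition pf_fst (C D : bicat) : pfun (C × D) C :=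
  @Pfun (C × D) C fst (fun _ _ f => fst f) (fun _ _ _ _ α => fst α)
    (fun _ _ _ => eq_refl) (fun _ _ _ _ _ _ _ => eq_refl)
    (fun _ _ _ g f => iso_id (fst g ∘ fst f)) (fun x => iso_id (id1 (fst x))).

Definition pf_snd (C D : bicat) : pfun (C × D) D :=
  @Pfun (C × D) D snd (fun _ _ f => snd f) (fun _ _ _ _ α => snd α)
    (fun _ _ _ => eq_refl) (fun _ _ _ _ _ _ _ => eq_refl)
    (fun _ _ _ g f => iso_id (snd g ∘ snd f)) (fun x => iso_id (id1 (snd x))).

Definition pair_iso (C D : bicat) (x y : C × D) (f g : hom x y)
  (α : iso2 (fst f) (fst g)) (β : iso2 (snd f) (snd g)) : iso2 f g.
Proof.
destruct x, y, f, g.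
refine (@Iso2 (C × D) _ _ _ _ (fwd α, fwd β) (bwd α, bwd β) _ _); cbn.
- abstract (now rewrite !fwdK).
- abstract (now rewrite !bwdK).
Defined.

Definition pf_pair (K C D : bicat) (F : pfun K C) (G : pfun K D) :
  pfun K (C × D).
Proof.
refine (@Pfun K (C × D) (fun x => (F x, G x)) (fun _ _ f => (F1 F f, F1 G f))
  (fun _ _ _ _ α => (F2 F α, F2 G α)) _ _
  (fun _ _ _ g f => @pair_iso C D (_, _) (_, _) (_, _) (_, _)
     (Fcomp F g f) (Fcomp G g f))
  (fun x => @pair_iso C D (_, _) (_, _) (_, _) (_, _) (Fid F x) (Fid G x))).
- abstract (intros; cbn; now rewrite !F2_id).
- abstract (intros; cbn; now rewrite !F2_comp).
Defined.

(** The data of a pseudonatural transformation; the laws are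
    [is_pseudonatural]. *)
Record trans (K C : bicat) (F G : pfun K C) := Trans {
  tr :> forall x : K, hom (F x) (G x);
  tr2 : forall (x y : K) (f : hom x y), iso2 (F1 G f ∘ tr x) (tr y ∘ F1 F f)
}.

Arguments tr2 {K C F G} t {x y} f.

Record is_pseudonatural (K C : bicat) (F G : pfun K C) (σ : trans F G) : Prop := {
  tr2_nat : forall (x y : K) (f g : hom x y) (α : cell f g),
    (F2 G α ⋆ id2 (σ x)) • tr2 σ g = tr2 σ f • (id2 (σ y) ⋆ F2 F α);
  tr2_id : forall x : K,
    (Fid G x ⋆ id2 (σ x)) • tr2 σ (id1 x) =
    lunit (σ x) • runit_inv (σ x) • (id2 (σ x) ⋆ Fid F x);
  tr2_comp : forall (x y z : K) (g : hom y z) (f : hom x y),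
    (Fcomp G g f ⋆ id2 (σ x)) • tr2 σ (g ∘ f) =
    assoc (F1 G g) (F1 G f) (σ x)
      • (id2 (F1 G g) ⋆ tr2 σ f)
      • assoc_inv (F1 G g) (σ y) (F1 F f)
      • (tr2 σ g ⋆ id2 (F1 F f))
      • assoc (σ z) (F1 F g) (F1 F f)
      • (id2 (σ z) ⋆ Fcomp F g f)
}.

(** Between 2-functors of 2-categories these are the 2-natural
    transformations. *)
Record is_2natural (K C : bicat) (F G : pfun K C) (σ : trans F G) : Prop := {
  twonatural_pseudo : is_pseudonatural σ;
  strict_tr2 : forall (x y : K) (f : hom x y), is_id2 (tr2 σ f)
}.

Definition is_2natural_iso (K C : bicat) (F G : pfun K C) (σ : trans F G) : Prop :=
  is_2natural σ /\
  forall x : K, exists g : hom (G x) (F x),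
    g ∘ σ x = id1 (F x) /\ σ x ∘ g = id1 (G x).

Definition tid (K C : bicat) (F : pfun K C) : trans F F :=
  @Trans K C F F (fun x => id1 (F x))
    (fun _ _ f => iso_comp (runit_iso (F1 F f)) (iso_inv (lunit_iso (F1 F f)))).

(** [σ ;; τ] is "[σ], then [τ]" *)
Definition tcomp (K C : bicat) (F G H : pfun K C)
  (σ : trans F G) (τ : trans G H) : trans F H :=
  @Trans K C F H (fun x => τ x ∘ σ x)
    (fun x y f =>
       iso_comp (iso_inv (assoc_iso (F1 H f) (τ x) (σ x)))
      (iso_comp (iso_hcomp (tr2 τ f) (iso_id (σ x)))
      (iso_comp (assoc_iso (τ y) (F1 G f) (σ x))
      (iso_comp (iso_hcomp (iso_id (τ y)) (tr2 σ f))
                (iso_inv (assoc_iso (τ y) (σ y) (F1 F f))))))).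

Notation "σ ;; τ" := (tcomp σ τ) (at level 57, right associativity)
  : bicat_scope.

Record modif (K C : bicat) (F G : pfun K C) (σ τ : trans F G) := Modif {
  md :> forall x : K, iso2 (σ x) (τ x);
  md_nat : forall (x y : K) (f : hom x y),
    (id2 (F1 G f) ⋆ md x) • tr2 τ f = tr2 σ f • (md y ⋆ id2 (F1 F f))
}.

(** A path is a composable list of 1-cells in diagrammatic order.  [pcomp]
    composes a path, bracketed as in [(h ∘ g) ∘ f], with [pcomp [f] = f].
    2-cells are whiskered and composed between composites of paths; the
    coherence isomorphisms are inserted by [pjoin] and [pmap_comp]. *)

Inductive path (C : bicat) : C -> C -> Type :=
| pnil : forall x, path x x
| pcons : forall x y z, hom x y -> path y z -> path x z.

Arguments pnil {C x}.
Arguments pcons {C x y z} f p.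

Declare Scope path_scope.
Delimit Scope path_scope with path.
Bind Scope path_scope with path.
Notation "[ ]" := pnil : path_scope.
Notation "[ f ; .. ; g ]" := (pcons f .. (pcons g pnil) ..) : path_scope.

Fixpoint papp (C : bicat) (x y z : C) (p : path x y) : path y z -> path x z :=
  match p with
  | pnil => fun q => q
  | pcons f p' => fun q => pcons f (papp p' q)
  end.

Definition extend (C : bicat) (x y z : C) (p : path y z) :
  hom y z -> hom x y -> hom x z :=
  match p in path y z return hom y z -> hom x y -> hom x z with
  | pnil => fun _ f => f
  | pcons _ _ => fun g f => g ∘ f
  end.

Fixpoint pcomp (C : bicat) (x y : C) (p : path x y) : hom x y :=
  match p with
  | pnil => id1 _
  | pcons f p' => extend p' (pcomp p') f
  end.
Arguments pcomp {C x y} p%_path.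

Definition pcons_iso (C : bicat) (x y z : C) (f : hom x y) (p : path y z) :
  iso2 (pcomp p ∘ f) (pcomp (pcons f p)) :=
  match p in path y z
    return forall f : hom x y, iso2 (pcomp p ∘ f) (pcomp (pcons f p)) with
  | pnil => fun f => lunit_iso f
  | pcons g p' => fun f => iso_id _
  end f.

Fixpoint pjoin (C : bicat) (x y z : C) (u : path x y) :
  forall p : path y z, iso2 (pcomp p ∘ pcomp u) (pcomp (papp u p)) :=
  match u in path x y
    return forall p : path y z, iso2 (pcomp p ∘ pcomp u) (pcomp (papp u p)) with
  | pnil => fun p => runit_iso (pcomp p)
  | pcons f u' => fun p =>
      iso_comp (iso_hcomp (iso_id (pcomp p)) (iso_inv (pcons_iso f u')))
     (iso_comp (iso_inv (assoc_iso (pcomp p) (pcomp u') f))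
     (iso_comp (iso_hcomp (pjoin u' p) (iso_id f))
               (pcons_iso f (papp u' p))))
  end.

Definition pcell (C : bicat) (x y : C) (p q : path x y) := iso2 (pcomp p) (pcomp q).
Arguments pcell {C x y} p%_path q%_path.

Declare Scope paste_scope.
Delimit Scope paste_scope with paste.
Bind Scope paste_scope with pcell.

Definition pvcomp (C : bicat) (x y : C) (p q r : path x y)
  (α : pcell p q) (β : pcell q r) : pcell p r := iso_comp α β.
Arguments pvcomp {C x y p q r} & α β.

Definition pinv (C : bicat) (x y : C) (p q : path x y) (α : pcell p q) :
  pcell q p := iso_inv α.

(** [α] applied after a first 1-cell [f] which is left unchanged *)
Definition skip (C : bicat) (x y z : C) (f : hom x y) (p q : path y z)
  (α : pcell p q) : pcell (pcons f p) (pcons f q) :=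
  iso_comp (iso_inv (pcons_iso f p))
 (iso_comp (iso_hcomp α (iso_id f))
           (pcons_iso f q)).
Arguments skip {C x y z f p q} & α.

(** [α] applied to an initial segment of a path; the remaining 1-cells [v] are
    left unchanged *)
Definition here (C : bicat) (x y z : C) (p q : path x y) (v : path y z)
  (α : pcell p q) : pcell (papp p v) (papp q v) :=
  iso_comp (iso_inv (pjoin p v))
 (iso_comp (iso_hcomp (iso_id (pcomp v)) α)
           (pjoin q v)).
Arguments here {C x y z p q v} α.

(** [α @@ n] applies [α] after [n] unchanged 1-cells; [>>] is vertical
    composition, in the order of rewriting. *)
Notation "α >> β" := (pvcomp α β) (at level 60, right associativity) : paste_scope.
Notation "α @@ 0" := (here α) (at level 55) : paste_scope.
Notation "α @@ 1" := (skip (here α)) (at level 55) : paste_scope.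
Notation "α @@ 2" := (skip (skip (here α))) (at level 55) : paste_scope.
Notation "α @@ 3" := (skip (skip (skip (here α)))) (at level 55) : paste_scope.
Notation "α @@ 4" := (skip (skip (skip (skip (here α))))) (at level 55)
  : paste_scope.
Notation "α @@ 5" := (skip (skip (skip (skip (skip (here α)))))) (at level 55)
  : paste_scope.
Notation "α @@ 6" := (skip (skip (skip (skip (skip (skip (here α)))))))
  (at level 55) : paste_scope.
Notation "α @@ 7" := (skip (skip (skip (skip (skip (skip (skip (here α))))))))
  (at level 55) : paste_scope.
Notation "α @@ 8" :=
  (skip (skip (skip (skip (skip (skip (skip (skip (here α)))))))))
  (at level 55) : paste_scope.
Notation "α ^-1" := (pinv α) (at level 3, left associativity, format "α ^-1") : paste_scope.

Definition eq_pcell (C : bicat) (x y : C) (p q : path x y) (α β : pcell p q) : Prop :=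
  fwd α = fwd β.
Arguments eq_pcell {C x y} p%_path q%_path α%_paste β%_paste.

(** The image of a 2-cell between paths under a pseudofunctor *)
Fixpoint pmap (C D : bicat) (F : pfun C D) (x y : C) (p : path x y) :
  path (F x) (F y) :=
  match p with
  | pnil => pnil
  | pcons f p' => pcons (F1 F f) (pmap F p')
  end.

Fixpoint pmap_comp (C D : bicat) (F : pfun C D) (x y : C) (p : path x y) :
  iso2 (pcomp (pmap F p)) (F1 F (pcomp p)) :=
  match p return iso2 (pcomp (pmap F p)) (F1 F (pcomp p)) with
  | pnil => Fid F _
  | pcons f p' =>
      iso_comp (iso_inv (pcons_iso (F1 F f) (pmap F p')))
     (iso_comp (iso_hcomp (pmap_comp F p') (iso_id (F1 F f)))
     (iso_comp (Fcomp F (pcomp p') f)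
               (F_iso F (pcons_iso f p'))))
  end.

Definition pmap_cell (C D : bicat) (F : pfun C D) (x y : C) (p q : path x y)
  (α : pcell p q) : pcell (pmap F p) (pmap F q) :=
  iso_comp (pmap_comp F p) (iso_comp (F_iso F α) (iso_inv (pmap_comp F q))).

Record adj_equiv (K C : bicat) (F G : pfun K C) (σ : trans F G) := AdjEquiv {
  ae_pseudo : is_pseudonatural σ;
  ae_inv : trans G F;
  ae_inv_pseudo : is_pseudonatural ae_inv;
  ae_unit : modif (tid F) (σ ;; ae_inv);
  ae_counit : modif (ae_inv ;; σ) (tid G);
  ae_triangle_l : forall x : K,
    let η : pcell [ ] [σ x; ae_inv x] := ae_unit x in
    let ε : pcell [ae_inv x; σ x] [ ] := ae_counit x in
    eq_pcell [σ x] [σ x] (η @@ 0 >> ε @@ 1) (iso_id (σ x));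
  ae_triangle_r : forall x : K,
    let η : pcell [ ] [σ x; ae_inv x] := ae_unit x in
    let ε : pcell [ae_inv x; σ x] [ ] := ae_counit x in
    eq_pcell [ae_inv x] [ae_inv x] (η @@ 1 >> ε @@ 0) (iso_id (ae_inv x))
}.

Definition ob1 (K : bicat) : pfun K K := pf_id K.
Definition ob21 (K : bicat) : pfun (K × K) K := pf_fst K K.
Definition ob22 (K : bicat) : pfun (K × K) K := pf_snd K K.
Definition ob31 (K : bicat) : pfun (K × K × K) K :=
  pf_comp (pf_fst K K) (pf_fst (K × K) K).
Definition ob32 (K : bicat) : pfun (K × K × K) K :=
  pf_comp (pf_snd K K) (pf_fst (K × K) K).
Definition ob33 (K : bicat) : pfun (K × K × K) K := pf_snd (K × K) K.
Definition ob41 (K : bicat) : pfun (K × K × K × K) K :=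
  pf_comp (ob31 K) (pf_fst (K × K × K) K).
Definition ob42 (K : bicat) : pfun (K × K × K × K) K :=
  pf_comp (ob32 K) (pf_fst (K × K × K) K).
Definition ob43 (K : bicat) : pfun (K × K × K × K) K :=
  pf_comp (ob33 K) (pf_fst (K × K × K) K).
Definition ob44 (K : bicat) : pfun (K × K × K × K) K := pf_snd (K × K × K) K.

Arguments ob1 {K}.  Arguments ob21 {K}. Arguments ob22 {K}.
Arguments ob31 {K}. Arguments ob32 {K}. Arguments ob33 {K}.
Arguments ob41 {K}. Arguments ob42 {K}. Arguments ob43 {K}. Arguments ob44 {K}.

(** [x ↦ F x ⊗ G x] *)
Definition pf_tens (J K : bicat) (T : pfun (K × K) K) (F G : pfun J K) : pfun J K :=
  pf_comp T (pf_pair F G).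

(** The data common to skew monoidal 2-categories and monoidal bicategories *)
Record monoidal_data (K : bicat) := MonoidalData {
  tensor : pfun (K × K) K;
  munit : K;
  massoc : trans (pf_tens tensor (pf_tens tensor ob31 ob32) ob33)
                 (pf_tens tensor ob31 (pf_tens tensor ob32 ob33));
  mleft : trans (pf_tens tensor (pf_const munit) ob1) ob1;
  mright : trans ob1 (pf_tens tensor ob1 (pf_const munit))
}.

Definition tens0 (K : bicat) (M : monoidal_data K) (A B : K) : K :=
  tensor M (A, B).

Definition tens1 (K : bicat) (M : monoidal_data K) (A A' B B' : K)
  (f : hom A A') (g : hom B B') : hom (tens0 M A B) (tens0 M A' B') :=
  @F1 _ _ (tensor M) (A, B) (A', B') (f, g).

Definition tens2 (K : bicat) (M : monoidal_data K) (A A' B B' : K)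
  (f f' : hom A A') (g g' : hom B B') (α : iso2 f f') (β : iso2 g g') :
  iso2 (tens1 M f g) (tens1 M f' g') :=
  F_iso (tensor M) (@pair_iso K K (A, B) (A', B') (f, g) (f', g') α β).

Definition ac (K : bicat) (M : monoidal_data K) (A B C : K) :
  hom (tens0 M (tens0 M A B) C) (tens0 M A (tens0 M B C)) := massoc M (A, B, C).
Definition lc (K : bicat) (M : monoidal_data K) (A : K) :
  hom (tens0 M (munit M) A) A := mleft M A.
Definition rc (K : bicat) (M : monoidal_data K) (A : K) :
  hom A (tens0 M A (munit M)) := mright M A.

Notation "A ⊗[ M ] B" := (tens0 M A B) (at level 39, left associativity,
  format "A  ⊗[ M ]  B") : bicat_scope.
Notation "f ⊠[ M ] g" := (tens1 M f g) (at level 39, left associativity,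
  format "f  ⊠[ M ]  g") : bicat_scope.

(** [A ⊗ -] and [- ⊗ B], acting on 1-cells by tensoring with an identity *)
Definition ltens (K : bicat) (M : monoidal_data K) (A : K) : pfun K K :=
  pf_tens (tensor M) (pf_const A) ob1.
Definition rtens (K : bicat) (M : monoidal_data K) (B : K) : pfun K K :=
  pf_tens (tensor M) ob1 (pf_const B).

Record is_skew_monoidal_2category (K : bicat) (M : monoidal_data K) : Prop := {
  skew_2category : is_2category K;
  skew_tensor : is_2functor (tensor M);
  skew_assoc : is_2natural (massoc M);
  skew_left : is_2natural (mleft M);
  skew_right : is_2natural (mright M);
  skew_pentagon : forall A B C D : K,
    ac M A B (C ⊗[M] D) ∘ ac M (A ⊗[M] B) C D =
    (id1 A ⊠[M] ac M B C D) ∘ ac M A (B ⊗[M] C) D ∘ (ac M A B C ⊠[M] id1 D);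
  skew_left_triangle : forall A B : K,
    lc M (A ⊗[M] B) ∘ ac M (munit M) A B = lc M A ⊠[M] id1 B;
  skew_middle_triangle : forall A B : K,
    (id1 A ⊠[M] lc M B) ∘ ac M A (munit M) B ∘ (rc M A ⊠[M] id1 B) =
    id1 (A ⊗[M] B);
  skew_right_triangle : forall A B : K,
    ac M A B (munit M) ∘ rc M (A ⊗[M] B) = id1 A ⊠[M] rc M B;
  skew_unit : lc M (munit M) ∘ rc M (munit M) = id1 (munit M)
}.

Definition symmetry_data (K : bicat) (M : monoidal_data K) : Type :=
  trans (pf_tens (tensor M) (pf_tens (tensor M) ob31 ob32) ob33)
        (pf_tens (tensor M) (pf_tens (tensor M) ob31 ob33) ob32).

Definition sc (K : bicat) (M : monoidal_data K) (s : symmetry_data M) (X A B : K) :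
  hom (X ⊗[M] A ⊗[M] B) (X ⊗[M] B ⊗[M] A) := s (X, A, B).

Record is_symmetry (K : bicat) (M : monoidal_data K) (s : symmetry_data M) : Prop := {
  sym_2natural_iso : is_2natural_iso s;
  sym_B1 : forall X A B C : K,
    sc s (X ⊗[M] C) A B ∘ (sc s X A C ⊠[M] id1 B) ∘ sc s (X ⊗[M] A) B C =
    (sc s X B C ⊠[M] id1 A) ∘ sc s (X ⊗[M] B) A C ∘ (sc s X A B ⊠[M] id1 C);
  sym_B2 : forall X A B C : K,
    sc s X A (B ⊗[M] C) ∘ ac M (X ⊗[M] A) B C =
    (ac M X B C ⊠[M] id1 A) ∘ sc s (X ⊗[M] B) A C ∘ (sc s X A B ⊠[M] id1 C);
  sym_B3 : forall X A B C : K,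
    sc s X (A ⊗[M] B) C ∘ (ac M X A B ⊠[M] id1 C) =
    ac M (X ⊗[M] C) A B ∘ (sc s X A C ⊠[M] id1 B) ∘ sc s (X ⊗[M] A) B C;
  sym_B4 : forall X A B C : K,
    (id1 X ⊠[M] sc s A B C) ∘ ac M X (A ⊗[M] B) C ∘ (ac M X A B ⊠[M] id1 C) =
    ac M X (A ⊗[M] C) B ∘ (ac M X A C ⊠[M] id1 B) ∘ sc s (X ⊗[M] A) B C;
  sym_Sym : forall X A B : K,
    sc s X B A ∘ sc s X A B = id1 (X ⊗[M] A ⊗[M] B)
}.

Section MonoidalBicategory.

Context {K : bicat} (M : monoidal_data K).

Local Notation I := (munit M).
Local Notation "A ⊗ B" := (tens0 M A B) (at level 39, left associativity).
Local Notation "F ⊗p G" := (pf_tens (tensor M) F G) (at level 39, left associativity).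
(* a 1-cell tensored with an identity *)
Local Notation "A ◁ f" := (F1 (ltens M A) f) (at level 38, right associativity).
Local Notation "f ▷ B" := (F1 (rtens M B) f) (at level 37, left associativity).
(* a 2-cell between paths tensored with an identity *)
Local Notation "A ◀ α" := (pmap_cell (ltens M A) α) (at level 38, right associativity).
Local Notation "α ▶ B" := (pmap_cell (rtens M B) α) (at level 37, left associativity).

Definition ttens (J : bicat) (F F' G G' : pfun J K)
  (σ : trans F F') (τ : trans G G') : trans (F ⊗p G) (F' ⊗p G') :=
  @Trans J K (F ⊗p G) (F' ⊗p G') (fun x => tens1 M (σ x) (τ x))
    (fun x y f =>
       iso_comp (@Fcomp _ _ (tensor M) (_, _) (_, _) (_, _)
                   (F1 F' f, F1 G' f) (σ x, τ x))
      (iso_comp (tens2 M (tr2 σ f) (tr2 τ f))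
                (iso_inv (@Fcomp _ _ (tensor M) (_, _) (_, _) (_, _)
                   (σ y, τ y) (F1 F f, F1 G f))))).

Local Notation "σ ⊗t τ" := (ttens σ τ) (at level 39, left associativity).

(** The constraints at pseudofunctors [F], [G], [H] in place of objects *)
Definition ta (J : bicat) (F G H : pfun J K) : trans (F ⊗p G ⊗p H) (F ⊗p (G ⊗p H)) :=
  @Trans J K (F ⊗p G ⊗p H) (F ⊗p (G ⊗p H)) (fun x => massoc M (F x, G x, H x))
    (fun x y f => @tr2 _ _ _ _ (massoc M) (F x, G x, H x) (F y, G y, H y)
                    (F1 F f, F1 G f, F1 H f)).
Definition tl (J : bicat) (F : pfun J K) : trans (pf_const I ⊗p F) F :=
  @Trans J K (pf_const I ⊗p F) F (fun x => mleft M (F x))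
    (fun x y f => tr2 (mleft M) (F1 F f)).
Definition tr_ (J : bicat) (F : pfun J K) : trans F (F ⊗p pf_const I) :=
  @Trans J K F (F ⊗p pf_const I) (fun x => mright M (F x))
    (fun x y f => tr2 (mright M) (F1 F f)).

Local Notation a := (ac M).
Local Notation l := (lc M).
Local Notation r := (rc M).

(** Naturality of the associator in one variable: [f] moves past [a] *)
Definition a_nat1 (A A' : K) (f : hom A A') (B C : K) :
  pcell [f ▷ B ▷ C; a A' B C] [a A B C; f ▷ (B ⊗ C)] :=
  iso_comp (iso_inv (@tr2 _ _ _ _ (massoc M) (A, B, C) (A', B, C) (f, id1 B, id1 C)))
    (iso_hcomp (tens2 M (iso_id f) (iso_inv (Fid (tensor M) (B, C))))
               (iso_id (a A B C))).
Definition a_nat2 (A B B' : K) (f : hom B B') (C : K) :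
  pcell [(A ◁ f) ▷ C; a A B' C] [a A B C; A ◁ (f ▷ C)] :=
  iso_inv (@tr2 _ _ _ _ (massoc M) (A, B, C) (A, B', C) (id1 A, f, id1 C)).
Definition a_nat3 (A B C C' : K) (f : hom C C') :
  pcell [(A ⊗ B) ◁ f; a A B C'] [a A B C; A ◁ (B ◁ f)] :=
  iso_comp (iso_hcomp (iso_id (a A B C'))
                      (tens2 M (Fid (tensor M) (A, B)) (iso_id f)))
    (iso_inv (@tr2 _ _ _ _ (massoc M) (A, B, C) (A, B, C') (id1 A, id1 B, f))).

(** [f] on the left factor and [g] on the right factor commute *)
Definition tens_exchange (A A' B B' : K) (f : hom A A') (g : hom B B') :
  pcell [f ▷ B; A' ◁ g] [A ◁ g; f ▷ B'] :=
  iso_comp (@Fcomp _ _ (tensor M) (A, B) (A', B) (A', B') (id1 A', g) (f, id1 B))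
 (iso_comp (tens2 M (iso_comp (lunit_iso f) (iso_inv (runit_iso f)))
                    (iso_comp (runit_iso g) (iso_inv (lunit_iso g))))
           (iso_inv (@Fcomp _ _ (tensor M) (A, B) (A, B') (A', B')
                       (f, id1 B') (id1 A, g)))).

(** Monoidal bicategories as tricategories with one object; as in Gordon, Power
    and Street the right unit constraint is directed [A -> A I]. *)
Record monoidal_bicategory := MonoidalBicategory {
  mb_tensor : is_pseudofunctor (tensor M);
  mb_a : adj_equiv (massoc M);
  mb_l : adj_equiv (mleft M);
  mb_r : adj_equiv (mright M);
  mb_π : modif (ta ob41 ob42 ob43 ⊗t tid _ ;; ta ob41 (ob42 ⊗p ob43) ob44
                  ;; tid _ ⊗t ta ob42 ob43 ob44)
               (ta (ob41 ⊗p ob42) ob43 ob44 ;; ta ob41 ob42 (ob43 ⊗p ob44));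
  mb_μ : modif (tr_ ob21 ⊗t tid _ ;; ta ob21 (pf_const I) ob22 ;; tid _ ⊗t tl ob22)
               (tid (ob21 ⊗p ob22));
  mb_λ : modif (tl ob21 ⊗t tid ob22)
               (ta (pf_const I) ob21 ob22 ;; tl (ob21 ⊗p ob22));
  mb_ρ : modif (tid ob21 ⊗t tr_ ob22)
               (tr_ (ob21 ⊗p ob22) ;; ta ob21 ob22 (pf_const I));

  π (A B C D : K) :
    pcell [a A B C ▷ D; a A (B ⊗ C) D; A ◁ a B C D]
          [a (A ⊗ B) C D; a A B (C ⊗ D)] := mb_π (A, B, C, D);
  μ (A B : K) : pcell [r A ▷ B; a A I B; A ◁ l B] [ ] := mb_μ (A, B);
  lam (A B : K) : pcell [l A ▷ B] [a I A B; l (A ⊗ B)] := mb_λ (A, B);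
  ρ (A B : K) : pcell [A ◁ r B] [r (A ⊗ B); a A B I] := mb_ρ (A, B);

  (* the non-abelian 4-cocycle condition *)
  mb_cocycle : forall A B C D E : K,
    eq_pcell
      [a A B C ▷ D ▷ E; a A (B ⊗ C) D ▷ E; (A ◁ a B C D) ▷ E;
       a A (B ⊗ (C ⊗ D)) E; A ◁ a B (C ⊗ D) E; A ◁ (B ◁ a C D E)]
      [a (A ⊗ B ⊗ C) D E; a (A ⊗ B) C (D ⊗ E); a A B (C ⊗ (D ⊗ E))]
      (π A B C D ▶ E @@ 0 >> π A B (C ⊗ D) E @@ 1
         >> (a_nat3 A B (a C D E))^-1 @@ 2 >> π (A ⊗ B) C D E @@ 0)
      (a_nat2 A (a B C D) E @@ 2 >> A ◀ π B C D E @@ 3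
         >> π A (B ⊗ C) D E @@ 1 >> a_nat1 (a A B C) D E @@ 0
         >> π A B C (D ⊗ E) @@ 1);
  mb_left_norm : forall A B C : K,
    eq_pcell
      [r A ▷ B ▷ C; a A I B ▷ C; a A (I ⊗ B) C; A ◁ a I B C; A ◁ l (B ⊗ C)]
      [a A B C]
      (π A I B C @@ 1 >> a_nat1 (r A) B C @@ 0 >> μ A (B ⊗ C) @@ 1)
      (A ◀ (lam B C)^-1 @@ 3 >> (a_nat2 A (l B) C)^-1 @@ 2 >> μ A B ▶ C @@ 0);
  mb_right_norm : forall A B C : K,
    eq_pcell
      [(A ◁ r B) ▷ C; a A (B ⊗ I) C; A ◁ a B I C; A ◁ (B ◁ l C)]
      [a A B C]
      (ρ A B ▶ C @@ 0 >> π A B I C @@ 1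
         >> (a_nat3 A B (l C))^-1 @@ 2 >> μ (A ⊗ B) C @@ 0)
      (a_nat2 A (r B) C @@ 0 >> A ◀ μ B C @@ 1)
}.

(** The adjoint inverse [a*] of the associator, as part of the structure *)
Section AssociatorInverse.

Context (V : monoidal_bicategory).

Definition massoc_inv := ae_inv (mb_a V).

Definition tas (J : bicat) (F G H : pfun J K) : trans (F ⊗p (G ⊗p H)) (F ⊗p G ⊗p H) :=
  @Trans J K (F ⊗p (G ⊗p H)) (F ⊗p G ⊗p H) (fun x => massoc_inv (F x, G x, H x))
    (fun x y f => @tr2 _ _ _ _ massoc_inv (F x, G x, H x) (F y, G y, H y)
                    (F1 F f, F1 G f, F1 H f)).

Definition asc (A B C : K) : hom (A ⊗ (B ⊗ C)) (A ⊗ B ⊗ C) := massoc_inv (A, B, C).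

Local Notation "a*" := asc.

Definition η (A B C : K) : pcell [ ] [a A B C; a* A B C] := ae_unit (mb_a V) (A, B, C).
Definition ε (A B C : K) : pcell [a* A B C; a A B C] [ ] := ae_counit (mb_a V) (A, B, C).

Definition as_nat1 (A A' : K) (f : hom A A') (B C : K) :
  pcell [f ▷ (B ⊗ C); a* A' B C] [a* A B C; f ▷ B ▷ C] :=
  iso_comp (iso_hcomp (iso_id (a* A' B C))
                      (tens2 M (iso_id f) (Fid (tensor M) (B, C))))
    (iso_inv (@tr2 _ _ _ _ massoc_inv (A, B, C) (A', B, C) (f, id1 B, id1 C))).
Definition as_nat2 (A B B' : K) (f : hom B B') (C : K) :
  pcell [A ◁ (f ▷ C); a* A B' C] [a* A B C; (A ◁ f) ▷ C] :=
  iso_inv (@tr2 _ _ _ _ massoc_inv (A, B, C) (A, B', C) (id1 A, f, id1 C)).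
Definition as_nat3 (A B C C' : K) (f : hom C C') :
  pcell [A ◁ (B ◁ f); a* A B C'] [a* A B C; (A ⊗ B) ◁ f] :=
  iso_comp (iso_inv (@tr2 _ _ _ _ massoc_inv (A, B, C) (A, B, C') (id1 A, id1 B, f)))
    (iso_hcomp (tens2 M (iso_inv (Fid (tensor M) (A, B))) (iso_id f))
               (iso_id (a* A B C))).

(** Mates of [π] with respect to the adjunctions between [a] and [a*] *)
Definition π1 (A B C D : K) :
  pcell [A ◁ a* B C D; a* A (B ⊗ C) D; a* A B C ▷ D]
        [a* A B (C ⊗ D); a* (A ⊗ B) C D] :=
  (η (A ⊗ B) C D @@ 3 >> η A B (C ⊗ D) @@ 4 >> (π V A B C D)^-1 @@ 3
     >> ε A B C ▶ D @@ 2 >> ε A (B ⊗ C) D @@ 1 >> A ◀ ε B C D @@ 0)%paste.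
Definition π2 (A B C D : K) :
  pcell [A ◁ a B C D; a* A B (C ⊗ D)]
        [a* A (B ⊗ C) D; a* A B C ▷ D; a (A ⊗ B) C D] :=
  ((ε (A ⊗ B) C D)^-1 @@ 2 >> (π1 A B C D)^-1 @@ 1
     >> (A ◀ η B C D)^-1 @@ 0)%paste.
Definition π3 (A B C D : K) :
  pcell [a* (A ⊗ B) C D; a A B C ▷ D]
        [a A B (C ⊗ D); A ◁ a* B C D; a* A (B ⊗ C) D] :=
  (η A B (C ⊗ D) @@ 0 >> (π1 A B C D)^-1 @@ 1 >> ε A B C ▶ D @@ 3)%paste.
Definition π4 (A B C D : K) :
  pcell [A ◁ a B C D; a* A B (C ⊗ D); a* (A ⊗ B) C D; a A B C ▷ D]
        [a* A (B ⊗ C) D] :=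
  ((π1 A B C D)^-1 @@ 1 >> (A ◀ η B C D)^-1 @@ 0 >> ε A B C ▶ D @@ 1)%paste.
Definition π5 (A B C D : K) :
  pcell [a* A B C ▷ D; a (A ⊗ B) C D; a A B (C ⊗ D); A ◁ a* B C D]
        [a A (B ⊗ C) D] :=
  ((π V A B C D)^-1 @@ 1 >> ε A B C ▶ D @@ 0 >> (A ◀ η B C D)^-1 @@ 1)%paste.

End AssociatorInverse.

Definition braiding_data := trans (ob21 ⊗p ob22) (ob22 ⊗p ob21).

Definition tb (b : braiding_data) (J : bicat) (F G : pfun J K) :
  trans (F ⊗p G) (G ⊗p F) :=
  @Trans J K (F ⊗p G) (G ⊗p F) (fun x => b (F x, G x))
    (fun x y f => @tr2 _ _ _ _ b (F x, G x) (F y, G y) (F1 F f, F1 G f)).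

Definition bc (b : braiding_data) (A B : K) : hom (A ⊗ B) (B ⊗ A) := b (A, B).

Definition b_nat1 (b : braiding_data) (A A' : K) (f : hom A A') (B : K) :
  pcell [f ▷ B; bc b A' B] [bc b A B; B ◁ f] :=
  iso_inv (@tr2 _ _ _ _ b (A, B) (A', B) (f, id1 B)).
Definition b_nat2 (b : braiding_data) (A B B' : K) (g : hom B B') :
  pcell [A ◁ g; bc b A B'] [bc b A B; g ▷ A] :=
  iso_inv (@tr2 _ _ _ _ b (A, B) (A, B') (id1 A, g)).

Record braided_data := BraidedData {
  bd_monoidal :> monoidal_bicategory;
  bd_b : braiding_data;
  bd_b_equiv : adj_equiv bd_b;
  bd_R : modif (tb bd_b ob31 ob32 ⊗t tid ob33 ;; ta ob32 ob31 ob33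
                   ;; tid ob32 ⊗t tb bd_b ob31 ob33)
                (ta ob31 ob32 ob33 ;; tb bd_b ob31 (ob32 ⊗p ob33)
                   ;; ta ob32 ob33 ob31);
  bd_S : modif (tid ob31 ⊗t tb bd_b ob32 ob33 ;; tas bd_monoidal ob31 ob33 ob32
                   ;; tb bd_b ob31 ob33 ⊗t tid ob32)
                (tas bd_monoidal ob31 ob32 ob33 ;; tb bd_b (ob31 ⊗p ob32) ob33
                   ;; tas bd_monoidal ob33 ob31 ob32)
}.

Definition hexR (X : braided_data) (A B C : K) :
  pcell [bc (bd_b X) A B ▷ C; a B A C; B ◁ bc (bd_b X) A C]
        [a A B C; bc (bd_b X) A (B ⊗ C); a B C A] := bd_R X (A, B, C).
Definition hexS (X : braided_data) (A B C : K) :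
  pcell [A ◁ bc (bd_b X) B C; asc X A C B; bc (bd_b X) A C ▷ B]
        [asc X A B C; bc (bd_b X) (A ⊗ B) C; asc X C A B] := bd_S X (A, B, C).

Section Laws.

Context (X : braided_data).
Local Notation V := (bd_monoidal X).
Local Notation b := (bc (bd_b X)).
Local Notation R := (hexR X).
Local Notation S := (hexS X).
Local Notation "a*" := (asc V).
Local Notation b_nat1 := (b_nat1 (bd_b X)).
Local Notation b_nat2 := (b_nat2 (bd_b X)).

Record is_braided : Prop := {
  (* moving [A] past [B], [C], [D] *)
  br_A_BCD : forall A B C D : K,
    eq_pcell
      [b A B ▷ C ▷ D; a B A C ▷ D; (B ◁ b A C) ▷ D; a B (C ⊗ A) D;
       B ◁ a C A D; B ◁ (C ◁ b A D)]
      [a (A ⊗ B) C D; a A B (C ⊗ D); b A (B ⊗ (C ⊗ D)); a B (C ⊗ D) A; B ◁ a C D A]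
      (R A B C ▶ D @@ 0 >> π V B C A D @@ 2 >> (a_nat3 B C (b A D))^-1 @@ 3
         >> R A (B ⊗ C) D @@ 1 >> (π V B C D A)^-1 @@ 3
         >> (b_nat2 A (a B C D))^-1 @@ 2 >> π V A B C D @@ 0)
      (a_nat2 B (b A C) D @@ 2 >> B ◀ R A C D @@ 3 >> π V B A C D @@ 1
         >> a_nat1 (b A B) C D @@ 0 >> R A B (C ⊗ D) @@ 1);
  (* moving [A], [B], [C] past [D] *)
  br_ABC_D : forall A B C D : K,
    eq_pcell
      [A ◁ (B ◁ b C D); A ◁ a* B D C; A ◁ (b B D ▷ C); a* A (D ⊗ B) C;
       a* A D B ▷ C; b A D ▷ B ▷ C]
      [a* A B (C ⊗ D); a* (A ⊗ B) C D; b (A ⊗ B ⊗ C) D; a* D (A ⊗ B) C;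
       a* D A B ▷ C]
      (A ◀ S B C D @@ 0 >> π1 V A D B C @@ 2 >> (as_nat1 V (b A D) B C)^-1 @@ 3
         >> S A (B ⊗ C) D @@ 1 >> (π1 V D A B C)^-1 @@ 3
         >> (b_nat1 (a* A B C) D)^-1 @@ 2 >> π1 V A B C D @@ 0)
      (as_nat2 V A (b B D) C @@ 2 >> S A B D ▶ C @@ 3 >> π1 V A B D C @@ 1
         >> as_nat3 V A B (b C D) @@ 0 >> S (A ⊗ B) C D @@ 1);
  (* moving [A], [B] past [C], [D] *)
  br_AB_CD : forall A B C D : K,
    eq_pcell
      [A ◁ (b B C ▷ D); A ◁ a C B D; A ◁ (C ◁ b B D); a* A C (D ⊗ B);
       a* (A ⊗ C) D B; b A C ▷ D ▷ B; a C A D ▷ B; (C ◁ b A D) ▷ B]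
      [A ◁ a B C D; a* A B (C ⊗ D); b (A ⊗ B) (C ⊗ D); a* (C ⊗ D) A B; a C D A ▷ B]
      (A ◀ R B C D @@ 0 >> R A C D ▶ B @@ 5 >> π4 V A C D B @@ 2
         >> S A B (C ⊗ D) @@ 1)
      (as_nat3 V A C (b B D) @@ 2 >> (as_nat1 V (b A C) D B)^-1 @@ 4
         >> (tens_exchange (b A C) (b B D))^-1 @@ 3
         >> π2 V A C B D @@ 1 >> as_nat2 V A (b B C) D @@ 0
         >> (a_nat1 (b A C) B D)^-1 @@ 3 >> S A B C ▶ D @@ 1
         >> π3 V C A D B @@ 6 >> a_nat3 C A (b B D) @@ 5
         >> (as_nat2 V C (b A D) B)^-1 @@ 8
         >> C ◀ S A B D @@ 6 >> π5 V C A B D @@ 3 >> R (A ⊗ B) C D @@ 2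
         >> (π2 V A B C D)^-1 @@ 0 >> (π3 V C D A B)^-1 @@ 3);
  (* the two proofs of the Yang-Baxter equation agree *)
  br_YB : forall A B C : K,
    eq_pcell
      [b A B ▷ C; a B A C; B ◁ b A C; a* B C A; b B C ▷ A; a C B A]
      [a A B C; A ◁ b B C; a* A C B; b A C ▷ B; a C A B; C ◁ b A B]
      (R A B C @@ 0 >> (η V B C A)^-1 @@ 2 >> (b_nat2 A (b B C))^-1 @@ 1
         >> (ε V A C B)^-1 @@ 2 >> (R A C B)^-1 @@ 3)
      (S B A C @@ 2 >> (η V B A C)^-1 @@ 1 >> ε V C B A @@ 2
         >> b_nat1 (b A B) C @@ 0
         >> η V A B C @@ 0 >> (ε V C A B)^-1 @@ 3 >> (S A B C)^-1 @@ 1)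
}.

End Laws.

Record braided_monoidal_bicategory := BraidedMonoidalBicategory {
  bmb_data :> braided_data;
  bmb_axioms : is_braided bmb_data
}.

Definition syllepsis_data (X : braided_data) :=
  modif (tb (bd_b X) ob21 ob22 ;; tb (bd_b X) ob22 ob21) (tid (ob21 ⊗p ob22)).

Section Laws.

Context (X : braided_data) (n : syllepsis_data X).
Local Notation V := (bd_monoidal X).
Local Notation b := (bc (bd_b X)).
Local Notation R := (hexR X).
Local Notation S := (hexS X).
Local Notation "a*" := (asc V).

Definition syl (A B : K) : pcell [b A B; b B A] [ ] := n (A, B).
Local Notation ν := syl.

Record is_sylleptic : Prop := {
  smb_A_BC : forall A B C : K,
    eq_pcell
      [b A B ▷ C; a B A C; B ◁ b A C; B ◁ b C A; a* B A C; b B A ▷ C]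
      [ ]
      (R A B C @@ 0 >> S B C A @@ 3
         >> (η V B C A)^-1 @@ 2 >> ν A (B ⊗ C) @@ 1 >> (η V A B C)^-1 @@ 0)
      (B ◀ ν A C @@ 2 >> (η V B A C)^-1 @@ 1 >> ν A B ▶ C @@ 0);
  smb_AB_C : forall A B C : K,
    eq_pcell
      [A ◁ b B C; a* A C B; b A C ▷ B; b C A ▷ B; a A C B; A ◁ b C B]
      [ ]
      (S A B C @@ 0 >> R C A B @@ 3
         >> ε V C A B @@ 2 >> ν (A ⊗ B) C @@ 1 >> ε V A B C @@ 0)
      (ν A C ▶ B @@ 2 >> ε V A C B @@ 1 >> A ◀ ν B C @@ 0)
}.

Definition is_symmetric : Prop := forall A B : K,
  eq_pcell [b A B; b B A; b A B] [b A B] (ν A B @@ 0) (ν B A @@ 1).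

End Laws.

Record sylleptic_monoidal_bicategory := SyllepticMonoidalBicategory {
  smb_braided :> braided_monoidal_bicategory;
  smb_syllepsis : syllepsis_data smb_braided;
  smb_axioms : is_sylleptic smb_syllepsis
}.

Record symmetric_monoidal_bicategory := SymmetricMonoidalBicategory {
  symb_sylleptic :> sylleptic_monoidal_bicategory;
  symb_axiom : is_symmetric (smb_syllepsis symb_sylleptic)
}.

End MonoidalBicategory.

Definition has_strict_coherence (K : bicat) (M : monoidal_data K)
  (V : monoidal_bicategory M) : Prop :=
  (forall A B C D : K, is_id2 (π V A B C D)) /\
  (forall A B : K, is_id2 (μ V A B)) /\
  (forall A B : K, is_id2 (lam V A B)) /\
  (forall A B : K, is_id2 (ρ V A B)).

(* Main.v *)
(* For every object A the 1-functor S = - ⊗ A carries a strength S(x ⊗ y) -> x ⊗ S y,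
   given by a, and a compatibility S x ⊗ z -> S(x ⊗ z), given by s; the axioms of a
   symmetry are strict equations about such endofunctors and the transformations
   between their composites.  Evaluation at I recovers A through ℓ_A : S I -> A.
   Call a 1-cell f : x -> y covered when x and y are presented by endofunctors S and T,
   through equivalences u : S I -> x and v : T I -> y, and f comes with a strong
   transformation n : S -> T and an invertible 2-cell v n_I ≅ f u.  Since u is an
   equivalence, two 1-cells covered by the same n are related by exactly one 2-cell
   compatible with the covers.  The 1-cells a, a* and b are covered by identities and by
   s, so the hexagon and syllepsis 2-cells can be defined by this universal property,
   and each coherence axiom equates two 2-cells that are compatible with the same covers.
   The braiding becomes pseudonatural because it is isomorphic, after precomposition with
   the equivalence ℓ_A ⊗ 1, to the 2-natural (ℓ_B ⊗ 1) s_{I,A,B}. *)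

From Stdlib Require Import ClassicalEpsilon Eqdep.
Require Import Defs.

Set Implicit Arguments.
Unset Strict Implicit.

(** * Total 2-cells *)

(** Composition of endofunctors is associative on the nose. Once A ⊗ B is presented by x ↦ (x A) B,
    both bracketings of a triple tensor product have the same underlying endofunctor; this is why a
    and its pseudo-inverse can be covered by identities although a is only an equivalence. The map
    [w] : S x → x ⊗ S I, built from the strength and r, exhibits S as - ⊗ S I up to equivalence and
    turns presentations of two objects into one of their tensor product.

    Compatible 2-cells must be stable under tensoring, and a tensor product of covers evaluates
    transformations away from I. Hence [good] compares all components n_X, although the 2-cell
    itself is only tested at I.

    The obstacle is that an object has several presentations: the axioms apply a hexagon cell at A
    and B ⊗ C, where B ⊗ C is presented by a composite. The hexagon and syllepsis cells are
    therefore chosen with every variable presented by - ⊗ A, and transferred to other presentations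
    along S X → X ⊗ S I → X ⊗ A. No formula for these cells is ever needed, only their existence and
    uniqueness. *)

(* In a 2-category the sides of an equation between pastings often have boundaries that
   are only propositionally equal.  A total 2-cell carries its own boundary, and a vertical
   composite with mismatching boundaries is [undef], so that all such equations become
   Leibniz equalities without casts. *)
Inductive tcell (K : bicat) (x y : K) : Type :=
| pk : forall f g : hom x y, cell f g -> tcell x y
| undef : tcell x y.

Arguments pk {K x y f g} α.
Arguments undef {K x y}.

(** Equality of 1-cells is decided classically and the second cell is transported to the target of
    the first. By uniqueness of identity proofs the choice of equality is immaterial, see [pk_v]. *)
Definition vt (K : bicat) (x y : K) (a b : tcell x y) : tcell x y :=
  match a, b with
  | @pk _ _ _ f g α, @pk _ _ _ g' h β =>
      match excluded_middle_informative (g' = g) with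
      | left e => pk (α • match e in _ = g return cell g h with eq_refl => β end)
      | right _ => undef
      end
  | _, _ => undef
  end.

Definition ht (K : bicat) (x y z : K) (b : tcell y z) (a : tcell x y) : tcell x z :=
  match b, a with
  | pk β, pk α => pk (β ⋆ α)
  | _, _ => undef
  end.

Definition im (K : bicat) (x y : K) (f : hom x y) : tcell x y := pk (id2 f).

Notation "⟪ α ⟫" := (pk α) (format "⟪ α ⟫") : bicat_scope.
Notation "⟦ f ⟧" := (im f) (format "⟦ f ⟧") : bicat_scope.
Notation "a ⊳ b" := (vt a b) (at level 45, right associativity) : bicat_scope.
Notation "b ⊛ a" := (ht b a) (at level 40, left associativity) : bicat_scope.

(** Casts only serve to give an invertible 2-cell a prescribed boundary; [pk_castI] removes them
    from every equation of total cells. *)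
Definition castI (K : bicat) (x y : K) (f g f' g' : hom x y)
  (e : f = f') (e' : g = g') (α : iso2 f g) : iso2 f' g' :=
  match e in _ = f', e' in _ = g' return iso2 f' g' with
  | eq_refl, eq_refl => α
  end.

Section TotalCells.

Context {K : bicat}.

Lemma pk_castI (x y : K) (f g f' g' : hom x y) (e : f = f') (e' : g = g')
  (α : iso2 f g) : ⟪castI e e' α⟫ = ⟪α⟫.
Proof. now destruct e, e'. Qed.

Lemma pk_inj (x y : K) (f g : hom x y) (α β : cell f g) : ⟪α⟫ = ⟪β⟫ -> α = β.
Proof.
intros H. injection H. intros H1. now do 2 apply inj_pair2 in H1.
Qed.

Lemma pk_src (x y : K) (f g f' g' : hom x y) (α : cell f g) (β : cell f' g') :
  ⟪α⟫ = ⟪β⟫ -> f = f'.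
Proof. intros H. now injection H. Qed.

Lemma pk_tgt (x y : K) (f g f' g' : hom x y) (α : cell f g) (β : cell f' g') :
  ⟪α⟫ = ⟪β⟫ -> g = g'.
Proof. intros H. now injection H. Qed.

Lemma im_inj (x y : K) (f g : hom x y) : ⟦f⟧ = ⟦g⟧ -> f = g.
Proof. apply pk_src. Qed.

Lemma pk_v (x y : K) (f g h : hom x y) (α : cell f g) (β : cell g h) :
  ⟪α • β⟫ = ⟪α⟫ ⊳ ⟪β⟫.
Proof.
cbn. destruct (excluded_middle_informative (g = g)) as [e|n].
- now rewrite (UIP_refl _ _ e).
- now destruct n.
Qed.

Lemma pk_h (x y z : K) (g g' : hom y z) (f f' : hom x y)
  (β : cell g g') (α : cell f f') : ⟪β ⋆ α⟫ = ⟪β⟫ ⊛ ⟪α⟫.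
Proof. reflexivity. Qed.

Lemma pk_vdef (x y : K) (f g g' h : hom x y) (α : cell f g) (β : cell g' h) :
  (g' = g /\ exists γ : cell f h, ⟪α⟫ ⊳ ⟪β⟫ = ⟪γ⟫) \/ (g' <> g /\ ⟪α⟫ ⊳ ⟪β⟫ = undef).
Proof.
cbn. destruct (excluded_middle_informative (g' = g)) as [e|n].
- left. split; [easy|]. eexists. reflexivity.
- now right.
Qed.

(** [undef] is absorbing and a mismatch of boundaries occurs in both bracketings or in neither, so
    associativity is an unconditional rewrite rule. *)
Lemma vt_assoc (x y : K) (a b c : tcell x y) : (a ⊳ b) ⊳ c = a ⊳ (b ⊳ c).
Proof.
destruct a as [f g α|], b as [f1 g1 β|], c as [f2 g2 γ|]; try reflexivity.
- destruct (pk_vdef α β) as [[e _]|[n H1]].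
  + subst. rewrite <- pk_v.
    destruct (pk_vdef β γ) as [[e _]|[n H1]].
    * subst. now rewrite <- !pk_v, vcomp_assoc.
    * rewrite H1. destruct (pk_vdef (α • β) γ) as [[e _]|[_ H2]]; [easy|].
      now rewrite H2.
  + rewrite H1. destruct (pk_vdef β γ) as [[e _]|[n2 H2]].
    * subst. rewrite <- pk_v.
      destruct (pk_vdef α (β • γ)) as [[e _]|[_ H2]]; [easy|]. now rewrite H2.
    * now rewrite H2.
- now destruct (pk_vdef α β) as [[_ [γ ->]]|[_ ->]].
Qed.

Lemma vt_idl (x y : K) (f g : hom x y) (α : cell f g) : ⟦f⟧ ⊳ ⟪α⟫ = ⟪α⟫.
Proof. unfold im. now rewrite <- pk_v, vcomp_id_l. Qed.

Lemma vt_idr (x y : K) (f g : hom x y) (α : cell f g) : ⟪α⟫ ⊳ ⟦g⟧ = ⟪α⟫.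
Proof. unfold im. now rewrite <- pk_v, vcomp_id_r. Qed.

Lemma vt_idl_eq (x y : K) (f g h : hom x y) (α : cell f g) :
  h = f -> ⟦h⟧ ⊳ ⟪α⟫ = ⟪α⟫.
Proof. intros ->. apply vt_idl. Qed.

Lemma vt_idr_eq (x y : K) (f g h : hom x y) (α : cell f g) :
  h = g -> ⟪α⟫ ⊳ ⟦h⟧ = ⟪α⟫.
Proof. intros ->. apply vt_idr. Qed.

Lemma vt_im (x y : K) (f : hom x y) : ⟦f⟧ ⊳ ⟦f⟧ = ⟦f⟧.
Proof. apply vt_idl. Qed.

Lemma fwd_bwd (x y : K) (f g : hom x y) (α : iso2 f g) : ⟪α⟫ ⊳ ⟪bwd α⟫ = ⟦f⟧.
Proof. now rewrite <- pk_v, fwdK. Qed.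

Lemma bwd_fwd (x y : K) (f g : hom x y) (α : iso2 f g) : ⟪bwd α⟫ ⊳ ⟪α⟫ = ⟦g⟧.
Proof. now rewrite <- pk_v, bwdK. Qed.

Lemma im_comp (x y z : K) (g : hom y z) (f : hom x y) : ⟦g ∘ f⟧ = ⟦g⟧ ⊛ ⟦f⟧.
Proof. unfold im, ht. now rewrite hcomp_id. Qed.

Lemma ht_exchange_l (x y z : K) (g g' : hom y z) (f f' : hom x y)
  (β : cell g g') (α : cell f f') :
  ⟪β⟫ ⊛ ⟦f⟧ ⊳ ⟦g'⟧ ⊛ ⟪α⟫ = ⟪β⟫ ⊛ ⟪α⟫.
Proof.
unfold im. rewrite <- !pk_h, <- pk_v, <- interchange.
now rewrite vcomp_id_l, vcomp_id_r.
Qed.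

Lemma ht_exchange_r (x y z : K) (g g' : hom y z) (f f' : hom x y)
  (β : cell g g') (α : cell f f') :
  ⟦g⟧ ⊛ ⟪α⟫ ⊳ ⟪β⟫ ⊛ ⟦f'⟧ = ⟪β⟫ ⊛ ⟪α⟫.
Proof.
unfold im. rewrite <- !pk_h, <- pk_v, <- interchange.
now rewrite vcomp_id_l, vcomp_id_r.
Qed.

(** Interchange is conditional on the two inner vertical composites being defined: different pairs
    of 1-cells may have equal composites, so the left side can be defined although the factors do
    not match. *)
Lemma ht_v (x y z : K) (b b' : tcell y z) (a a' : tcell x y) (g g' : hom y z)
  (f f' : hom x y) (β : cell g g') (α : cell f f') :
  b ⊳ b' = ⟪β⟫ -> a ⊳ a' = ⟪α⟫ -> b ⊛ a ⊳ b' ⊛ a' = ⟪β⟫ ⊛ ⟪α⟫.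
Proof.
destruct b as [g1 g2 b|], b' as [g3 g4 b'|], a as [f1 f2 a|], a' as [f3 f4 a'|];
  try discriminate.
intros H1 H2.
destruct (pk_vdef b b') as [[e _]|[_ H]]; [|rewrite H in H1; discriminate].
destruct (pk_vdef a a') as [[e' _]|[_ H]]; [|rewrite H in H2; discriminate].
subst. rewrite <- H1, <- H2, <- !pk_v, <- !pk_h, <- pk_v.
now rewrite interchange.
Qed.

Lemma ht_vl (x y z : K) (b b' : tcell y z) (g g' : hom y z) (β : cell g g')
  (f : hom x y) : b ⊳ b' = ⟪β⟫ -> b ⊛ ⟦f⟧ ⊳ b' ⊛ ⟦f⟧ = ⟪β⟫ ⊛ ⟦f⟧.
Proof. intros H. apply ht_v; [easy|apply vt_im]. Qed.

Lemma ht_vr (x y z : K) (a a' : tcell x y) (f f' : hom x y) (α : cell f f')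
  (g : hom y z) : a ⊳ a' = ⟪α⟫ -> ⟦g⟧ ⊛ a ⊳ ⟦g⟧ ⊛ a' = ⟦g⟧ ⊛ ⟪α⟫.
Proof. intros H. apply ht_v; [apply vt_im|easy]. Qed.

Lemma pk_id2 (x y : K) (f g : hom x y) (α : cell f g) : is_id2 α -> ⟪α⟫ = ⟦f⟧.
Proof. intros [e ->]. now destruct e. Qed.

Lemma pk_id2' (x y : K) (f g : hom x y) (α : cell f g) : is_id2 α -> ⟪α⟫ = ⟦g⟧.
Proof. intros [e ->]. now destruct e. Qed.

Lemma is_id2_pk (x y : K) (f g h : hom x y) (α : cell f g) :
  ⟪α⟫ = ⟦h⟧ -> is_id2 α.
Proof.
intros H. pose proof (pk_src H). pose proof (pk_tgt H). subst.
exists eq_refl. now apply pk_inj.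
Qed.

Lemma pk_bwd (x y : K) (f g h : hom x y) (α : iso2 f g) :
  ⟪α⟫ = ⟦h⟧ -> ⟪bwd α⟫ = ⟦h⟧.
Proof.
intros H. pose proof (fwd_bwd α) as F. rewrite H in F.
pose proof (pk_src H). pose proof (pk_tgt H). subst f g.
now rewrite vt_idl in F.
Qed.

Context (HK : is_2category K).

Lemma lunitE (x y : K) (f : hom x y) : id1 y ∘ f = f.
Proof. destruct (strict_lunit HK f) as [e _]. exact e. Qed.

Lemma runitE (x y : K) (f : hom x y) : f ∘ id1 x = f.
Proof. destruct (strict_runit HK f) as [e _]. exact e. Qed.

Lemma assocE (x y z w : K) (h : hom z w) (g : hom y z) (f : hom x y) :
  (h ∘ g) ∘ f = h ∘ (g ∘ f).
Proof. destruct (strict_assoc HK h g f) as [e _]. exact e. Qed.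

Lemma pk_lunit (x y : K) (f : hom x y) : ⟪lunit f⟫ = ⟦f⟧.
Proof. apply pk_id2', strict_lunit, HK. Qed.

Lemma pk_runit (x y : K) (f : hom x y) : ⟪runit f⟫ = ⟦f⟧.
Proof. apply pk_id2', strict_runit, HK. Qed.

Lemma pk_assoc (x y z w : K) (h : hom z w) (g : hom y z) (f : hom x y) :
  ⟪assoc h g f⟫ = ⟦h ∘ (g ∘ f)⟧.
Proof. apply pk_id2', strict_assoc, HK. Qed.

Lemma pk_lunit_inv (x y : K) (f : hom x y) : ⟪lunit_inv f⟫ = ⟦f⟧.
Proof. apply (pk_bwd (α := lunit_iso f)), pk_lunit. Qed.

Lemma pk_runit_inv (x y : K) (f : hom x y) : ⟪runit_inv f⟫ = ⟦f⟧.
Proof. apply (pk_bwd (α := runit_iso f)), pk_runit. Qed.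

Lemma pk_assoc_inv (x y z w : K) (h : hom z w) (g : hom y z) (f : hom x y) :
  ⟪assoc_inv h g f⟫ = ⟦h ∘ (g ∘ f)⟧.
Proof. apply (pk_bwd (α := assoc_iso h g f)), pk_assoc. Qed.

(** Naturality of a unitor whose components are identities. The boundaries agree only
    propositionally, which total cells do not see; [ht_idr] and [ht_assoc] work alike. *)
Lemma ht_idl (x y : K) (a : tcell x y) : ⟦id1 y⟧ ⊛ a = a.
Proof.
destruct a as [f g α|]; [|reflexivity].
pose proof (f_equal pk (lunit_nat α)) as H.
rewrite !pk_v, !pk_lunit, vt_idl, vt_idr_eq in H; [exact H|].
symmetry. apply lunitE.
Qed.

Lemma ht_idr (x y : K) (a : tcell x y) : a ⊛ ⟦id1 x⟧ = a.
Proof.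
destruct a as [f g α|]; [|reflexivity].
pose proof (f_equal pk (runit_nat α)) as H.
rewrite !pk_v, !pk_runit, vt_idl, vt_idr_eq in H; [exact H|].
symmetry. apply runitE.
Qed.

Lemma ht_assoc (x y z w : K) (c : tcell z w) (b : tcell y z) (a : tcell x y) :
  (c ⊛ b) ⊛ a = c ⊛ (b ⊛ a).
Proof.
destruct c as [h h' γ|], b as [g g' β|], a as [f f' α|]; try reflexivity.
pose proof (f_equal pk (assoc_nat γ β α)) as H.
rewrite !pk_v, !pk_assoc, vt_idr_eq, vt_idl in H; [exact H|].
symmetry. apply assocE.
Qed.

End TotalCells.

(** * Adjoint equivalences *)

Section Equivalences.

Context {K : bicat}.

Lemma pk_iso_comp (x y : K) (f g h : hom x y) (α : iso2 f g) (β : iso2 g h) :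
  ⟪iso_comp α β⟫ = ⟪α⟫ ⊳ ⟪β⟫.
Proof. apply pk_v. Qed.

Lemma pk_v_l (x y z : K) (f g h : hom y z) (α : cell f g) (β : cell g h)
  (k : hom x y) : ⟪α • β⟫ ⊛ ⟦k⟧ = ⟪α⟫ ⊛ ⟦k⟧ ⊳ ⟪β⟫ ⊛ ⟦k⟧.
Proof. symmetry. apply ht_vl. now rewrite pk_v. Qed.

Lemma pk_iso_comp_l (x y z : K) (f g h : hom y z) (α : iso2 f g) (β : iso2 g h)
  (k : hom x y) : ⟪iso_comp α β⟫ ⊛ ⟦k⟧ = ⟪α⟫ ⊛ ⟦k⟧ ⊳ ⟪β⟫ ⊛ ⟦k⟧.
Proof. symmetry. apply ht_vl. now rewrite pk_iso_comp. Qed.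

Lemma ht_exchange (x y z : K) (g g' : hom y z) (f f' : hom x y)
  (β : cell g g') (α : cell f f') :
  ⟦g⟧ ⊛ ⟪α⟫ ⊳ ⟪β⟫ ⊛ ⟦f'⟧ = ⟪β⟫ ⊛ ⟦f⟧ ⊳ ⟦g'⟧ ⊛ ⟪α⟫.
Proof. now rewrite ht_exchange_l, ht_exchange_r. Qed.

Lemma vt_cancel (x y : K) (f g : hom x y) (α : iso2 f g) (b c : tcell x y) :
  (exists h (β : cell g h), b = ⟪β⟫) -> (exists h (γ : cell g h), c = ⟪γ⟫) ->
  ⟪α⟫ ⊳ b = ⟪α⟫ ⊳ c -> b = c.
Proof.
intros [h [β ->]] [h' [γ ->]] H.
apply (f_equal (vt ⟪bwd α⟫)) in H.
now rewrite <- !vt_assoc, !bwd_fwd, !vt_idl in H.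
Qed.

Context (HK : is_2category K).

(* As the 2-cells are invertible, one triangle identity implies the other: [adj_tri_r]. *)
Record adjoint (x y : K) (u : hom x y) := Adjoint {
  rev : hom y x;
  aη : iso2 (id1 x) (rev ∘ u);
  aε : iso2 (u ∘ rev) (id1 y);
  a_tri : ⟦u⟧ ⊛ ⟪aη⟫ ⊳ ⟪aε⟫ ⊛ ⟦u⟧ = ⟦u⟧
}.

Lemma fwd_bwd_r (x y z : K) (f g : hom x y) (α : iso2 f g) (k : hom y z) :
  ⟦k⟧ ⊛ ⟪α⟫ ⊳ ⟦k⟧ ⊛ ⟪bwd α⟫ = ⟦k ∘ f⟧.
Proof. rewrite im_comp. apply ht_vr, fwd_bwd. Qed.
Lemma bwd_fwd_r (x y z : K) (f g : hom x y) (α : iso2 f g) (k : hom y z) :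
  ⟦k⟧ ⊛ ⟪bwd α⟫ ⊳ ⟦k⟧ ⊛ ⟪α⟫ = ⟦k ∘ g⟧.
Proof. rewrite im_comp. apply ht_vr, bwd_fwd. Qed.
Lemma fwd_bwd_l (x y z : K) (f g : hom y z) (α : iso2 f g) (k : hom x y) :
  ⟪α⟫ ⊛ ⟦k⟧ ⊳ ⟪bwd α⟫ ⊛ ⟦k⟧ = ⟦f ∘ k⟧.
Proof. rewrite im_comp. apply ht_vl, fwd_bwd. Qed.
Lemma bwd_fwd_l (x y z : K) (f g : hom y z) (α : iso2 f g) (k : hom x y) :
  ⟪bwd α⟫ ⊛ ⟦k⟧ ⊳ ⟪α⟫ ⊛ ⟦k⟧ = ⟦g ∘ k⟧.
Proof. rewrite im_comp. apply ht_vl, bwd_fwd. Qed.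

(** The usual correction of an equivalence to an adjoint one: the unit η is kept and the counit
    becomes ε' = ε⁻¹(u u'), then u η⁻¹ u', then ε. *)
Lemma adjoint_of_equivalence (x y : K) (u : hom x y) (u' : hom y x) :
  equivalence_inverse u u' -> exists A : adjoint u, rev A = u'.
Proof.
intros [[η] [ε]].
assert (e1 : u ∘ ((u' ∘ u) ∘ u') = (u ∘ u') ∘ (u ∘ u')) by now rewrite !(assocE HK).
assert (e2 : u ∘ (id1 x ∘ u') = u ∘ u') by now rewrite (lunitE HK).
set (ε' := iso_comp (castI (lunitE HK (u ∘ u')) eq_refl
               (iso_hcomp (iso_inv ε) (iso_id (u ∘ u'))))
   (iso_comp (castI e1 e2 (iso_hcomp (iso_id u) (iso_hcomp (iso_inv η) (iso_id u')))) ε)).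
unshelve eexists; [refine (@Adjoint _ _ u u' η ε' _)|reflexivity].
unfold ε'. rewrite !pk_iso_comp_l, !pk_castI.
change (⟦u⟧ ⊛ ⟪η⟫ ⊳ (⟪bwd ε⟫ ⊛ ⟦u ∘ u'⟧) ⊛ ⟦u⟧
  ⊳ (⟦u⟧ ⊛ (⟪bwd η⟫ ⊛ ⟦u'⟧)) ⊛ ⟦u⟧ ⊳ ⟪ε⟫ ⊛ ⟦u⟧ = ⟦u⟧).
rewrite !(ht_assoc HK), <- !im_comp, !(assocE HK).
rewrite <- vt_assoc.
(* The unit slides past ε⁻¹, meets η⁻¹ and cancels there by a second exchange; what remains is ε⁻¹
   followed by ε. *)
assert (H1 : ⟦u⟧ ⊛ ⟪η⟫ ⊳ ⟪bwd ε⟫ ⊛ ⟦u ∘ (u' ∘ u)⟧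
  = ⟪bwd ε⟫ ⊛ ⟦u⟧ ⊳ ⟦u⟧ ⊛ (⟦u' ∘ u⟧ ⊛ ⟪η⟫)).
{ pose proof (ht_exchange (bwd ε) (id2 u ⋆ η)) as E.
  rewrite (ht_idl HK), !pk_h, (runitE HK) in E.
  change (pk (id2 u)) with ⟦u⟧ in E.
  now rewrite E, !im_comp, !(ht_assoc HK). }
rewrite H1, vt_assoc. clear H1.
assert (H2 : ⟦u⟧ ⊛ (⟦u' ∘ u⟧ ⊛ ⟪η⟫) ⊳ ⟦u⟧ ⊛ (⟪bwd η⟫ ⊛ ⟦u' ∘ u⟧) = ⟦u⟧ ⊛ ⟦u' ∘ u⟧).
{ apply ht_vr. rewrite ht_exchange.
  rewrite (ht_idl HK), (ht_idr HK). apply bwd_fwd. }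
rewrite <- (vt_assoc (⟦u⟧ ⊛ (⟦u' ∘ u⟧ ⊛ ⟪η⟫))), H2. clear H2.
rewrite <- im_comp. change (⟪ε⟫ ⊛ ⟦u⟧) with ⟪ε ⋆ id2 u⟫.
rewrite vt_idl_eq; [|now rewrite <- (assocE HK)].
change ⟪ε ⋆ id2 u⟫ with (⟪ε⟫ ⊛ ⟦u⟧). rewrite bwd_fwd_l. now rewrite (lunitE HK).
Qed.

Section Whiskering.

Context (x y z : K) (u : hom x y) (A : adjoint u).

(** The triangle identity solved for the counit, using that the unit is invertible. It replaces a
    counit whiskered by [u] with a unit. *)
Lemma adj_ε_l : ⟪aε A⟫ ⊛ ⟦u⟧ = ⟦u⟧ ⊛ ⟪bwd (aη A)⟫.
Proof.
pose proof (f_equal (vt (⟦u⟧ ⊛ ⟪bwd (aη A)⟫)) (a_tri A)) as H.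
rewrite <- vt_assoc, bwd_fwd_r in H.
change (⟪aε A⟫ ⊛ ⟦u⟧) with ⟪aε A ⋆ id2 u⟫ in *.
change (⟦u⟧ ⊛ ⟪bwd (aη A)⟫) with ⟪id2 u ⋆ bwd (aη A)⟫ in *.
now rewrite vt_idl_eq, vt_idr_eq in H; rewrite ?(runitE HK), ?(assocE HK).
Qed.

Lemma adj_ε_bwd_l : ⟪bwd (aε A)⟫ ⊛ ⟦u⟧ = ⟦u⟧ ⊛ ⟪aη A⟫.
Proof.
pose proof (f_equal (fun a => a ⊳ ⟪bwd (aε A)⟫ ⊛ ⟦u⟧) (a_tri A)) as H.
cbv beta in H. rewrite vt_assoc, fwd_bwd_l in H.
change (⟪bwd (aε A)⟫ ⊛ ⟦u⟧) with ⟪bwd (aε A) ⋆ id2 u⟫ in *.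
change (⟦u⟧ ⊛ ⟪aη A⟫) with ⟪id2 u ⋆ aη A⟫ in *.
now rewrite vt_idl_eq, vt_idr_eq in H; rewrite ?(lunitE HK), ?(assocE HK).
Qed.

(** Whiskering further by [rev A] and conjugating with the counit recovers the 2-cell. *)
Lemma whisker_inj (f g f' g' : hom y z) (γ : cell f g) (γ' : cell f' g') :
  f = f' -> g = g' -> ⟪γ⟫ ⊛ ⟦u⟧ = ⟪γ'⟫ ⊛ ⟦u⟧ -> ⟪γ⟫ = ⟪γ'⟫.
Proof.
intros <- <- H. apply (f_equal (fun a => a ⊛ ⟦rev A⟧)) in H.
rewrite !(ht_assoc HK), <- !im_comp in H.
apply (f_equal (fun a => (⟦f⟧ ⊛ ⟪bwd (aε A)⟫ ⊳ a) ⊳ ⟦g⟧ ⊛ ⟪aε A⟫)) in H.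
rewrite !ht_exchange, !vt_assoc, !bwd_fwd_r, !(ht_idr HK), !vt_idr_eq in H;
  now rewrite ?(runitE HK).
Qed.

(** The preimage is δ whiskered by [rev A] and conjugated with the counit. After whiskering by [u]
    the triangle identities turn the two counits into η and η⁻¹, which slide past δ and cancel. *)
Lemma whisker_full (f g : hom y z) (δ : iso2 (f ∘ u) (g ∘ u)) :
  exists γ : iso2 f g, ⟪γ⟫ ⊛ ⟦u⟧ = ⟪δ⟫.
Proof.
exists (iso_comp (castI (runitE HK f) (eq_sym (assocE HK _ _ _))
                    (iso_hcomp (iso_id f) (iso_inv (aε A))))
  (iso_comp (iso_hcomp δ (iso_id (rev A)))
            (castI (eq_sym (assocE HK _ _ _)) (runitE HK g)
                    (iso_hcomp (iso_id g) (aε A))))).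
rewrite !pk_iso_comp_l, !pk_castI.
change ((⟦f⟧ ⊛ ⟪bwd (aε A)⟫) ⊛ ⟦u⟧ ⊳ (⟪δ⟫ ⊛ ⟦rev A⟧) ⊛ ⟦u⟧
  ⊳ (⟦g⟧ ⊛ ⟪aε A⟫) ⊛ ⟦u⟧ = ⟪δ⟫).
rewrite !(ht_assoc HK), adj_ε_l, adj_ε_bwd_l, <- !(ht_assoc HK), <- !im_comp.
rewrite (ht_assoc HK), <- im_comp, <- vt_assoc, ht_exchange, vt_assoc, fwd_bwd_r,
  (ht_idr HK).
apply vt_idr_eq. apply runitE, HK.
Qed.

End Whiskering.

(** By faithfulness of whiskering it is enough to compare after [u], where [adj_ε_l] reduces the
    claim to η⁻¹ against η. *)
Lemma adj_tri_r (x y : K) (u : hom x y) (A : adjoint u) :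
  ⟪aη A⟫ ⊛ ⟦rev A⟧ ⊳ ⟦rev A⟧ ⊛ ⟪aε A⟫ = ⟦rev A⟧.
Proof.
set (ζ := iso_comp (castI (lunitE HK _) (assocE HK _ _ _)
                     (iso_hcomp (aη A) (iso_id (rev A))))
                   (castI eq_refl (runitE HK _) (iso_hcomp (iso_id (rev A)) (aε A)))).
transitivity ⟪ζ⟫; [unfold ζ; now rewrite pk_iso_comp, !pk_castI|].
apply (whisker_inj A); try reflexivity.
unfold ζ. rewrite pk_iso_comp_l, !pk_castI.
change ((⟪aη A⟫ ⊛ ⟦rev A⟧) ⊛ ⟦u⟧ ⊳ (⟦rev A⟧ ⊛ ⟪aε A⟫) ⊛ ⟦u⟧ = ⟦rev A⟧ ⊛ ⟦u⟧).
rewrite !(ht_assoc HK), adj_ε_l, <- !(ht_assoc HK), (ht_assoc HK), <- im_comp.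
rewrite <- ht_exchange, (ht_idl HK), (ht_idr HK). apply bwd_fwd.
Qed.

(** * 2-functors in terms of total 2-cells, and transport of pseudonaturality *)

Record strict_pfun (J : bicat) (F : pfun J K) : Prop := {
  pk_Fcomp : forall (x y z : J) (g : hom y z) (f : hom x y),
    ⟪Fcomp F g f⟫ = ⟦F1 F g ∘ F1 F f⟧;
  pk_Fid : forall x : J, ⟪Fid F x⟫ = ⟦id1 (F x)⟧;
  pk_F2_h : forall (x y z : J) (g g' : hom y z) (f f' : hom x y)
    (β : cell g g') (α : cell f f'), ⟪F2 F (β ⋆ α)⟫ = ⟪F2 F β⟫ ⊛ ⟪F2 F α⟫
}.

Lemma strict_2functor (J : bicat) (F : pfun J K) : is_2functor F -> strict_pfun F.
Proof.
intros HF.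
assert (E : forall (x y z : J) (g : hom y z) (f : hom x y),
  ⟪Fcomp F g f⟫ = ⟦F1 F g ∘ F1 F f⟧) by (intros; apply pk_id2, strict_Fcomp, HF).
split; [exact E|intros; apply pk_id2, strict_Fid, HF|].
intros x y z g g' f f' β α.
pose proof (f_equal pk (Fcomp_nat (twofunctor_pseudo HF) β α)) as H.
rewrite !pk_v, !E, vt_idr_eq in H by reflexivity.
rewrite vt_idl_eq in H; [exact H|]. symmetry. exact (pk_tgt (E x y z g f)).
Qed.

Section StrictFunctors.

Context (J : bicat) (F : pfun J K) (HF : strict_pfun F).

Lemma F1_comp (x y z : J) (g : hom y z) (f : hom x y) :
  F1 F (g ∘ f) = F1 F g ∘ F1 F f.
Proof. exact (pk_tgt (pk_Fcomp HF g f)). Qed.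

Lemma F1_id (x : J) : F1 F (id1 x) = id1 (F x).
Proof. exact (pk_tgt (pk_Fid HF x)). Qed.

Lemma F2_im (x y : J) (f : hom x y) : ⟪F2 F (id2 f)⟫ = ⟦F1 F f⟧.
Proof. now rewrite F2_id. Qed.

End StrictFunctors.

(* Whiskering with [κ] is bijective on 2-cells, so the 2-naturality of [ρ ≅ b κ] determines
   pseudonaturality cells for [b]. *)
Section Transport.

Context (J : bicat) (F' F G : pfun J K)
  (HF' : strict_pfun F') (HF : strict_pfun F) (HG : strict_pfun G)
  (κ : forall x : J, hom (F' x) (F x)) (ρ : forall x : J, hom (F' x) (G x))
  (κ_nat : forall (x y : J) (f g : hom x y) (α : cell f g),
    ⟪F2 F α⟫ ⊛ ⟦κ x⟧ = ⟦κ y⟧ ⊛ ⟪F2 F' α⟫)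
  (ρ_nat : forall (x y : J) (f g : hom x y) (α : cell f g),
    ⟪F2 G α⟫ ⊛ ⟦ρ x⟧ = ⟦ρ y⟧ ⊛ ⟪F2 F' α⟫)
  (κ_adj : forall x : J, adjoint (κ x))
  (b : forall x : J, hom (F x) (G x))
  (Θ : forall x : J, iso2 (ρ x) (b x ∘ κ x)).

(** The equality of 1-cells is read off the sources of the total-cell equation at identity
    2-cells. *)
Lemma nat1 (H' H : pfun J K) (σ : forall x : J, hom (H' x) (H x))
  (σ_nat : forall (x y : J) (f g : hom x y) (α : cell f g),
    ⟪F2 H α⟫ ⊛ ⟦σ x⟧ = ⟦σ y⟧ ⊛ ⟪F2 H' α⟫)
  (x y : J) (f : hom x y) : F1 H f ∘ σ x = σ y ∘ F1 H' f.
Proof.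
pose proof (σ_nat x y f f (id2 f)) as E. rewrite !F2_id in E. exact (pk_src E).
Qed.

(** As [Θ] is invertible, the equation prescribes t whiskered by κ; fullness of whiskering by the
    equivalence κ provides t. *)
Lemma transport_ex (x y : J) (f : hom x y) :
  exists t : iso2 (F1 G f ∘ b x) (b y ∘ F1 F f),
    ⟦F1 G f⟧ ⊛ ⟪Θ x⟫ ⊳ ⟪t⟫ ⊛ ⟦κ x⟧ = ⟪Θ y⟫ ⊛ ⟦F1 F' f⟧.
Proof.
assert (e1 : F1 G f ∘ ρ x = ρ y ∘ F1 F' f) by now apply nat1.
assert (e2 : (b y ∘ κ y) ∘ F1 F' f = (b y ∘ F1 F f) ∘ κ x).
{ rewrite !(assocE HK). f_equal. symmetry. now apply nat1. }
destruct (whisker_full (κ_adj x)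
  (iso_comp (castI (eq_sym (assocE HK _ _ _)) e1
              (iso_hcomp (iso_id (F1 G f)) (iso_inv (Θ x))))
            (castI eq_refl e2 (iso_hcomp (Θ y) (iso_id (F1 F' f)))))) as [t Ht].
exists t. rewrite Ht, pk_iso_comp, !pk_castI, <- vt_assoc.
change ((⟦F1 G f⟧ ⊛ ⟪Θ x⟫ ⊳ ⟦F1 G f⟧ ⊛ ⟪bwd (Θ x)⟫) ⊳ ⟪Θ y ⋆ id2 (F1 F' f)⟫ =
  ⟪Θ y ⋆ id2 (F1 F' f)⟫).
rewrite fwd_bwd_r. now apply vt_idl_eq.
Qed.

Definition transport_tr2 (x y : J) (f : hom x y) :
  iso2 (F1 G f ∘ b x) (b y ∘ F1 F f) :=
  proj1_sig (constructive_indefinite_description _ (transport_ex f)).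

Definition transport : trans F G := @Trans J K F G b transport_tr2.

Lemma transportE (x y : J) (f : hom x y) :
  ⟦F1 G f⟧ ⊛ ⟪Θ x⟫ ⊳ ⟪tr2 transport f⟫ ⊛ ⟦κ x⟧ = ⟪Θ y⟫ ⊛ ⟦F1 F' f⟧.
Proof.
exact (proj2_sig (constructive_indefinite_description _ (transport_ex f))).
Qed.

(** The uniqueness half of the transport. Each pseudonaturality law is checked after whiskering with
    κ and prefixing [Θ], where it becomes strict naturality of ρ and κ. *)
Lemma transport_ext (x y : J) (f : hom x y) (h : hom (F x) (G y)) g' h'
  (γ : cell (F1 G f ∘ b x) h) (γ' : cell g' h') :
  g' = F1 G f ∘ b x -> h' = h ->
  ⟦F1 G f⟧ ⊛ ⟪Θ x⟫ ⊳ ⟪γ⟫ ⊛ ⟦κ x⟧ = ⟦F1 G f⟧ ⊛ ⟪Θ x⟫ ⊳ ⟪γ'⟫ ⊛ ⟦κ x⟧ -> ⟪γ⟫ = ⟪γ'⟫.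
Proof.
intros -> -> H. apply (whisker_inj (κ_adj x)); try reflexivity.
apply (f_equal (vt (⟦F1 G f⟧ ⊛ ⟪bwd (Θ x)⟫))) in H.
rewrite <- !vt_assoc, !bwd_fwd_r in H.
change (⟪γ⟫ ⊛ ⟦κ x⟧) with ⟪γ ⋆ id2 (κ x)⟫ in *.
change (⟪γ'⟫ ⊛ ⟦κ x⟧) with ⟪γ' ⋆ id2 (κ x)⟫ in *.
now rewrite !vt_idl_eq in H by now rewrite (assocE HK).
Qed.

Lemma transport_id (x : J) : ⟪tr2 transport (id1 x)⟫ = ⟦b x⟧.
Proof.
apply transport_ext with (f := id1 x).
- now rewrite (F1_id HG), (lunitE HK).
- now rewrite (F1_id HF), (runitE HK).
- rewrite transportE, (F1_id HG), (F1_id HF'), (ht_idl HK), (ht_idr HK).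
  change (⟪id2 (b x)⟫ ⊛ ⟦κ x⟧) with (⟦b x⟧ ⊛ ⟦κ x⟧).
  now rewrite <- im_comp, vt_idr.
Qed.

Lemma transport_comp (x y z : J) (g : hom y z) (f : hom x y) :
  ⟪tr2 transport (g ∘ f)⟫ =
  ⟦F1 G g⟧ ⊛ ⟪tr2 transport f⟫ ⊳ ⟪tr2 transport g⟫ ⊛ ⟦F1 F f⟧.
Proof.
set (ζ := iso_comp (iso_hcomp (iso_id (F1 G g)) (tr2 transport f))
            (castI (assocE HK _ _ _) eq_refl
              (iso_hcomp (tr2 transport g) (iso_id (F1 F f))))).
transitivity ⟪ζ⟫; [|unfold ζ; now rewrite pk_iso_comp, pk_castI].
apply transport_ext with (f := g ∘ f).
- now rewrite (F1_comp HG), (assocE HK).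
- now rewrite (F1_comp HF), (assocE HK).
- rewrite transportE, (F1_comp HG), (F1_comp HF'), !im_comp.
  unfold ζ. rewrite pk_iso_comp_l, pk_castI.
  change (⟪Θ z⟫ ⊛ (⟦F1 F' g⟧ ⊛ ⟦F1 F' f⟧) =
    (⟦F1 G g⟧ ⊛ ⟦F1 G f⟧) ⊛ ⟪Θ x⟫ ⊳ (⟦F1 G g⟧ ⊛ ⟪tr2 transport f⟫) ⊛ ⟦κ x⟧
    ⊳ (⟪tr2 transport g⟫ ⊛ ⟦F1 F f⟧) ⊛ ⟦κ x⟧).
  rewrite !(ht_assoc HK), <- vt_assoc.
  assert (E : ⟦F1 G g⟧ ⊛ (⟦F1 G f⟧ ⊛ ⟪Θ x⟫)
    ⊳ ⟦F1 G g⟧ ⊛ (⟪tr2 transport f⟫ ⊛ ⟦κ x⟧) = ⟦F1 G g⟧ ⊛ (⟪Θ y⟫ ⊛ ⟦F1 F' f⟧)).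
  { apply ht_vr. apply transportE. }
  assert (E' : ⟦F1 F f⟧ ⊛ ⟦κ x⟧ = ⟦κ y⟧ ⊛ ⟦F1 F' f⟧)
    by now rewrite <- !im_comp, (nat1 κ_nat).
  rewrite E, E', <- !(ht_assoc HK).
  symmetry. apply ht_vl, transportE.
Qed.

Lemma transport_nat (x y : J) (f g : hom x y) (α : cell f g) :
  ⟪F2 G α⟫ ⊛ ⟦b x⟧ ⊳ ⟪tr2 transport g⟫ = ⟪tr2 transport f⟫ ⊳ ⟦b y⟧ ⊛ ⟪F2 F α⟫.
Proof.
change (⟪F2 G α ⋆ id2 (b x)⟫ ⊳ ⟪tr2 transport g⟫ =
  ⟪tr2 transport f⟫ ⊳ ⟪id2 (b y) ⋆ F2 F α⟫).
rewrite <- !pk_v. apply transport_ext with (f := f); try reflexivity.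
rewrite !pk_v_l, !pk_h, <- !vt_assoc, transportE.
change (pk (id2 (b x))) with ⟦b x⟧. change (pk (id2 (b y))) with ⟦b y⟧.
rewrite !(ht_assoc HK), <- im_comp, ht_exchange, vt_assoc, transportE, ρ_nat, κ_nat.
now rewrite <- (ht_assoc HK ⟦b y⟧), <- im_comp, ht_exchange.
Qed.

Lemma transport_pseudo : is_pseudonatural transport.
Proof.
split.
- intros. apply pk_inj. rewrite !pk_v. apply transport_nat.
- intros. apply pk_inj. rewrite !pk_v, !pk_h, transport_id, (pk_Fid HF), (pk_Fid HG).
  rewrite (pk_lunit HK), (pk_runit_inv HK).
  change (⟦id1 (G x)⟧ ⊛ ⟦b x⟧ ⊳ ⟦b x⟧ = ⟦b x⟧ ⊳ ⟦b x⟧ ⊳ ⟦b x⟧ ⊛ ⟦id1 (F x)⟧).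
  now rewrite (ht_idl HK), (ht_idr HK), !vt_im.
- intros x y z g f. apply pk_inj.
  rewrite !pk_v, !pk_h, (pk_Fcomp HF), (pk_Fcomp HG), transport_comp.
  rewrite !(pk_assoc HK), (pk_assoc_inv HK).
  change (pk (id2 (F1 G g))) with ⟦F1 G g⟧. change (pk (id2 (F1 F f))) with ⟦F1 F f⟧.
  change (⟦F1 G g ∘ F1 G f⟧ ⊛ ⟦b x⟧ ⊳ ⟪id2 (F1 G g) ⋆ tr2 transport f⟫ ⊳
    ⟪tr2 transport g ⋆ id2 (F1 F f)⟫ =
    ⟦F1 G g ∘ (F1 G f ∘ b x)⟧ ⊳ ⟪id2 (F1 G g) ⋆ tr2 transport f⟫ ⊳
    ⟦F1 G g ∘ (b y ∘ F1 F f)⟧ ⊳ ⟪tr2 transport g ⋆ id2 (F1 F f)⟫ ⊳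
    ⟦b z ∘ (F1 F g ∘ F1 F f)⟧ ⊳ ⟦b z⟧ ⊛ ⟦F1 F g ∘ F1 F f⟧).
  rewrite <- !im_comp, vt_im, !(assocE HK).
  rewrite (vt_idr_eq (tr2 transport g ⋆ id2 (F1 F f))) by now rewrite (assocE HK).
  rewrite (vt_idl_eq (tr2 transport g ⋆ id2 (F1 F f))) by now rewrite (assocE HK).
  reflexivity.
Qed.

End Transport.

End Equivalences.

(** * Pastings in a 2-category *)

Section Pasting.

Context {K : bicat} (HK : is_2category K).

(** In a 2-category all coherence cells hidden in the path notation are identities, so a pasting
    reduces to whiskerings and vertical composites. *)
Lemma pk_pcons_iso (x y z : K) (f : hom x y) (p : path y z) :
  ⟪pcons_iso f p⟫ = ⟦pcomp p ∘ f⟧.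
Proof.
destruct p; [|reflexivity]. cbn. rewrite pk_lunit by easy. now rewrite lunitE.
Qed.

Lemma pcomp_cons (x y z : K) (f : hom x y) (p : path y z) :
  pcomp (pcons f p) = pcomp p ∘ f.
Proof. exact (pk_tgt (pk_pcons_iso f p)). Qed.

Lemma pk_pjoin (x y z : K) (u : path x y) (p : path y z) :
  ⟪pjoin u p⟫ = ⟦pcomp p ∘ pcomp u⟧.
Proof.
induction u as [x|x y' y f u IH].
- cbn. rewrite pk_runit by easy. now rewrite runitE.
- cbn [pjoin]. rewrite !pk_iso_comp, pk_pcons_iso.
  change (⟦pcomp p⟧ ⊛ ⟪bwd (pcons_iso f u)⟫ ⊳ ⟪assoc_inv (pcomp p) (pcomp u) f⟫
    ⊳ ⟪pjoin u p⟫ ⊛ ⟦f⟧ ⊳ ⟦pcomp (papp u p) ∘ f⟧ = ⟦pcomp p ∘ pcomp (pcons f u)⟧).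
  rewrite IH, (pk_bwd (pk_pcons_iso f u)), (pk_assoc_inv HK), pcomp_cons.
  pose proof (pk_tgt (IH p)) as E. rewrite E, <- !im_comp, !(assocE HK).
  now rewrite !vt_im.
Qed.

Lemma pcomp_app (x y z : K) (u : path x y) (p : path y z) :
  pcomp (papp u p) = pcomp p ∘ pcomp u.
Proof. exact (pk_tgt (pk_pjoin u p)). Qed.

Lemma pk_skip (x y z : K) (f : hom x y) (p q : path y z) (α : pcell p q) :
  ⟪skip (f := f) α⟫ = ⟪α⟫ ⊛ ⟦f⟧.
Proof.
unfold skip. rewrite !pk_iso_comp.
change (⟪bwd (pcons_iso f p)⟫ ⊳ ⟪α ⋆ id2 f⟫ ⊳ ⟪pcons_iso f q⟫ = ⟪α ⋆ id2 f⟫).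
rewrite (pk_bwd (pk_pcons_iso f p)), pk_pcons_iso. now rewrite vt_idr, vt_idl.
Qed.

Lemma pk_here (x y z : K) (p q : path x y) (v : path y z) (α : pcell p q) :
  ⟪here (v := v) α⟫ = ⟦pcomp v⟧ ⊛ ⟪α⟫.
Proof.
unfold here. rewrite !pk_iso_comp.
change (⟪bwd (pjoin p v)⟫ ⊳ ⟪id2 (pcomp v) ⋆ α⟫ ⊳ ⟪pjoin q v⟫ = ⟪id2 (pcomp v) ⋆ α⟫).
rewrite (pk_bwd (pk_pjoin p v)), pk_pjoin. now rewrite vt_idr, vt_idl.
Qed.

Lemma pk_pvcomp (x y : K) (p q r : path x y) (α : pcell p q) (β : pcell q r) :
  ⟪pvcomp α β⟫ = ⟪α⟫ ⊳ ⟪β⟫.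
Proof. apply pk_v. Qed.

Lemma pk_tcomp (J : bicat) (F G H : pfun J K) (σ : trans F G) (τ : trans G H)
  (x y : J) (f : hom x y) :
  ⟪tr2 (σ ;; τ) f⟫ = ⟪tr2 τ f⟫ ⊛ ⟦σ x⟧ ⊳ ⟦τ y⟧ ⊛ ⟪tr2 σ f⟫.
Proof.
cbn [tr2 tcomp]. rewrite !pk_iso_comp.
change (⟪assoc_inv (F1 H f) (τ x) (σ x)⟫ ⊳ ⟪tr2 τ f ⋆ id2 (σ x)⟫ ⊳
  ⟪assoc (τ y) (F1 G f) (σ x)⟫ ⊳ ⟪id2 (τ y) ⋆ tr2 σ f⟫ ⊳
  ⟪assoc_inv (τ y) (σ y) (F1 F f)⟫ =
  ⟪tr2 τ f ⋆ id2 (σ x)⟫ ⊳ ⟪id2 (τ y) ⋆ tr2 σ f⟫).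
rewrite !(pk_assoc_inv HK), (pk_assoc HK), vt_idr, vt_idl.
rewrite <- vt_assoc, vt_idl_eq; [reflexivity|now rewrite (assocE HK)].
Qed.

Lemma pk_tid (J : bicat) (F : pfun J K) (x y : J) (f : hom x y) :
  ⟪tr2 (tid F) f⟫ = ⟦F1 F f⟧.
Proof.
cbn [tr2 tid]. rewrite pk_iso_comp.
change (⟪runit (F1 F f)⟫ ⊳ ⟪lunit_inv (F1 F f)⟫ = ⟦F1 F f⟧).
now rewrite (pk_runit HK), (pk_lunit_inv HK), vt_im.
Qed.

Section AdjointInverse.

Context (J : bicat) (F G : pfun J K) (HF : strict_pfun F) (HG : strict_pfun G)
  (σ : trans F G) (Hσ : is_2natural σ) (A : forall x : J, adjoint (σ x)).

Lemma pk_tr2 (x y : J) (f : hom x y) : ⟪tr2 σ f⟫ = ⟦F1 G f ∘ σ x⟧.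
Proof. apply pk_id2, strict_tr2, Hσ. Qed.

Lemma tr2_src (x y : J) (f : hom x y) : F1 G f ∘ σ x = σ y ∘ F1 F f.
Proof. symmetry. exact (pk_tgt (pk_tr2 f)). Qed.

Lemma trans_nat (x y : J) (f g : hom x y) (α : cell f g) :
  ⟪F2 G α⟫ ⊛ ⟦σ x⟧ = ⟦σ y⟧ ⊛ ⟪F2 F α⟫.
Proof.
pose proof (f_equal pk (tr2_nat (twonatural_pseudo Hσ) α)) as H.
rewrite !pk_v, !pk_tr2, vt_idr in H.
rewrite vt_idl_eq in H by apply tr2_src. exact H.
Qed.

Lemma id_nat (x y : J) (f g : hom x y) (α : cell f g) :
  ⟪F2 F α⟫ ⊛ ⟦id1 (F x)⟧ = ⟦id1 (F y)⟧ ⊛ ⟪F2 F α⟫.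
Proof. now rewrite (ht_idl HK), (ht_idr HK). Qed.

(** The transport with κ = σ, ρ the identity and [Θ] the unit id ≅ [rev] σ: a pseudo-inverse of a
    strict transformation is in general only pseudonatural. *)
Definition inverse : trans G F :=
  transport HK trans_nat id_nat A (fun x => aη (A x)).

Lemma inverseE (x y : J) (f : hom x y) :
  ⟦F1 F f⟧ ⊛ ⟪aη (A x)⟫ ⊳ ⟪tr2 inverse f⟫ ⊛ ⟦σ x⟧ = ⟪aη (A y)⟫ ⊛ ⟦F1 F f⟧.
Proof.
exact (transportE HK trans_nat id_nat A (fun x => aη (A x)) f).
Qed.

Lemma inverse_pseudo : is_pseudonatural inverse.
Proof. now apply transport_pseudo. Qed.

Lemma inverse_unit_nat (x y : J) (f : hom x y) :
  (id2 (F1 F f) ⋆ aη (A x)) • tr2 (σ ;; inverse) f =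
  tr2 (tid F) f • (aη (A y) ⋆ id2 (F1 F f)).
Proof.
apply pk_inj. rewrite !pk_v.
change (⟦F1 F f⟧ ⊛ ⟪aη (A x)⟫ ⊳ ⟪tr2 (σ ;; inverse) f⟫ =
  ⟪tr2 (tid F) f⟫ ⊳ ⟪aη (A y) ⋆ id2 (F1 F f)⟫).
rewrite pk_tcomp, pk_tid, pk_tr2.
rewrite vt_idl_eq by now rewrite (lunitE HK).
rewrite <- vt_assoc, inverseE, <- im_comp, tr2_src.
apply (vt_idr_eq (aη (A y) ⋆ id2 (F1 F f))). now rewrite (assocE HK).
Qed.

(** Checked after whiskering with σ: there the counits become inverse units, and the claim is the
    defining equation [inverseE] read backwards. *)
Lemma inverse_counit_nat (x y : J) (f : hom x y) :
  (id2 (F1 G f) ⋆ aε (A x)) • tr2 (tid G) f =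
  tr2 (inverse ;; σ) f • (aε (A y) ⋆ id2 (F1 G f)).
Proof.
assert (E : ⟪tr2 (inverse ;; σ) f⟫ = ⟦σ y⟧ ⊛ ⟪tr2 inverse f⟫).
{ rewrite pk_tcomp, pk_tr2, <- im_comp.
  apply (vt_idl_eq (id2 (σ y) ⋆ tr2 inverse f)).
  now rewrite tr2_src, (assocE HK). }
apply pk_inj, (whisker_inj HK (A x)); try reflexivity.
rewrite !pk_v_l.
change ((⟦F1 G f⟧ ⊛ ⟪aε (A x)⟫) ⊛ ⟦σ x⟧ ⊳ ⟪tr2 (tid G) f⟫ ⊛ ⟦σ x⟧ =
  ⟪tr2 (inverse ;; σ) f⟫ ⊛ ⟦σ x⟧ ⊳ (⟪aε (A y)⟫ ⊛ ⟦F1 G f⟧) ⊛ ⟦σ x⟧).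
rewrite E, pk_tid.
rewrite !(ht_assoc HK), adj_ε_l by exact HK.
rewrite <- (im_comp (F1 G f)), tr2_src, im_comp, <- (ht_assoc HK ⟪aε (A y)⟫), adj_ε_l
  by exact HK.
rewrite (ht_assoc HK).
assert (E' : ⟪tr2 inverse f⟫ ⊛ ⟦σ x⟧ ⊳ ⟪bwd (aη (A y))⟫ ⊛ ⟦F1 F f⟧ =
  ⟦F1 F f⟧ ⊛ ⟪bwd (aη (A x))⟫).
{ pose proof (f_equal (fun a => ⟦F1 F f⟧ ⊛ ⟪bwd (aη (A x))⟫ ⊳ a ⊳
    ⟪bwd (aη (A y))⟫ ⊛ ⟦F1 F f⟧) (inverseE f)) as H.
  cbv beta in H. rewrite fwd_bwd_l, !vt_assoc, <- vt_assoc, bwd_fwd_r in H.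
  change (⟪tr2 inverse f⟫ ⊛ ⟦σ x⟧)
    with ⟪tr2 inverse f ⋆ id2 (σ x)⟫ in *.
  rewrite <- vt_assoc, vt_idl_eq in H by now rewrite (assocE HK).
  rewrite H. apply (vt_idr_eq (id2 (F1 F f) ⋆ bwd (aη (A x)))).
  now rewrite (lunitE HK), (runitE HK). }
assert (E'' : ⟦σ y⟧ ⊛ (⟪tr2 inverse f⟫ ⊛ ⟦σ x⟧) ⊳
  ⟦σ y⟧ ⊛ (⟪bwd (aη (A y))⟫ ⊛ ⟦F1 F f⟧) = ⟦σ y⟧ ⊛ (⟦F1 F f⟧ ⊛ ⟪bwd (aη (A x))⟫)).
{ exact (ht_vr (α := id2 (F1 F f) ⋆ bwd (aη (A x))) (σ y) E'). }
rewrite E'', <- !(ht_assoc HK), <- !im_comp, tr2_src.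
apply (vt_idr_eq (id2 (σ y ∘ F1 F f) ⋆ bwd (aη (A x)))).
now rewrite (runitE HK).
Qed.

Definition strict_adj_equiv : adj_equiv σ.
Proof.
refine (@AdjEquiv _ _ _ _ σ (twonatural_pseudo Hσ) inverse inverse_pseudo
  (@Modif J K F F (tid F) (σ ;; inverse) (fun x => aη (A x)) inverse_unit_nat)
  (@Modif J K G G (inverse ;; σ) (tid G) (fun x => aε (A x)) inverse_counit_nat)
  _ _).
- intros x η ε. apply pk_inj.
  change (⟪pvcomp (here (v := [σ x]%path) η) (skip (here (v := pnil) ε))⟫ = ⟦σ x⟧).
  rewrite pk_pvcomp, <- (a_tri (A x)).
  apply f_equal2; [exact (pk_here [σ x]%path η)|].
  etransitivity; [apply pk_skip|]. apply (f_equal (fun a => a ⊛ ⟦σ x⟧)).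
  etransitivity; [exact (pk_here pnil ε)|]. apply (ht_idl HK).
- intros x η ε. apply pk_inj.
  change (⟪pvcomp (skip (here (v := pnil) η)) (here (v := [inverse x]%path) ε)⟫
    = ⟦inverse x⟧).
  rewrite pk_pvcomp. etransitivity; [|exact (adj_tri_r HK (A x))].
  apply f_equal2; [|exact (pk_here [inverse x]%path ε)].
  etransitivity; [apply pk_skip|]. apply (f_equal (fun a => a ⊛ ⟦inverse x⟧)).
  etransitivity; [exact (pk_here pnil η)|]. apply (ht_idl HK).
Defined.

End AdjointInverse.

End Pasting.

(** * Pastings of identity 2-cells *)

Section StrictPasting.

Context {K : bicat} (HK : is_2category K).

(** Being an identity up to equality of boundaries. The predicate is closed under pasting, and two
    such cells with a common boundary are equal, which makes coherence between identity cells
    automatic. *)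
Definition id_cell (x y : K) (f g : hom x y) (α : cell f g) : Prop := ⟪α⟫ = ⟦f⟧.

Lemma id_cell_tgt (x y : K) (f g : hom x y) (α : cell f g) : id_cell α -> ⟪α⟫ = ⟦g⟧.
Proof. intros H. rewrite H. pose proof (pk_tgt H). now subst. Qed.

Lemma id_cell_eq (x y : K) (f g : hom x y) (α β : cell f g) :
  id_cell α -> id_cell β -> α = β.
Proof. intros H1 H2. apply pk_inj. now rewrite H1, H2. Qed.

Lemma id_cell_v (x y : K) (f g h : hom x y) (α : cell f g) (β : cell g h) :
  id_cell α -> id_cell β -> id_cell (α • β).
Proof.
unfold id_cell. intros H1 H2. rewrite pk_v, H2, vt_idr. exact H1.
Qed.

Lemma id_cell_h (x y z : K) (g g' : hom y z) (f f' : hom x y)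
  (β : cell g g') (α : cell f f') : id_cell β -> id_cell α -> id_cell (β ⋆ α).
Proof. unfold id_cell. intros H1 H2. now rewrite pk_h, H1, H2, im_comp. Qed.

Lemma id_cell_bwd (x y : K) (f g : hom x y) (α : iso2 f g) : id_cell α -> id_cell (bwd α).
Proof.
unfold id_cell. intros H. rewrite (pk_bwd H). pose proof (pk_tgt H). now subst.
Qed.

Lemma id_cell_id (x y : K) (f : hom x y) : id_cell (id2 f).
Proof. reflexivity. Qed.

Lemma id_cell_pv (x y : K) (p q r : path x y) (α : pcell p q) (β : pcell q r) :
  id_cell α -> id_cell β -> id_cell (pvcomp α β).
Proof. apply id_cell_v. Qed.

Lemma id_cell_skip (x y z : K) (f : hom x y) (p q : path y z) (α : pcell p q) :
  id_cell α -> id_cell (skip (f := f) α).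
Proof.
unfold id_cell. intros H. now rewrite (pk_skip HK), H, <- im_comp, (pcomp_cons HK).
Qed.

Lemma id_cell_here (x y z : K) (p q : path x y) (v : path y z) (α : pcell p q) :
  id_cell α -> id_cell (here (v := v) α).
Proof.
unfold id_cell. intros H. now rewrite (pk_here HK), H, <- im_comp, (pcomp_app HK).
Qed.

Section PathMaps.

Context (J : bicat) (F : pfun J K) (HF : strict_pfun F).

Lemma F2_pk (x y : J) (f g h : hom x y) (α : cell f g) :
  ⟪α⟫ = ⟦h⟧ -> ⟪F2 F α⟫ = ⟦F1 F h⟧.
Proof.
intros H. pose proof (pk_src H). pose proof (pk_tgt H). subst.
apply pk_inj in H. subst. now rewrite F2_id.
Qed.

End PathMaps.

Lemma pk_pmap_comp (F : pfun K K) (HF : strict_pfun F) (x y : K) (p : path x y) :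
  ⟪pmap_comp F p⟫ = ⟦F1 F (pcomp p)⟧.
Proof.
induction p as [x|x y z f p IH].
- cbn. rewrite (pk_Fid HF). now rewrite (F1_id HF).
- cbn [pmap_comp]. rewrite !pk_iso_comp.
  change (⟪bwd (pcons_iso (F1 F f) (pmap F p))⟫ ⊳ ⟪pmap_comp F p⟫ ⊛ ⟦F1 F f⟧
    ⊳ ⟪Fcomp F (pcomp p) f⟫ ⊳ ⟪F2 F (pcons_iso f p)⟫ = ⟦F1 F (pcomp (pcons f p))⟧).
  rewrite (pk_bwd (pk_pcons_iso HK (F1 F f) (pmap F p))), IH, (pk_Fcomp HF).
  rewrite (F2_pk F (pk_pcons_iso HK f p)), (pcomp_cons HK), (F1_comp HF).
  rewrite (pk_src IH), <- im_comp. now rewrite !vt_im.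
Qed.

Lemma pk_pmap_cell (F : pfun K K) (HF : strict_pfun F) (x y : K) (p q : path x y)
  (α : pcell p q) : ⟪pmap_cell F α⟫ = ⟪F2 F α⟫.
Proof.
unfold pmap_cell. rewrite !pk_iso_comp, (pk_pmap_comp HF).
change (⟦F1 F (pcomp p)⟧ ⊳ ⟪F2 F α⟫ ⊳ ⟪bwd (pmap_comp F q)⟫ = ⟪F2 F α⟫).
rewrite (pk_bwd (pk_pmap_comp HF q)). now rewrite vt_idr, vt_idl.
Qed.

Lemma id_cell_pmap (F : pfun K K) (HF : strict_pfun F) (x y : K) (p q : path x y)
  (α : pcell p q) : id_cell α -> id_cell (pmap_cell F α).
Proof.
unfold id_cell. intros H. rewrite (pk_pmap_cell HF), (F2_pk F H).
now rewrite <- (pk_src (pk_pmap_comp HF p)).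
Qed.

End StrictPasting.

(** * The monoidal bicategory *)

Definition tt (K : bicat) (M : monoidal_data K) (x x' y y' : K)
  (a : tcell x y) (a' : tcell x' y') : tcell (x ⊗[M] x') (y ⊗[M] y') :=
  match a, a' with
  | @pk _ _ _ f g α, @pk _ _ _ f' g' α' =>
      pk (@F2 _ _ (tensor M) (x, x') (y, y') (f, f') (g, g') (α, α'))
  | _, _ => undef
  end.

Section Skew.

Context {K : bicat} {M : monoidal_data K} (Hskew : is_skew_monoidal_2category M).

Local Notation HK := (skew_2category Hskew).
Local Notation I := (munit M).
Local Notation "x ⊗ y" := (tens0 M x y) (at level 39, left associativity).
Local Notation "f ⊠ g" := (tens1 M f g) (at level 39, left associativity).
Local Notation "a ⊡ b" := (@tt K M _ _ _ _ a b) (at level 39, left associativity).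
Local Notation a := (ac M).
Local Notation l := (lc M).
Local Notation r := (rc M).
Local Notation "F ⊗p G" := (pf_tens (tensor M) F G) (at level 39, left associativity).
Local Notation "A ◁ f" := (F1 (ltens M A) f) (at level 38, right associativity).
Local Notation "f ▷ B" := (F1 (rtens M B) f) (at level 37, left associativity).

Lemma tens_comp (x y z x' y' z' : K) (g : hom y z) (f : hom x y)
  (g' : hom y' z') (f' : hom x' y') :
  (g ⊠ g') ∘ (f ⊠ f') = (g ∘ f) ⊠ (g' ∘ f').
Proof.
symmetry.
exact (@F1_comp _ _ _ (strict_2functor (skew_tensor Hskew)) (x, x') (y, y') (z, z')
  (g, g') (f, f')).
Qed.

Lemma tens_id (x y : K) : id1 x ⊠ id1 y = id1 (x ⊗ y).
Proof. exact (@F1_id _ _ _ (strict_2functor (skew_tensor Hskew)) (x, y)). Qed.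

Lemma tt_im (x y x' y' : K) (f : hom x y) (g : hom x' y') :
  ⟦f⟧ ⊡ ⟦g⟧ = ⟦f ⊠ g⟧.
Proof. exact (@F2_im _ _ (tensor M) (x, x') (y, y') (f, g)). Qed.

Lemma tt_h (x y z x' y' z' : K) (b : tcell y z) (b' : tcell y' z')
  (c : tcell x y) (c' : tcell x' y') :
  (b ⊡ b') ⊛ (c ⊡ c') = (b ⊛ c) ⊡ (b' ⊛ c').
Proof.
destruct b as [g1 g2 β|], b' as [g1' g2' β'|], c as [f1 f2 α|], c' as [f1' f2' α'|];
  try reflexivity.
symmetry. exact (@pk_F2_h _ _ _ (strict_2functor (skew_tensor Hskew))
  (x, x') (y, y') (z, z')
  (g1, g1') (g2, g2') (f1, f1') (f2, f2') (β, β') (α, α')).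
Qed.

Lemma tt_v (x y x' y' : K) (b c : tcell x y) (b' c' : tcell x' y')
  (f g : hom x y) (f' g' : hom x' y') (γ : cell f g) (γ' : cell f' g') :
  b ⊳ c = ⟪γ⟫ -> b' ⊳ c' = ⟪γ'⟫ -> b ⊡ b' ⊳ c ⊡ c' = ⟪γ⟫ ⊡ ⟪γ'⟫.
Proof.
destruct b as [g1 g2 β|], b' as [g1' g2' β'|], c as [f1 f2 α|], c' as [f1' f2' α'|];
  try discriminate.
intros H H'.
destruct (pk_vdef β α) as [[e _]|[_ E]]; [|rewrite E in H; discriminate].
destruct (pk_vdef β' α') as [[e' _]|[_ E]]; [|rewrite E in H'; discriminate].
subst. rewrite <- H, <- H'. rewrite <- !pk_v. cbn [tt]. rewrite <- pk_v.
now rewrite <- F2_comp.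
Qed.

Lemma a_natT (x y x' y' x'' y'' : K) (c : tcell x y) (c' : tcell x' y')
  (c'' : tcell x'' y'') :
  ⟦a y y' y''⟧ ⊛ ((c ⊡ c') ⊡ c'') = (c ⊡ (c' ⊡ c'')) ⊛ ⟦a x x' x''⟧.
Proof.
destruct c as [f1 f2 α|], c' as [f1' f2' α'|], c'' as [f1'' f2'' α''|];
  try reflexivity.
symmetry. exact (@trans_nat _ _ _ _ _ (skew_assoc Hskew) (x, x', x'') (y, y', y'')
  (f1, f1', f1'') (f2, f2', f2'') (α, α', α'')).
Qed.

Lemma l_natT (x y : K) (c : tcell x y) :
  c ⊛ ⟦l x⟧ = ⟦l y⟧ ⊛ (⟦id1 I⟧ ⊡ c).
Proof.
destruct c as [f1 f2 α|]; [|reflexivity].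
exact (@trans_nat _ _ _ _ _ (skew_left Hskew) x y f1 f2 α).
Qed.

Lemma r_natT (x y : K) (c : tcell x y) :
  (c ⊡ ⟦id1 I⟧) ⊛ ⟦r x⟧ = ⟦r y⟧ ⊛ c.
Proof.
destruct c as [f1 f2 α|]; [|reflexivity].
exact (@trans_nat _ _ _ _ _ (skew_right Hskew) x y f1 f2 α).
Qed.

Lemma a_nat (x y x' y' x'' y'' : K) (f : hom x y) (f' : hom x' y')
  (f'' : hom x'' y'') :
  a y y' y'' ∘ ((f ⊠ f') ⊠ f'') = (f ⊠ (f' ⊠ f'')) ∘ a x x' x''.
Proof.
apply im_inj. rewrite !im_comp, <- !tt_im. apply a_natT.
Qed.

Lemma l_nat (x y : K) (f : hom x y) : f ∘ l x = l y ∘ (id1 I ⊠ f).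
Proof. apply im_inj. rewrite !im_comp, <- !tt_im. apply l_natT. Qed.

Lemma r_nat (x y : K) (f : hom x y) : (f ⊠ id1 I) ∘ r x = r y ∘ f.
Proof. apply im_inj. rewrite !im_comp, <- !tt_im. apply r_natT. Qed.

Lemma strict_const (J : bicat) (c : K) : strict_pfun (@pf_const J K c).
Proof.
split; intros; cbn; try reflexivity.
- rewrite (pk_lunit HK). now rewrite (lunitE HK).
- unfold im. now rewrite hcomp_id, (lunitE HK).
Qed.

Lemma strict_id : strict_pfun (@ob1 K).
Proof. split; reflexivity. Qed.
Lemma strict_21 : strict_pfun (@ob21 K).
Proof. split; reflexivity. Qed.
Lemma strict_22 : strict_pfun (@ob22 K).
Proof. split; reflexivity. Qed.
Lemma strict_31 : strict_pfun (@ob31 K).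
Proof. split; intros; cbn; now rewrite ?vcomp_id_l. Qed.
Lemma strict_32 : strict_pfun (@ob32 K).
Proof. split; intros; cbn; now rewrite ?vcomp_id_l. Qed.
Lemma strict_33 : strict_pfun (@ob33 K).
Proof. split; reflexivity. Qed.

Lemma strict_tens (J : bicat) (F G : pfun J K) :
  strict_pfun F -> strict_pfun G -> strict_pfun (F ⊗p G).
Proof.
intros HF HG. split; intros.
- change (⟪Fcomp (F ⊗p G) g f⟫ = ⟦(F1 F g ⊠ F1 G g) ∘ (F1 F f ⊠ F1 G f)⟧).
  cbn [Fcomp pf_tens pf_comp]. rewrite pk_iso_comp.
  rewrite (pk_Fcomp (strict_2functor (skew_tensor Hskew))).
  change (⟦(F1 F g ⊠ F1 G g) ∘ (F1 F f ⊠ F1 G f)⟧ ⊳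
    tt M ⟪Fcomp F g f⟫ ⟪Fcomp G g f⟫ = ⟦(F1 F g ⊠ F1 G g) ∘ (F1 F f ⊠ F1 G f)⟧).
  rewrite (pk_Fcomp HF), (pk_Fcomp HG), tt_im, tens_comp. now rewrite vt_im.
- change (⟪Fid (F ⊗p G) x⟫ = ⟦id1 (F x ⊗ G x)⟧).
  cbn [Fid pf_tens pf_comp]. rewrite pk_iso_comp.
  rewrite (pk_Fid (strict_2functor (skew_tensor Hskew))).
  change (⟦id1 (F x ⊗ G x)⟧ ⊳ tt M ⟪Fid F x⟫ ⟪Fid G x⟫ = ⟦id1 (F x ⊗ G x)⟧).
  rewrite (pk_Fid HF), (pk_Fid HG), tt_im, tens_id. now rewrite vt_im.
- change (tt M ⟪F2 F (β ⋆ α)⟫ ⟪F2 G (β ⋆ α)⟫ =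
    tt M ⟪F2 F β⟫ ⟪F2 G β⟫ ⊛ tt M ⟪F2 F α⟫ ⟪F2 G α⟫).
  rewrite tt_h, (pk_F2_h HF), (pk_F2_h HG). reflexivity.
Qed.

Lemma strict_ltens (A : K) : strict_pfun (ltens M A).
Proof. apply strict_tens; [apply strict_const|apply strict_id]. Qed.
Lemma strict_rtens (A : K) : strict_pfun (rtens M A).
Proof. apply strict_tens; [apply strict_id|apply strict_const]. Qed.

Definition strict_tr (J : bicat) (F G : pfun J K) (σ : trans F G) : Prop :=
  forall (x y : J) (f : hom x y), id_cell (tr2 σ f).

Lemma strict_tcomp (J : bicat) (F G H : pfun J K) (σ : trans F G) (τ : trans G H) :
  strict_tr σ -> strict_tr τ -> strict_tr (σ ;; τ).
Proof.
intros H1 H2 x y f. unfold id_cell.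
rewrite (pk_tcomp HK), (H2 _ _ f), (H1 _ _ f), <- !im_comp, <- !(assocE HK).
rewrite (pk_tgt (H2 _ _ f) : τ y ∘ F1 G f = _), (assocE HK). apply vt_im.
Qed.

Lemma strict_tid (J : bicat) (F : pfun J K) : strict_tr (tid F).
Proof. intros x y f. unfold id_cell. now rewrite (pk_tid HK), (runitE HK). Qed.

Lemma strict_2natural (J : bicat) (F G : pfun J K) (σ : trans F G) :
  is_2natural σ -> strict_tr σ.
Proof. intros H x y f. apply (pk_id2 (strict_tr2 H f)). Qed.

Lemma strict_ta (J : bicat) (F G H : pfun J K) : strict_tr (ta M F G H).
Proof.
intros x y f. exact (@strict_2natural _ _ _ _ (skew_assoc Hskew)
  (F x, G x, H x) (F y, G y, H y) (F1 F f, F1 G f, F1 H f)).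
Qed.

Lemma strict_tl (J : bicat) (F : pfun J K) : strict_tr (tl M F).
Proof.
intros x y f. exact (@strict_2natural _ _ _ _ (skew_left Hskew) _ _ (F1 F f)).
Qed.

Lemma strict_tr_ (J : bicat) (F : pfun J K) : strict_tr (tr_ M F).
Proof.
intros x y f. exact (@strict_2natural _ _ _ _ (skew_right Hskew) _ _ (F1 F f)).
Qed.

Lemma pk_ttens (J : bicat) (F F' G G' : pfun J K) (σ : trans F F') (τ : trans G G')
  (x y : J) (f : hom x y) :
  ⟪tr2 (ttens M σ τ) f⟫ = tt M ⟪tr2 σ f⟫ ⟪tr2 τ f⟫.
Proof.
set (HT := strict_2functor (skew_tensor Hskew)).
cbn [tr2 ttens]. rewrite !pk_iso_comp, (pk_Fcomp HT).
change (⟦(F1 F' f ⊠ F1 G' f) ∘ (σ x ⊠ τ x)⟧ ⊳ tt M ⟪tr2 σ f⟫ ⟪tr2 τ f⟫ ⊳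
  ⟪bwd (@Fcomp _ _ (tensor M) (_, _) (_, _) (_, _)
                   (σ y, τ y) (F1 F f, F1 G f))⟫ = tt M ⟪tr2 σ f⟫ ⟪tr2 τ f⟫).
rewrite (pk_bwd (@pk_Fcomp _ _ _ HT (F x, G x) (F y, G y) (F' y, G' y)
  (σ y, τ y) (F1 F f, F1 G f))).
change (⟦(F1 F' f ⊠ F1 G' f) ∘ (σ x ⊠ τ x)⟧ ⊳ tt M ⟪tr2 σ f⟫ ⟪tr2 τ f⟫ ⊳
  ⟦(σ y ⊠ τ y) ∘ (F1 F f ⊠ F1 G f)⟧ = tt M ⟪tr2 σ f⟫ ⟪tr2 τ f⟫).
rewrite !tens_comp. cbn [tt]. now rewrite vt_idr, vt_idl.
Qed.

Lemma strict_ttens (J : bicat) (F F' G G' : pfun J K) (σ : trans F F')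
  (τ : trans G G') : strict_tr σ -> strict_tr τ -> strict_tr (ttens M σ τ).
Proof.
intros H1 H2 x y f. unfold id_cell. rewrite pk_ttens, (H1 _ _ f), (H2 _ _ f), tt_im.
now rewrite <- tens_comp.
Qed.

(** When the naturality cells are identities, equal components suffice: both sides of the
    modification law are identity cells with the same boundary. *)
Definition strict_modif (J : bicat) (F G : pfun J K) (σ τ : trans F G)
  (Hσ : strict_tr σ) (Hτ : strict_tr τ) (e : forall x, σ x = τ x) : modif σ τ.
Proof.
refine (@Modif _ _ _ _ σ τ (fun x => castI eq_refl (e x) (iso_id (σ x))) _).
abstract (intros x y f; apply id_cell_eq; apply id_cell_v; try apply id_cell_h;
  try apply id_cell_id;
  first [apply Hσ|apply Hτ|exact (pk_castI _ _ _)]).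
Defined.

Context (Ha : forall x y z : K, is_equivalence (a x y z))
  (Hl : forall x : K, is_equivalence (l x))
  (Hr : forall x : K, is_equivalence (r x)).

(** [is_equivalence] is a proposition, while [adj_equiv] stores an inverse as data; the choice
    principle bridges the two. *)
Definition adjoint_choice (x y : K) (u : hom x y) (H : is_equivalence u) : adjoint u.
Proof.
assert (E : exists A : adjoint u, True).
{ destruct H as [v Hv]. destruct (adjoint_of_equivalence HK Hv) as [A _]. now exists A. }
exact (proj1_sig (constructive_indefinite_description _ E)).
Defined.

Definition mon_a : adj_equiv (massoc M).
Proof.
refine (strict_adj_equiv HK _ _ (skew_assoc Hskew)
  (fun x => match x with (x1, x2, x3) => adjoint_choice (Ha x1 x2 x3) end)).
all: repeat first [apply strict_tens|apply strict_31|apply strict_32|apply strict_33].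
Defined.

Definition mon_l : adj_equiv (mleft M).
Proof.
refine (strict_adj_equiv HK _ _ (skew_left Hskew) (fun x => adjoint_choice (Hl x))).
all: repeat first [apply strict_tens|apply strict_const|apply strict_id].
Defined.

Definition mon_r : adj_equiv (mright M).
Proof.
refine (strict_adj_equiv HK _ _ (skew_right Hskew) (fun x => adjoint_choice (Hr x))).
all: repeat first [apply strict_tens|apply strict_const|apply strict_id].
Defined.

Ltac strict_trans := repeat first [apply strict_tcomp|apply strict_ttens
  |apply strict_ta|apply strict_tl|apply strict_tr_|apply strict_tid].

Definition mon_π : modif (ttens M (ta M ob41 ob42 ob43) (tid _) ;;
    ta M ob41 (ob42 ⊗p ob43) ob44 ;; ttens M (tid _) (ta M ob42 ob43 ob44))
  (ta M (ob41 ⊗p ob42) ob43 ob44 ;; ta M ob41 ob42 (ob43 ⊗p ob44)).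
Proof.
refine (strict_modif _ _ _); [strict_trans|strict_trans|].
intros [[[A B] C] D]. symmetry. apply (skew_pentagon Hskew).
Defined.

Definition mon_μ : modif (ttens M (tr_ M ob21) (tid _) ;; ta M ob21 (pf_const I) ob22
    ;; ttens M (tid _) (tl M ob22)) (tid (ob21 ⊗p ob22)).
Proof.
refine (strict_modif _ _ _); [strict_trans|strict_trans|].
intros [A B]. apply (skew_middle_triangle Hskew).
Defined.

Definition mon_λ : modif (ttens M (tl M ob21) (tid ob22))
  (ta M (pf_const I) ob21 ob22 ;; tl M (ob21 ⊗p ob22)).
Proof.
refine (strict_modif _ _ _); [strict_trans|strict_trans|].
intros [A B]. symmetry. apply (skew_left_triangle Hskew).
Defined.

Definition mon_ρ : modif (ttens M (tid ob21) (tr_ M ob22))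
  (tr_ M (ob21 ⊗p ob22) ;; ta M ob21 ob22 (pf_const I)).
Proof.
refine (strict_modif _ _ _); [strict_trans|strict_trans|].
intros [A B]. symmetry. apply (skew_right_triangle Hskew).
Defined.

Lemma id_cell_mon_π x : id_cell (mon_π x).
Proof. exact (pk_castI _ _ _). Qed.
Lemma id_cell_mon_μ x : id_cell (mon_μ x).
Proof. exact (pk_castI _ _ _). Qed.
Lemma id_cell_mon_λ x : id_cell (mon_λ x).
Proof. exact (pk_castI _ _ _). Qed.
Lemma id_cell_mon_ρ x : id_cell (mon_ρ x).
Proof. exact (pk_castI _ _ _). Qed.

Lemma id_cell_a (x y : (K × K × K)%bicat) (f : hom x y) : id_cell (tr2 (massoc M) f).
Proof. apply strict_2natural, Hskew. Qed.

Lemma id_cell_tens2 (x y x' y' : K) (f g : hom x y) (f' g' : hom x' y')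
  (α : iso2 f g) (β : iso2 f' g') : id_cell α -> id_cell β -> id_cell (tens2 M α β).
Proof.
unfold id_cell. intros H1 H2. change (tt M ⟪α⟫ ⟪β⟫ = ⟦f ⊠ f'⟧).
now rewrite H1, H2, tt_im.
Qed.

Lemma id_cell_Fid (x y : K) : id_cell (Fid (tensor M) (x, y)).
Proof. apply (pk_Fid (strict_2functor (skew_tensor Hskew)) (x, y)). Qed.

Lemma id_cell_a_nat1 (x y : K) (f : hom x y) (B C : K) : id_cell (a_nat1 M f B C).
Proof.
apply id_cell_v; [apply id_cell_bwd, id_cell_a|]. apply id_cell_h; [|apply id_cell_id].
apply id_cell_tens2; [apply id_cell_id|apply id_cell_bwd, id_cell_Fid].
Qed.

Lemma id_cell_a_nat2 (A x y : K) (f : hom x y) (C : K) : id_cell (a_nat2 M A f C).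
Proof. apply id_cell_bwd, id_cell_a. Qed.

Lemma id_cell_a_nat3 (A B x y : K) (f : hom x y) : id_cell (a_nat3 M A B f).
Proof.
apply id_cell_v; [|apply id_cell_bwd, id_cell_a]. apply id_cell_h; [apply id_cell_id|].
apply id_cell_tens2; [apply id_cell_Fid|apply id_cell_id].
Qed.

Ltac id_cell_paste :=
  repeat match goal with
  | |- id_cell (fwd (pvcomp _ _)) => apply id_cell_pv
  | |- id_cell (fwd (@skip _ ?x ?y ?z ?f ?p ?q ?α)) =>
      refine (@id_cell_skip _ HK x y z f p q α _)
  | |- id_cell (fwd (@here _ ?x ?y ?z ?p ?q ?v ?α)) =>
      refine (@id_cell_here _ HK x y z p q v α _)
  | |- id_cell (fwd (pinv ?α)) => refine (id_cell_bwd (α := α) _)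
  | |- id_cell (fwd (pmap_cell (ltens _ ?A) ?α)) =>
      refine (id_cell_pmap HK (strict_ltens A) _)
  | |- id_cell (fwd (pmap_cell (rtens _ ?A) ?α)) =>
      refine (id_cell_pmap HK (strict_rtens A) _)
  | |- id_cell (fwd (a_nat1 _ _ _ _)) => apply id_cell_a_nat1
  | |- id_cell (fwd (a_nat2 _ _ _ _)) => apply id_cell_a_nat2
  | |- id_cell (fwd (a_nat3 _ _ _ _)) => apply id_cell_a_nat3
  | |- id_cell (fwd (md _ ?x)) => first [exact (id_cell_mon_π x)|exact (id_cell_mon_μ x)
      |exact (id_cell_mon_λ x)|exact (id_cell_mon_ρ x)]
  end.

(** The structural modifications are the strict skew axioms themselves, so all three coherence
    axioms compare pastings of identity cells. *)
Definition skew_monoidal_bicategory : monoidal_bicategory M.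
Proof.
refine (@MonoidalBicategory K M (twofunctor_pseudo (skew_tensor Hskew))
  mon_a mon_l mon_r mon_π mon_μ mon_λ mon_ρ _ _ _).
all: abstract (intros; apply id_cell_eq; id_cell_paste).
Defined.

Lemma skew_has_strict_coherence : has_strict_coherence skew_monoidal_bicategory.
Proof.
repeat split; intros.
- exact (is_id2_pk (id_cell_mon_π (A, B, C, D))).
- exact (is_id2_pk (id_cell_mon_μ (A, B))).
- exact (is_id2_pk (id_cell_mon_λ (A, B))).
- exact (is_id2_pk (id_cell_mon_ρ (A, B))).
Qed.

(** * Strong endofunctors *)

Context {sy : symmetry_data M} (Hsym : is_symmetry sy).
Local Notation s := (sc sy).

Lemma s_natT (x y x' y' x'' y'' : K) (c : tcell x y) (c' : tcell x' y')
  (c'' : tcell x'' y'') :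
  ⟦s y y' y''⟧ ⊛ ((c ⊡ c') ⊡ c'') = ((c ⊡ c'') ⊡ c') ⊛ ⟦s x x' x''⟧.
Proof.
destruct c as [f1 f2 α|], c' as [f1' f2' α'|], c'' as [f1'' f2'' α''|];
  try reflexivity.
symmetry. exact (@trans_nat _ _ _ _ _ (proj1 (sym_2natural_iso Hsym))
  (x, x', x'') (y, y', y'') (f1, f1', f1'') (f2, f2', f2'') (α, α', α'')).
Qed.

Lemma s_nat (x y x' y' x'' y'' : K) (f : hom x y) (f' : hom x' y')
  (f'' : hom x'' y'') :
  s y y' y'' ∘ ((f ⊠ f') ⊠ f'') = ((f ⊠ f'') ⊠ f') ∘ s x x' x''.
Proof.
apply im_inj. rewrite !im_comp, <- !tt_im. apply s_natT.
Qed.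

Ltac nrm := rewrite ?(lunitE HK), ?(runitE HK), ?(assocE HK).
Ltac nrm_in H := rewrite ?(lunitE HK), ?(runitE HK), ?(assocE HK) in H.
Lemma tens_l (x y z w : K) (g : hom y z) (f : hom x y) :
  (g ∘ f) ⊠ id1 w = (g ⊠ id1 w) ∘ (f ⊠ id1 w).
Proof. now rewrite tens_comp, (lunitE HK). Qed.

Lemma tens_r (x y z w : K) (g : hom y z) (f : hom x y) :
  id1 w ⊠ (g ∘ f) = (id1 w ⊠ g) ∘ (id1 w ⊠ f).
Proof. now rewrite tens_comp, (lunitE HK). Qed.

Lemma assoc_eq2 (x y z w : K) (h : hom z w) (g : hom y z) (k : hom y w) :
  h ∘ g = k -> forall f : hom x y, h ∘ (g ∘ f) = k ∘ f.
Proof. intros H f. now rewrite <- H, (assocE HK). Qed.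

Lemma assoc_eq3 (x y z w v : K) (i : hom w v) (h : hom z w) (g : hom y z) (k : hom y v) :
  i ∘ (h ∘ g) = k -> forall f : hom x y, i ∘ (h ∘ (g ∘ f)) = k ∘ f.
Proof. intros H f. now rewrite <- H, !(assocE HK). Qed.

(* rewrites with an equation between composites inside a right-nested composite *)
Ltac rw E :=
  let H := fresh "H" in pose proof E as H; nrm_in H;
  first [rewrite H | rewrite (assoc_eq2 H) | rewrite (assoc_eq3 H)]; clear H; nrm.

Lemma left_triangle (x y : K) : l (x ⊗ y) ∘ a I x y = l x ⊠ id1 y.
Proof. apply (skew_left_triangle Hskew). Qed.

(** The compatibility of s with r is not an axiom of a symmetry; it follows from (B2) with last
    object I, the right triangle and (Sym). It is the field [sd_r] of the endofunctor - ⊗ A. *)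
Lemma s_r (x y : K) : s x y I ∘ r (x ⊗ y) = r x ⊠ id1 y.
Proof.
assert (H : forall z, (a x z I ⊠ id1 y) ∘ (s (x ⊗ z) y I ∘ r ((x ⊗ z) ⊗ y)) =
  (a x z I ⊠ id1 y) ∘ (r (x ⊗ z) ⊠ id1 y)).
{ intros z.
  (* The 1-cell [s x z y] is inserted so that, after moving r and s by naturality, both sides
     contain s followed by its inverse. *)
  pose proof (f_equal (fun k => k ∘ (r (x ⊗ y ⊗ z) ∘ s x z y)) (sym_B2 Hsym x y z I))
    as H.
  cbv beta in H. nrm_in H.
  rewrite <- (assocE HK (a (x ⊗ y) z I)), (skew_right_triangle Hskew) in H.
  rewrite <- (tens_id x y), <- (assocE HK (s x y (z ⊗ I))), s_nat, (assocE HK),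
    (sym_Sym Hsym), (runitE HK) in H.
  rewrite <- (assocE HK (s x y z ⊠ id1 I)), r_nat, (assocE HK), (sym_Sym Hsym),
    (runitE HK) in H.
  now rewrite <- H, tens_comp, (skew_right_triangle Hskew), (lunitE HK). }
(* The middle triangle gives a left inverse of the associator preceded by r; this cancels the factor
   a left over in [H], taken at z = I. *)
assert (H' : forall k : hom (x ⊗ y) (x ⊗ I ⊗ y), ((id1 x ⊠ l I) ⊠ id1 y) ∘
  ((a x I I ⊠ id1 y) ∘ (((r x ⊠ id1 I) ⊠ id1 y) ∘ k)) = k).
{ intros k. rewrite <- !(assocE HK), !tens_comp, (skew_middle_triangle Hskew).
  now rewrite !(lunitE HK), tens_id, (lunitE HK). }
rewrite <- (H' (s x y I ∘ r (x ⊗ y))), <- (H' (r x ⊠ id1 y)).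
f_equal. rewrite <- (assocE HK ((r x ⊠ id1 I) ⊠ id1 y)), <- s_nat, (assocE HK),
  r_nat, <- (assocE HK (s _ _ _)), <- (assocE HK), H, (assocE HK).
now rewrite !tens_comp, r_nat.
Qed.

(* The model is [- ⊗ A], with [st] = a and [sd] = s ([satom]); the fields [sd_a], [sd_s] and
   [sd_st] are then (B2), (B3) and (B4). *)
Record sfun := Sfun {
  sf :> K -> K;
  sm : forall x y, hom x y -> hom (sf x) (sf y);
  st : forall x y, hom (sf (x ⊗ y)) (x ⊗ sf y);
  sd : forall x z, hom (sf x ⊗ z) (sf (x ⊗ z));
  sm_id : forall x, sm (id1 x) = id1 (sf x);
  sm_comp : forall x y z (g : hom y z) (f : hom x y), sm (g ∘ f) = sm g ∘ sm f;
  sm_equiv : forall x y (f : hom x y), is_equivalence f -> is_equivalence (sm f);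
  st_equiv : forall x y, is_equivalence (st x y);
  st_nat : forall x x' y y' (f : hom x x') (g : hom y y'),
    st x' y' ∘ sm (f ⊠ g) = (f ⊠ sm g) ∘ st x y;
  sd_nat : forall x x' z z' (f : hom x x') (g : hom z z'),
    sd x' z' ∘ (sm f ⊠ g) = sm (f ⊠ g) ∘ sd x z;
  st_a : forall x y z, a x y (sf z) ∘ st (x ⊗ y) z =
    (id1 x ⊠ st y z) ∘ (st x (y ⊗ z) ∘ sm (a x y z));
  st_l : forall x, l (sf x) ∘ st I x = sm (l x);
  sd_r : forall x, sd x I ∘ r (sf x) = sm (r x);
  sd_a : forall x y z, sd x (y ⊗ z) ∘ a (sf x) y z =
    sm (a x y z) ∘ (sd (x ⊗ y) z ∘ (sd x y ⊠ id1 z));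
  sd_s : forall x y z, s x (sf y) z ∘ (st x y ⊠ id1 z) =
    st (x ⊗ z) y ∘ (sm (s x y z) ∘ sd (x ⊗ y) z);
  sd_st : forall x y z, st x (y ⊗ z) ∘ (sm (a x y z) ∘ sd (x ⊗ y) z) =
    (id1 x ⊠ sd y z) ∘ (a x (sf y) z ∘ (st x y ⊠ id1 z))
}.

Arguments sm s {x y} f.

Lemma equivalence_comp (x y z : K) (g : hom y z) (f : hom x y) :
  is_equivalence g -> is_equivalence f -> is_equivalence (g ∘ f).
Proof.
intros [g' [[η] [ε]]] [f' [[η'] [ε']]]. exists (f' ∘ g'). split; constructor.
- refine (iso_comp η' (castI (f := f' ∘ (id1 y ∘ f)) _ _
    (iso_hcomp (iso_id f') (iso_hcomp η (iso_id f))))); now nrm.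
- refine (iso_comp (castI (g := g ∘ (id1 y ∘ g')) _ _
    (iso_hcomp (iso_id g) (iso_hcomp ε' (iso_id g')))) ε); now nrm.
Qed.

Lemma equivalence_id (x : K) : is_equivalence (id1 x).
Proof.
exists (id1 x). split; constructor; [apply iso_inv|]; apply lunit_iso.
Qed.

Lemma equivalence_tens (x y x' y' : K) (f : hom x y) (f' : hom x' y') :
  is_equivalence f -> is_equivalence f' -> is_equivalence (f ⊠ f').
Proof.
intros [g [[η] [ε]]] [g' [[η'] [ε']]]. exists (g ⊠ g'). split; constructor.
- refine (castI _ _ (tens2 M η η')); [apply tens_id|].
  symmetry. apply tens_comp.
- refine (castI _ _ (tens2 M ε ε')); [|apply tens_id].
  symmetry. apply tens_comp.
Qed.

Definition satom (A : K) : sfun.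
Proof.
refine (@Sfun (fun x => x ⊗ A) (fun _ _ f => f ⊠ id1 A) (fun x y => a x y A)
  (fun x z => s x A z) _ _ _ _ _ _ _ _ _ _ _ _).
- intros. apply tens_id.
- intros. now rewrite tens_comp, (lunitE HK).
- intros. now apply equivalence_tens, equivalence_id.
- intros. apply Ha.
- intros. apply a_nat.
- intros. apply s_nat.
- intros. rewrite (skew_pentagon Hskew). now nrm.
- intros. apply left_triangle.
- intros. apply s_r.
- intros. rewrite (sym_B2 Hsym). now nrm.
- intros. rewrite (sym_B3 Hsym). now nrm.
- intros. pose proof (sym_B4 Hsym x y A z) as H. nrm_in H. now symmetry.
Defined.

(** [S] is applied first, so that the composite for A and B is x ↦ (x A) B, in the order of the
    tensor product. *)
Definition scomp (S T : sfun) : sfun.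
Proof.
refine (@Sfun (fun x => T (S x)) (fun _ _ f => sm T (sm S f))
  (fun x y => st T x (S y) ∘ sm T (st S x y))
  (fun x z => sm T (sd S x z) ∘ sd T (S x) z) _ _ _ _ _ _ _ _ _ _ _ _); intros.
- now rewrite !sm_id.
- now rewrite !sm_comp.
- now do 2 apply sm_equiv.
- apply equivalence_comp; [|apply sm_equiv]; apply st_equiv.
- nrm. rewrite <- sm_comp, st_nat, sm_comp, <- (assocE HK), st_nat. now nrm.
- nrm. rewrite sd_nat, <- (assocE HK), <- sm_comp, sd_nat, sm_comp. now nrm.
- nrm. rw (st_a T x y (S z)). rewrite <- !sm_comp, st_a, !sm_comp.
  rw (st_nat T (id1 x) (st S y z)). rewrite <- (assocE HK (_ ⊠ _) (_ ⊠ _)), tens_comp.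
  now nrm.
- nrm. rw (st_l T (S x)). now rewrite <- sm_comp, st_l.
- nrm. now rewrite sd_r, <- sm_comp, sd_r.
- nrm. rewrite sd_a. rw (eq_sym (sm_comp T (sd S x (y ⊗ z)) (a (S x) y z))).
  rewrite sd_a, !sm_comp. nrm. f_equal. f_equal.
  rewrite tens_l.
  rw (sd_nat T (sd S x y) (id1 z)). reflexivity.
- nrm. rewrite tens_l.
  rw (sd_s T x (S y) z). rw (sd_nat T (st S x y) (id1 z)).
  rw (eq_sym (sm_comp T (s x (S y) z) (st S x y ⊠ id1 z))).
  rewrite sd_s, !sm_comp. now nrm.
- nrm. rw (eq_sym (sm_comp T (sm S (a x y z)) (sd S (x ⊗ y) z))).
  rw (eq_sym (sm_comp T (st S x (y ⊗ z)) (sm S (a x y z) ∘ sd S (x ⊗ y) z))).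
  rewrite sd_st, !sm_comp. nrm.
  rw (st_nat T (id1 x) (sd S y z)).
  rw (eq_sym (sd_nat T (st S x y) (id1 z))).
  rw (sd_st T x (S y) z).
  rewrite tens_r, tens_l. now nrm.
Defined.

(** For S = - ⊗ A this is x A → (x I) A → x (I A). It is an equivalence by [w_equiv], and [w_l]
    shows that at I it is a section of ℓ. *)
Definition w (S : sfun) (x : K) : hom (S x) (x ⊗ S I) := st S x I ∘ sm S (r x).

Lemma w_nat (S : sfun) (x y : K) (f : hom x y) :
  w S y ∘ sm S f = (f ⊠ id1 (S I)) ∘ w S x.
Proof.
unfold w. nrm. rewrite <- sm_comp, <- r_nat, sm_comp. rw (st_nat S f (id1 I)).
now rewrite sm_id.
Qed.

Lemma w_equiv (S : sfun) (x : K) : is_equivalence (w S x).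
Proof. apply equivalence_comp; [apply st_equiv|apply sm_equiv, Hr]. Qed.

Lemma w_st (S : sfun) (x y : K) :
  a x y (S I) ∘ w S (x ⊗ y) = (id1 x ⊠ w S y) ∘ st S x y.
Proof.
unfold w. rw (st_a S x y I). rewrite <- sm_comp, (skew_right_triangle Hskew).
now rewrite st_nat, tens_r, (assocE HK).
Qed.

Lemma w_l (S : sfun) : l (S I) ∘ w S I = id1 (S I).
Proof.
unfold w. rw (st_l S I). now rewrite <- sm_comp, (skew_unit Hskew), sm_id.
Qed.

Lemma w_scomp (S T : sfun) (x : K) :
  w (scomp S T) x = st T x (S I) ∘ sm T (w S x).
Proof. unfold w. cbn. now rewrite sm_comp, (assocE HK). Qed.

(** * Strong transformations and swaps *)

Record snat (S T : sfun) := Snat {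
  n :> forall x, hom (S x) (T x);
  n_nat : forall x y (f : hom x y), n y ∘ sm S f = sm T f ∘ n x;
  n_st : forall x y, st T x y ∘ n (x ⊗ y) = (id1 x ⊠ n y) ∘ st S x y
}.

(** The strength reduces a component at x to the one at I, so evaluating at I is compatible with
    changing the presentation. *)
Lemma n_w (S T : sfun) (m : snat S T) (x : K) :
  w T x ∘ m x = (id1 x ⊠ m I) ∘ w S x.
Proof. unfold w. nrm. rewrite <- n_nat. rw (n_st m x I). reflexivity. Qed.

Definition snat_id (S : sfun) : snat S S.
Proof.
refine (@Snat S S (fun x => id1 (S x)) _ _); intros; nrm; [reflexivity|].
now rewrite tens_id, (lunitE HK).
Defined.

(** Its components are identities, but [snat_id] does not apply: the strengths of the two
    bracketings agree only up to functoriality of U. *)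
Definition snat_assoc (S T U : sfun) :
  snat (scomp (scomp S T) U) (scomp S (scomp T U)).
Proof.
refine (@Snat (scomp (scomp S T) U) (scomp S (scomp T U))
  (fun x => id1 (U (T (S x)))) _ _); intros; cbn; nrm; [reflexivity|].
rewrite tens_id. nrm. now rewrite sm_comp.
Defined.

Definition snat_assoc_inv (S T U : sfun) :
  snat (scomp S (scomp T U)) (scomp (scomp S T) U).
Proof.
refine (@Snat (scomp S (scomp T U)) (scomp (scomp S T) U)
  (fun x => id1 (U (T (S x)))) _ _); intros; cbn; nrm; [reflexivity|].
rewrite tens_id. nrm. now rewrite sm_comp.
Defined.

Definition snat_comp (S T U : sfun) (m : snat T U) (m' : snat S T) : snat S U.
Proof.
refine (@Snat S U (fun x => m x ∘ m' x) _ _); intros; nrm.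
- rewrite n_nat. rw (n_nat m f). reflexivity.
- rewrite tens_r. rw (n_st m x y). rw (n_st m' x y). reflexivity.
Defined.

Definition snat_h (S S' T T' : sfun) (m : snat S S') (m' : snat T T') :
  snat (scomp S T) (scomp S' T').
Proof.
refine (@Snat (scomp S T) (scomp S' T') (fun x => m' (S' x) ∘ sm T (m x)) _ _);
  intros; cbn; nrm.
- rewrite <- sm_comp, (n_nat m f), sm_comp. rw (n_nat m' (sm S' f)). reflexivity.
- rw (eq_sym (n_nat m' (st S' x y))). rewrite <- sm_comp, n_st, sm_comp.
  rw (n_st m' x (S' y)). rw (st_nat T (id1 x) (m y)). now rewrite tens_r, (assocE HK).
Defined.

(* Generalizes s_{X,A,B} : (X A) B -> (X B) A to composites of the endofunctors [- ⊗ A];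
   by [swap_sd] a swap is determined by s, see [swap_ww]. *)
Record swap (S T : sfun) := Swap {
  swap_nt :> snat (scomp S T) (scomp T S);
  swap_sd : forall x z, sd S x (T z) ∘ st T (S x) z =
    sm S (st T x z) ∘ (swap_nt (x ⊗ z) ∘ sm T (sd S x z))
}.

(** Here [swap_sd] is precisely [sd_a]. For S = - ⊗ A the component is s itself. *)
Definition swap_with_atom (S : sfun) (B : K) : swap S (satom B).
Proof.
unshelve refine (@Swap S (satom B) (@Snat (scomp S (satom B)) (scomp (satom B) S)
  (fun x => sd S x B) _ _) _); intros; cbn.
- apply sd_nat.
- nrm. apply sd_st.
- apply sd_a.
Defined.

(** S is exchanged with T and then with T'. For atoms this is the composite of two s that (B2)
    compares with s at a tensor product. *)
Definition swap_comp (S T T' : sfun) (B : swap S T) (B' : swap S T') :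
  swap S (scomp T T').
Proof.
unshelve refine (@Swap S (scomp T T')
  (@Snat (scomp S (scomp T T')) (scomp (scomp T T') S)
  (fun x => B' (T x) ∘ sm T' (B x)) _ _) _); intros; cbn; nrm.
- pose proof (n_nat B f) as H. pose proof (n_nat B' (sm T f)) as H'. cbn in H, H'.
  rewrite <- sm_comp, H, sm_comp. rw H'. reflexivity.
- pose proof (n_st B x y) as H. pose proof (n_st B' x (T y)) as H'.
  pose proof (n_nat B' (st T x y)) as H''. cbn in H, H', H''.
  rewrite sm_comp. nrm. rw (eq_sym H''). rw H'.
  rewrite <- !sm_comp. nrm_in H. rewrite H, !sm_comp. nrm.
  rw (st_nat T' (id1 x) (B y)). now rewrite tens_r, (assocE HK).
- pose proof (swap_sd B x z) as H. pose proof (swap_sd B' x (T z)) as H'.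
  pose proof (n_nat B' (st T x z)) as H''. cbn in H''. cbn in *.
  rw H'. rewrite <- sm_comp, H, !sm_comp. nrm. rw H''. reflexivity.
Defined.

Lemma s_r' (x y : K) : s x I y ∘ (r x ⊠ id1 y) = r (x ⊗ y).
Proof. rewrite <- s_r, <- (assocE HK), (sym_Sym Hsym). now nrm. Qed.

Lemma swap_w (S T : sfun) (B : swap S T) (x : K) :
  sd S x (T I) ∘ w T (S x) = sm S (w T x) ∘ B x.
Proof.
unfold w. rewrite sm_comp. rw (swap_sd B x I).
cbn [sf scomp]. rewrite <- sm_comp, sd_r. pose proof (n_nat B (r x)) as H.
cbn in H. now rewrite H.
Qed.

(** [swap_w] trades the swap for [sd], the field [sd_s] brings in s, and [s_r'] absorbs the unit
    object. *)
Lemma swap_ww (S T : sfun) (B : swap S T) (x : K) :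
  s x (S I) (T I) ∘ ((w S x ⊠ id1 (T I)) ∘ w T (S x)) =
  (w T x ⊠ id1 (S I)) ∘ (w S (T x) ∘ B x).
Proof.
rw (eq_sym (w_nat S (w T x))). rewrite <- swap_w. unfold w at 1 3. nrm.
rewrite tens_l. nrm. rw (sd_s S x I (T I)). rw (sd_nat S (r x) (id1 (T I))).
rw (eq_sym (sm_comp S (s x I (T I)) (r x ⊠ id1 (T I)))).
now rewrite s_r'.
Qed.

(** * Covers *)

(* An object presented by a strong endofunctor. *)
Record cob (x : K) := Cob {
  cs : sfun;
  cu : hom (cs I) x;
  cu_equiv : is_equivalence cu
}.

Definition catom (x : K) : cob x := @Cob x (satom x) (l x) (Hl x).

(** The map [w] splits T (S I) into S I ⊗ T I, on which the two given equivalences act. *)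
Definition ctens (x y : K) (V : cob x) (W : cob y) : cob (x ⊗ y).
Proof.
refine (@Cob (x ⊗ y) (scomp (cs V) (cs W)) ((cu V ⊠ cu W) ∘ w (cs W) (cs V I)) _).
apply equivalence_comp; [apply equivalence_tens; apply cu_equiv|apply w_equiv].
Defined.

(* A 1-cell covered by a strong transformation; [good] 2-cells are those compatible with
   covers. *)
Record cov (x y : K) (V : cob x) (W : cob y) (f : hom x y) := Cov {
  cn : snat (cs V) (cs W);
  cθ : iso2 (cu W ∘ cn I) (f ∘ cu V)
}.

Definition good (x y : K) (V : cob x) (W : cob y) (f g : hom x y)
  (c : cov V W f) (d : cov V W g) (t : tcell x y) : Prop :=
  (forall X, cn c X = cn d X) /\ ⟪cθ c⟫ ⊳ t ⊛ ⟦cu V⟧ = ⟪cθ d⟫.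

Lemma good_v (x y : K) (V : cob x) (W : cob y) (f g h f' : hom x y)
  (c : cov V W f) (d : cov V W g) (e : cov V W h) (γ : cell f f') (δ : cell f' h) :
  good c d ⟪γ⟫ -> good d e ⟪δ⟫ -> good c e (⟪γ⟫ ⊳ ⟪δ⟫).
Proof.
intros [H1 H2] [H3 H4]. split; [congruence|].
now rewrite <- pk_v, pk_v_l, <- vt_assoc, H2.
Qed.

Lemma good_inv (x y : K) (V : cob x) (W : cob y) (f g : hom x y)
  (c : cov V W f) (d : cov V W g) (γ : iso2 f g) :
  good c d ⟪γ⟫ -> good d c ⟪bwd γ⟫.
Proof.
intros [H1 H2]. split; [congruence|].
rewrite <- H2, vt_assoc, fwd_bwd_l. apply vt_idr.
Qed.

Lemma good_strict (x y : K) (V : cob x) (W : cob y) (f g : hom x y)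
  (c : cov V W f) (d : cov V W g) :
  (forall X, cn c X = cn d X) -> ⟪cθ c⟫ = ⟪cθ d⟫ -> good c d ⟦f⟧.
Proof.
intros H1 H2. split; [easy|]. rewrite <- im_comp. now rewrite vt_idr.
Qed.

Lemma good_refl (x y : K) (V : cob x) (W : cob y) (f : hom x y)
  (c : cov V W f) : good c c ⟦f⟧.
Proof. now apply good_strict. Qed.

Lemma cob_adj (x : K) (V : cob x) : exists A : adjoint (cu V), True.
Proof.
destruct (cu_equiv V) as [u' Hu].
destruct (adjoint_of_equivalence HK Hu) as [A _]. now exists A.
Qed.

(** Compatibility fixes the whiskering of the 2-cell by [cu V] because [cθ c] is invertible, and
    this whiskering is faithful because [cu V] is an equivalence. Every coherence axiom is proved
    through this. *)
Lemma good_unique (x y : K) (V : cob x) (W : cob y) (f g : hom x y)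
  (c : cov V W f) (d : cov V W g) (γ δ : cell f g) :
  good c d ⟪γ⟫ -> good c d ⟪δ⟫ -> γ = δ.
Proof.
intros [_ H1] [_ H2]. destruct (cob_adj V) as [A _].
apply pk_inj, (whisker_inj HK A); try reflexivity.
apply vt_cancel with (α := cθ c).
- now exists (g ∘ cu V), (γ ⋆ id2 (cu V)).
- now exists (g ∘ cu V), (δ ⋆ id2 (cu V)).
- congruence.
Qed.

(** The cell ([cθ c])⁻¹ followed by [cθ d] is composable since the transformations agree, and it
    lifts along the equivalence [cu V]. *)
Lemma good_ex (x y : K) (V : cob x) (W : cob y) (f g : hom x y)
  (c : cov V W f) (d : cov V W g) :
  (forall X, cn c X = cn d X) -> exists γ : iso2 f g, good c d ⟪γ⟫.
Proof.
intros H. destruct (cob_adj V) as [A _].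
assert (e : cu W ∘ cn d I = cu W ∘ cn c I) by now rewrite H.
destruct (whisker_full HK A (iso_comp (iso_inv (cθ c)) (castI e eq_refl (cθ d))))
  as [γ Hγ].
exists γ. split; [exact H|].
rewrite Hγ, pk_iso_comp, pk_castI.
change (⟪cθ c⟫ ⊳ ⟪bwd (cθ c)⟫ ⊳ ⟪cθ d⟫ = ⟪cθ d⟫).
rewrite <- vt_assoc, fwd_bwd. now rewrite vt_idl_eq.
Qed.

Definition cov_comp (x y z : K) (V : cob x) (W : cob y) (Z : cob z)
  (g : hom y z) (f : hom x y) (d : cov W Z g) (c : cov V W f) : cov V Z (g ∘ f).
Proof.
refine (@Cov x z V Z (g ∘ f) (snat_comp (cn d) (cn c))
  (iso_comp (castI _ eq_refl (iso_hcomp (cθ d) (iso_id (cn c I))))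
            (castI _ _ (iso_hcomp (iso_id g) (cθ c))))); abstract (cbn; now nrm).
Defined.

Lemma cov_compE (x y z : K) (V : cob x) (W : cob y) (Z : cob z)
  (g : hom y z) (f : hom x y) (d : cov W Z g) (c : cov V W f) :
  ⟪cθ d⟫ ⊛ ⟦cn c I⟧ ⊳ ⟦g⟧ ⊛ ⟪cθ c⟫ = ⟪cθ (cov_comp d c)⟫.
Proof. cbn [cθ cov_comp]. now rewrite pk_iso_comp, !pk_castI. Qed.

Definition cov_id (x : K) (V : cob x) : cov V V (id1 x).
Proof.
refine (@Cov x x V V (id1 x) (snat_id (cs V)) (castI _ _ (iso_id (cu V))));
abstract (cbn; now nrm).
Defined.

Lemma cov_idE (x : K) (V : cob x) : ⟪cθ (cov_id V)⟫ = ⟦cu V⟧.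
Proof. cbn [cθ cov_id]. now rewrite pk_castI. Qed.

(** Through [w], horizontal composition of strong transformations becomes the tensor product of
    1-cells; this is what makes a tensor product of covers a cover. *)
Lemma w_snat_h (S S' T T' : sfun) (m : snat S S') (m' : snat T T') (x : K) :
  w T' (S' x) ∘ (m' (S' x) ∘ sm T (m x)) = (m x ⊠ m' I) ∘ w T (S x).
Proof.
rw (n_w m' (S' x)). rewrite w_nat, <- (assocE HK), tens_comp. now nrm.
Qed.

Definition cov_tens (x y x' y' : K) (V : cob x) (W : cob y) (V' : cob x')
  (W' : cob y') (f : hom x x') (g : hom y y') (c : cov V V' f) (d : cov W W' g) :
  cov (ctens V W) (ctens V' W') (f ⊠ g).
Proof.
refine (@Cov _ _ (ctens V W) (ctens V' W') (f ⊠ g) (snat_h (cn c) (cn d))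
  (castI _ _ (iso_hcomp (tens2 M (cθ c) (cθ d)) (iso_id (w (cs W) (cs V I)))))).
- abstract (cbn; rewrite (assocE HK), w_snat_h, <- (assocE HK), tens_comp;
    reflexivity).
- abstract (cbn [cu ctens]; now rewrite <- (assocE HK), tens_comp).
Defined.

Lemma cov_tensE (x y x' y' : K) (V : cob x) (W : cob y) (V' : cob x')
  (W' : cob y') (f : hom x x') (g : hom y y') (c : cov V V' f) (d : cov W W' g) :
  ⟪cθ (cov_tens c d)⟫ = (⟪cθ c⟫ ⊡ ⟪cθ d⟫) ⊛ ⟦w (cs W) (cs V I)⟧.
Proof. cbn [cθ cov_tens]. now rewrite pk_castI. Qed.

(** The two ways of splitting a composite of endofunctors differ exactly by a. By [cu_assoc], a is
    then covered by identities with an identity 2-cell. *)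
Lemma w_assoc (T U : sfun) (x : K) :
  a x (T I) (U I) ∘ ((w T x ⊠ id1 (U I)) ∘ w U (T x)) =
  (id1 x ⊠ w U (T I)) ∘ w (scomp T U) x.
Proof.
rewrite w_scomp, <- w_nat. rw (w_st U x (T I)). reflexivity.
Qed.

Lemma cu_assoc (x y z : K) (V : cob x) (W : cob y) (Z : cob z) :
  cu (ctens V (ctens W Z)) = a x y z ∘ cu (ctens (ctens V W) Z).
Proof.
cbn [cu ctens cs]. rewrite <- (runitE HK (cu Z)) at 2.
rewrite <- tens_comp. nrm. rw (a_nat (cu V) (cu W) (cu Z)).
cbn [sf scomp]. rewrite w_assoc, <- (assocE HK (cu V ⊠ _)), tens_comp. now nrm.
Qed.

Definition cov_a (x y z : K) (V : cob x) (W : cob y) (Z : cob z) :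
  cov (ctens (ctens V W) Z) (ctens V (ctens W Z)) (a x y z).
Proof.
refine (@Cov _ _ (ctens (ctens V W) Z) (ctens V (ctens W Z)) _
  (snat_assoc (cs V) (cs W) (cs Z))
  (castI _ eq_refl (iso_id (a x y z ∘ cu (ctens (ctens V W) Z))))).
abstract (rewrite <- cu_assoc; symmetry; apply (runitE HK)).
Defined.

Lemma cov_aE (x y z : K) (V : cob x) (W : cob y) (Z : cob z) :
  ⟪cθ (cov_a V W Z)⟫ = ⟦a x y z ∘ cu (ctens (ctens V W) Z)⟧.
Proof. cbn [cθ cov_a]. now rewrite pk_castI. Qed.

(** γ is exchanged with [cθ d], which separates the claim into compatibility of δ whiskered on the
    right and of γ whiskered on the left. *)
Lemma good_h (x y z : K) (V : cob x) (W : cob y) (Z : cob z)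
  (g g' : hom y z) (f f' : hom x y) (d : cov W Z g) (d' : cov W Z g')
  (c : cov V W f) (c' : cov V W f') (δ : cell g g') (γ : cell f f') :
  good c c' ⟪γ⟫ -> good d d' ⟪δ⟫ ->
  good (cov_comp d c) (cov_comp d' c') (⟪δ⟫ ⊛ ⟪γ⟫).
Proof.
intros [H1 H2] [H3 H4]. split; [intros X; cbn; now rewrite H1, H3|].
assert (E : ⟦cn c' I⟧ = ⟦cn c I⟧) by now rewrite H1.
rewrite <- !cov_compE, E, <- ht_exchange_l.
change (⟪δ⟫ ⊛ ⟦f⟧ ⊳ ⟦g'⟧ ⊛ ⟪γ⟫) with (⟪δ ⋆ id2 f⟫ ⊳ ⟪id2 g' ⋆ γ⟫).
rewrite <- pk_v, pk_v_l.
change (⟪δ ⋆ id2 f⟫) with (⟪δ⟫ ⊛ ⟦f⟧). change (⟪id2 g' ⋆ γ⟫) with (⟦g'⟧ ⊛ ⟪γ⟫).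
rewrite !(ht_assoc HK), <- im_comp, vt_assoc, <- (vt_assoc (⟦g⟧ ⊛ _)), ht_exchange.
rewrite im_comp, vt_assoc, <- (ht_assoc HK), <- vt_assoc.
apply f_equal2.
- apply ht_vl, H4.
- apply ht_vr, H2.
Qed.

Lemma good_tens (x y x' y' : K) (V : cob x) (W : cob y) (V' : cob x')
  (W' : cob y') (f f' : hom x x') (g g' : hom y y') (c : cov V V' f)
  (c' : cov V V' f') (d : cov W W' g) (d' : cov W W' g') (t t' : tcell _ _) :
  good c c' t -> good d d' t' -> good (cov_tens c d) (cov_tens c' d') (t ⊡ t').
Proof.
intros [H1 H2] [H3 H4]. split; [intros X; cbn; now rewrite H1, H3|].
rewrite !cov_tensE. cbn [cu ctens]. rewrite im_comp, <- (ht_assoc HK), <- tt_im, tt_h.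
apply (ht_vl (β := F2 (tensor M) _)), tt_v; assumption.
Qed.

Lemma good_Fcomp (x y z x' y' z' : K) (V : cob x) (W : cob y) (Z : cob z)
  (V' : cob x') (W' : cob y') (Z' : cob z') (g : hom y z) (f : hom x y)
  (g' : hom y' z') (f' : hom x' y') (d : cov W Z g) (c : cov V W f)
  (d' : cov W' Z' g') (c' : cov V' W' f') :
  good (cov_comp (cov_tens d d') (cov_tens c c'))
       (cov_tens (cov_comp d c) (cov_comp d' c')) ⟦(g ⊠ g') ∘ (f ⊠ f')⟧.
Proof.
apply good_strict.
- intros X. cbn. nrm. rewrite sm_comp.
  rw (n_nat (cn c') (cn d X)). reflexivity.
- rewrite <- cov_compE, !cov_tensE, <- !cov_compE.
  rewrite (ht_assoc HK), <- im_comp. cbn [cn cov_tens snat_h n sf scomp cs ctens].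
  rewrite w_snat_h.
  rewrite im_comp, <- !(ht_assoc HK), <- !tt_im, !tt_h.
  set (A := ⟪cθ d⟫ ⊛ _) in *. set (B := ⟪cθ d'⟫ ⊛ _) in *.
  set (A' := ⟦g⟧ ⊛ _) in *. set (B' := ⟦g'⟧ ⊛ _) in *.
  assert (E1 : A ⊳ A' = ⟪cθ (cov_comp d c)⟫) by apply cov_compE.
  assert (E2 : B ⊳ B' = ⟪cθ (cov_comp d' c')⟫) by apply cov_compE.
  rewrite E1, E2. apply (ht_vl (β := F2 (tensor M) _)).
  now apply tt_v.
Qed.

Lemma good_Fid (x y : K) (V : cob x) (W : cob y) :
  good (cov_id (ctens V W)) (cov_tens (cov_id V) (cov_id W)) ⟦id1 (x ⊗ y)⟧.
Proof.
apply good_strict.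
- intros X. cbn. now rewrite sm_id, (lunitE HK).
- now rewrite cov_tensE, !cov_idE, tt_im, <- im_comp.
Qed.

Lemma tens_assoc_θ (x y z x' y' z' : K) (V : cob x) (W : cob y) (Z : cob z)
  (V' : cob x') (W' : cob y') (Z' : cob z') (f : hom x x') (g : hom y y')
  (h : hom z z') (c : cov V V' f) (d : cov W W' g) (e : cov Z Z' h) :
  ⟪cθ (cov_tens c (cov_tens d e))⟫ =
  ⟦a x' y' z'⟧ ⊛ ⟪cθ (cov_tens (cov_tens c d) e)⟫.
Proof.
rewrite !cov_tensE. cbn [cs ctens].
rewrite <- (ht_idr HK ⟪cθ c⟫) at 1. rewrite <- (ht_idr HK ⟪cθ e⟫) at 2.
change ((⟪cθ c⟫ ⊛ ⟦id1 (cs V I)⟧) ⊡ ((⟪cθ d⟫ ⊡ ⟪cθ e⟫) ⊛ ⟦w (cs Z) (cs W I)⟧)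
  ⊛ ⟦w (scomp (cs W) (cs Z)) (cs V I)⟧ = ⟦a x' y' z'⟧ ⊛
  ((⟪cθ c⟫ ⊡ ⟪cθ d⟫ ⊛ ⟦w (cs W) (cs V I)⟧) ⊡ (⟪cθ e⟫ ⊛ ⟦id1 (cs Z I)⟧)
  ⊛ ⟦w (cs Z) (cs W (cs V I))⟧)).
rewrite <- !tt_h, !tt_im, !(ht_assoc HK), <- !im_comp, <- w_assoc.
rewrite <- !(ht_assoc HK), a_natT, (ht_assoc HK), <- im_comp. reflexivity.
Qed.

Lemma good_a_nat (x y z x' y' z' : K) (V : cob x) (W : cob y) (Z : cob z)
  (V' : cob x') (W' : cob y') (Z' : cob z') (f : hom x x') (g : hom y y')
  (h : hom z z') (c : cov V V' f) (d : cov W W' g) (e : cov Z Z' h) :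
  good (cov_comp (cov_tens c (cov_tens d e)) (cov_a V W Z))
       (cov_comp (cov_a V' W' Z') (cov_tens (cov_tens c d) e))
       ⟦(f ⊠ (g ⊠ h)) ∘ a x y z⟧.
Proof.
apply good_strict.
- intros X. cbn. nrm. now rewrite sm_comp.
- rewrite <- !cov_compE, !cov_aE, <- !im_comp, tens_assoc_θ. cbn [cn cov_a snat_assoc n].
  rewrite (ht_idr HK).
  set (E := cθ (cov_tens (cov_tens c d) e)).
  change (⟪id2 (a x' y' z') ⋆ E⟫ ⊳ ⟦f ⊠ (g ⊠ h) ∘ (a x y z ∘ cu (ctens (ctens V W) Z))⟧
   = ⟦a x' y' z' ∘ cu (ctens (ctens V' W') Z') ∘ cn (cov_tens (cov_tens c d) e) I⟧
   ⊳ ⟪id2 (a x' y' z') ⋆ E⟫).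
  rewrite vt_idr_eq, vt_idl_eq; [reflexivity|now nrm|].
  nrm. rw (a_nat f g h). reflexivity.
Qed.

(* Changes of presentation; through [good_rel] a 2-cell that is good for the presentations
   [catom] is good for all others. *)
Record cmap (x : K) (V W : cob x) := Cmap {
  cmap_snat :> snat (cs V) (cs W);
  cmap_cu : cu W ∘ cmap_snat I = cu V
}.

Definition cmap_tens (x y : K) (V W : cob x) (V' W' : cob y)
  (m : cmap V W) (m' : cmap V' W') : cmap (ctens V V') (ctens W W').
Proof.
refine (@Cmap _ (ctens V V') (ctens W W') (snat_h m m') _).
cbn. rewrite (assocE HK), w_snat_h, <- (assocE HK), tens_comp. now rewrite !cmap_cu.
Defined.

(** S X → X ⊗ S I → X ⊗ x: every presentation maps to the standard one, - ⊗ x. Its compatibility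
    with the evaluations at I is [w_l]. *)
Definition cmap_atom (x : K) (V : cob x) : cmap V (catom x).
Proof.
unshelve refine (@Cmap _ V (catom x) (@Snat (cs V) (satom x)
  (fun X => (id1 X ⊠ cu V) ∘ w (cs V) X) _ _) _); intros; cbn.
- nrm. rewrite w_nat, <- !(assocE HK), !tens_comp. now nrm.
- rewrite tens_r. nrm. rewrite <- w_st, <- (tens_id x0 y).
  rw (a_nat (id1 x0) (id1 y) (cu V)). reflexivity.
- rewrite <- (assocE HK), <- l_nat, (assocE HK), w_l. now nrm.
Defined.

Definition cnat (x y : K) (V V' : cob x) (W W' : cob y) (f : hom x y)
  (m : cmap V V') (m' : cmap W W') (c : cov V W f) (d : cov V' W' f) : Prop :=
  (forall X, m' X ∘ cn c X = cn d X ∘ m X) /\ ⟪cθ c⟫ = ⟪cθ d⟫ ⊛ ⟦m I⟧.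

Lemma cnat_comp (x y z : K) (V V' : cob x) (W W' : cob y) (Z Z' : cob z)
  (f : hom x y) (g : hom y z) (m : cmap V V') (m' : cmap W W') (m'' : cmap Z Z')
  (c : cov V W f) (d : cov V' W' f) (c' : cov W Z g) (d' : cov W' Z' g) :
  cnat m m' c d -> cnat m' m'' c' d' -> cnat m m'' (cov_comp c' c) (cov_comp d' d).
Proof.
intros [H1 H2] [H3 H4]. split.
- intros X. cbn. rw (H3 X). rw (H1 X). reflexivity.
- rewrite <- cov_compE, H2, H4, (ht_assoc HK), <- im_comp, H1, im_comp.
  rewrite <- !(ht_assoc HK). apply ht_vl, cov_compE.
Qed.

Lemma cnat_id (x : K) (V V' : cob x) (m : cmap V V') :
  cnat m m (cov_id V) (cov_id V').
Proof.
split.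
- intros X. cbn. now nrm.
- now rewrite !cov_idE, <- im_comp, cmap_cu.
Qed.

Lemma cnat_tens (x y x' y' : K) (V1 V2 : cob x) (W1 W2 : cob y) (V1' V2' : cob x')
  (W1' W2' : cob y') (f : hom x x') (g : hom y y') (mV : cmap V1 V2)
  (mW : cmap W1 W2) (mV' : cmap V1' V2') (mW' : cmap W1' W2')
  (c : cov V1 V1' f) (c' : cov V2 V2' f) (d : cov W1 W1' g) (d' : cov W2 W2' g) :
  cnat mV mV' c c' -> cnat mW mW' d d' ->
  cnat (cmap_tens mV mW) (cmap_tens mV' mW') (cov_tens c d) (cov_tens c' d').
Proof.
intros [H1 H2] [H3 H4]. split.
- intros X. cbn. nrm. rw (eq_sym (n_nat (cn d) (mV' X))).
  rw (H3 (cs V2' X)). rewrite <- sm_comp, H1, sm_comp.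
  rw (n_nat mW (cn c' X)). reflexivity.
- rewrite !cov_tensE, H2, H4. cbn [cmap_snat cmap_tens snat_h n].
  rewrite (ht_assoc HK), <- im_comp.
  cbn [cs ctens scomp sf]. rewrite w_snat_h.
  rewrite im_comp, <- tt_im, <- (ht_assoc HK), tt_h. reflexivity.
Qed.

Lemma cnat_a (x y z : K) (V V' : cob x) (W W' : cob y) (Z Z' : cob z)
  (mV : cmap V V') (mW : cmap W W') (mZ : cmap Z Z') :
  cnat (cmap_tens (cmap_tens mV mW) mZ) (cmap_tens mV (cmap_tens mW mZ))
    (cov_a V W Z) (cov_a V' W' Z').
Proof.
split.
- intros X. cbn. nrm. now rewrite sm_comp.
- rewrite !cov_aE, <- im_comp, (assocE HK). f_equal. f_equal.
  symmetry. exact (cmap_cu (cmap_tens (cmap_tens mV mW) mZ)).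
Qed.

(** The 2-cells of [c] and [d] are those of [c'] and [d'] restricted along [m I], so compatibility
    restricts too. *)
Lemma good_rel (x y : K) (V V' : cob x) (W W' : cob y) (f g : hom x y)
  (m : cmap V V') (m' : cmap W W') (c : cov V W f) (c' : cov V' W' f)
  (d : cov V W g) (d' : cov V' W' g) (t : tcell x y) :
  cnat m m' c c' -> cnat m m' d d' -> (forall X, cn c X = cn d X) ->
  good c' d' t -> good c d t.
Proof.
intros [_ H1] [_ H2] H3 [_ H4]. split; [easy|].
rewrite H1, H2, <- (cmap_cu m), im_comp, <- (ht_assoc HK). now apply ht_vl.
Qed.

(** * Covers of the braiding *)

Section Braiding.

Context (β : braiding_data M).
Local Notation b := (bc β).
(** The only link between b and s: precomposed with ℓ ⊗ 1, the braiding is isomorphic to a strictly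
    natural composite. No inverse of ℓ appears here. *)
Context (Θ : forall x y : K,
     iso2 ((l y ⊠ id1 x) ∘ s I x y) (b x y ∘ (l x ⊠ id1 y))).

Definition atom_pair (x y : K) (V : cob x) (W : cob y) : cmap (ctens V W) _ :=
  cmap_tens (cmap_atom V) (cmap_atom W).

Lemma atom_pairE (x y : K) (V : cob x) (W : cob y) (X : K) :
  atom_pair V W X = ((id1 X ⊠ cu V) ⊠ cu W) ∘
    ((w (cs V) X ⊠ id1 (cs W I)) ∘ w (cs W) (cs V X)).
Proof.
cbn. rewrite sm_comp. nrm. rw (w_nat (cs W) (id1 X ⊠ cu V)).
rw (w_nat (cs W) (w (cs V) X)). rewrite <- !(assocE HK), !tens_comp. now nrm.
Qed.

Lemma atom_pair_cu (x y : K) (V : cob x) (W : cob y) :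
  (l x ⊠ id1 y) ∘ atom_pair V W I = cu (ctens V W).
Proof.
rewrite atom_pairE. cbn [cu ctens]. rewrite <- !(assocE HK), !tens_comp, <- l_nat.
nrm. now rewrite w_l, (runitE HK).
Qed.

(** By [swap_ww] and naturality of s, every swap becomes s on the standard presentations. Hence one
    isomorphism [Θ] serves for all presentations. *)
Lemma atom_pair_swap (x y : K) (V : cob x) (W : cob y) (B : swap (cs V) (cs W)) (X : K) :
  s X x y ∘ atom_pair V W X = atom_pair W V X ∘ B X.
Proof.
rewrite !atom_pairE. rw (s_nat (id1 X) (cu V) (cu W)). cbn [cs ctens scomp sf].
rw (swap_ww B X). now nrm.
Qed.

Lemma cov_b_src (x y : K) (V : cob x) (W : cob y) (B : swap (cs V) (cs W)) :
  ((l y ⊠ id1 x) ∘ s I x y) ∘ atom_pair V W I = cu (ctens W V) ∘ B I.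
Proof. rewrite <- atom_pair_cu, (assocE HK), (atom_pair_swap B). now nrm. Qed.

Lemma cov_b_tgt (x y : K) (V : cob x) (W : cob y) :
  (b x y ∘ (l x ⊠ id1 y)) ∘ atom_pair V W I = b x y ∘ cu (ctens V W).
Proof. now rewrite (assocE HK), atom_pair_cu. Qed.

(** Any swap covers b. The 2-cell is [Θ] restricted along the maps to atoms; the swap enters it only
    through its boundary. *)
Definition cov_b (x y : K) (V : cob x) (W : cob y) (B : swap (cs V) (cs W)) :
  cov (ctens V W) (ctens W V) (b x y) :=
  @Cov _ _ (ctens V W) (ctens W V) (b x y) B
    (castI (cov_b_src B) (cov_b_tgt V W)
       (iso_hcomp (Θ x y) (iso_id (atom_pair V W I)))).

Lemma cov_bE (x y : K) (V : cob x) (W : cob y) (B : swap (cs V) (cs W)) :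
  ⟪cθ (cov_b B)⟫ = ⟪Θ x y⟫ ⊛ ⟦atom_pair V W I⟧.
Proof. cbn [cθ cov_b]. now rewrite pk_castI. Qed.

Definition swap_atoms (x y : K) : swap (cs (catom x)) (cs (catom y)) :=
  swap_with_atom (satom x) y.

Definition bt (x x' y y' : K) (f : hom x x') (g : hom y y') :
  iso2 ((g ⊠ f) ∘ b x y) (b x' y' ∘ (f ⊠ g)) :=
  @tr2 _ _ _ _ β (x, y) (x', y') (f, g).

Context (bt_Θ : forall (x x' y y' : K) (f : hom x x') (g : hom y y'),
    ⟦g ⊠ f⟧ ⊛ ⟪Θ x y⟫ ⊳ ⟪bt f g⟫ ⊛ ⟦l x ⊠ id1 y⟧ =
    ⟪Θ x' y'⟫ ⊛ ⟦(id1 I ⊠ f) ⊠ g⟧).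

Lemma l_natT2 (x x' y y' : K) (c : tcell x x') (d : tcell y y') :
  ⟦l x' ⊠ id1 y'⟧ ⊛ ((⟦id1 I⟧ ⊡ c) ⊡ d) = (c ⊡ d) ⊛ ⟦l x ⊠ id1 y⟧.
Proof.
now rewrite <- !tt_im, !tt_h, <- l_natT, (ht_idl HK), (ht_idr HK).
Qed.

(** [bt_Θ] expresses the pseudonaturality cell by [Θ]; after that the claim is an exchange of [Θ]
    with the tensor product of the 2-cells of [c] and [d]. *)
Lemma good_b_nat (x x' y y' : K) (V : cob x) (W : cob y) (V' : cob x') (W' : cob y')
  (f : hom x x') (g : hom y y') (c : cov V V' f) (d : cov W W' g)
  (B : swap (cs V) (cs W)) (B' : swap (cs V') (cs W')) :
  (forall X, snat_h (cn d) (cn c) X ∘ B X = B' X ∘ snat_h (cn c) (cn d) X) ->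
  good (cov_comp (cov_tens d c) (cov_b B)) (cov_comp (cov_b B') (cov_tens c d))
    ⟪bt f g⟫.
Proof.
intros H. split; [exact H|].
rewrite <- !cov_compE, !cov_tensE, !cov_bE.
set (z := (w (cs V) I ⊠ id1 (cs W I)) ∘ w (cs W) (cs V I)).
(* The 2-cells of both covers placed over (I x) y, the common source of s and of ℓ ⊗ 1. [E1] pushes
   α through (ℓ ⊗ 1) s and [E2] through ℓ ⊗ 1. *)
set (α := F2 (tensor M) (x := (_, _)) (y := (_, _)) (f := (_, _)) (g := (_, _))
  (F2 (tensor M) (x := (_, _)) (y := (_, _)) (f := (_, _)) (g := (_, _))
    (id2 (id1 I), fwd (cθ c)), fwd (cθ d)) ⋆ id2 z).
assert (Eα : ⟪α⟫ = ((⟦id1 I⟧ ⊡ ⟪cθ c⟫) ⊡ ⟪cθ d⟫) ⊛ ⟦z⟧) by reflexivity.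
assert (E1 : (⟪cθ d⟫ ⊡ ⟪cθ c⟫) ⊛ ⟦w (cs V) (cs W I)⟧ ⊛ ⟦B I⟧ =
  ⟦(l y' ⊠ id1 x') ∘ s I x' y'⟧ ⊛ ⟪α⟫).
{ rewrite Eα, im_comp, (ht_assoc HK ⟦l y' ⊠ id1 x'⟧), <- (ht_assoc HK ⟦s I x' y'⟧).
  rewrite s_natT, (ht_assoc HK _ ⟦s I _ _⟧), <- (ht_assoc HK ⟦l y' ⊠ id1 x'⟧), l_natT2.
  rewrite !(ht_assoc HK). apply f_equal. rewrite <- !im_comp. apply f_equal.
  unfold z. rewrite (swap_ww B), <- !(assocE HK), tens_comp, w_l, (lunitE HK), tens_id.
  now nrm. }
assert (E2 : (⟪cθ c⟫ ⊡ ⟪cθ d⟫) ⊛ ⟦w (cs W) (cs V I)⟧ = ⟦l x' ⊠ id1 y'⟧ ⊛ ⟪α⟫).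
{ rewrite Eα, <- (ht_assoc HK), l_natT2, (ht_assoc HK). apply f_equal.
  rewrite <- im_comp. apply f_equal. unfold z.
  rewrite <- (assocE HK), tens_comp, w_l, (lunitE HK), tens_id. now nrm. }
assert (Es : ⟪Θ x' y'⟫ ⊛ ⟦atom_pair V' W' I⟧ ⊛ ⟦snat_h (cn c) (cn d) I⟧ =
  ⟪Θ x' y'⟫ ⊛ ⟦((id1 I ⊠ (cu V' ∘ cn c I)) ⊠ (cu W' ∘ cn d I)) ∘ z⟧).
{ rewrite (ht_assoc HK), <- im_comp, atom_pairE. apply f_equal, f_equal. cbn. nrm.
  rw (w_snat_h (cn c) (cn d) I). unfold z.
  rewrite <- !(assocE HK), !tens_comp, !(assocE HK), n_w, <- (assocE HK (id1 I ⊠ cu V')).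
  rewrite !tens_comp. now nrm. }
assert (Et : ((id1 I ⊠ f) ⊠ g) ∘ atom_pair V W I =
  ((id1 I ⊠ (f ∘ cu V)) ⊠ (g ∘ cu W)) ∘ z).
{ rewrite atom_pairE. fold z. now rewrite <- (assocE HK), !tens_comp, (lunitE HK). }
change (((⟪cθ d⟫ ⊡ ⟪cθ c⟫) ⊛ ⟦w (cs V) (cs W I)⟧ ⊛ ⟦B I⟧
  ⊳ ⟦g ⊠ f⟧ ⊛ (⟪Θ x y⟫ ⊛ ⟦atom_pair V W I⟧)) ⊳ ⟪bt f g⟫ ⊛ ⟦cu (ctens V W)⟧ =
  ⟪Θ x' y'⟫ ⊛ ⟦atom_pair V' W' I⟧ ⊛ ⟦snat_h (cn c) (cn d) I⟧
  ⊳ ⟦b x' y'⟧ ⊛ ((⟪cθ c⟫ ⊡ ⟪cθ d⟫) ⊛ ⟦w (cs W) (cs V I)⟧)).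
rewrite E1, E2, Es, vt_assoc.
rewrite <- (atom_pair_cu V W), (im_comp (l x ⊠ id1 y)), <- (ht_assoc HK ⟪bt f g⟫),
  <- (ht_assoc HK ⟦g ⊠ f⟧).
etransitivity; [refine (f_equal (vt (⟦(l y' ⊠ id1 x') ∘ s I x' y'⟧ ⊛ ⟪α⟫))
  (ht_vl (β := Θ x' y' ⋆ id2 ((id1 I ⊠ f) ⊠ g)) (atom_pair V W I) (bt_Θ f g)))|].
rewrite <- (ht_assoc HK ⟦b x' y'⟧), <- im_comp.
etransitivity; [|exact (ht_exchange (Θ x' y') α)]. apply f_equal.
transitivity (⟪Θ x' y'⟫ ⊛ (⟦(id1 I ⊠ f) ⊠ g⟧ ⊛ ⟦atom_pair V W I⟧));
  [exact (ht_assoc HK ⟪Θ x' y'⟫ ⟦(id1 I ⊠ f) ⊠ g⟧ ⟦atom_pair V W I⟧)|]. apply f_equal.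
rewrite <- im_comp. exact (f_equal (@im K _ _) Et).
Qed.

Ltac rw E ::=
  let H := fresh "H" in pose proof E as H; cbn [sf scomp] in H; nrm_in H;
  first [rewrite H | rewrite (assoc_eq2 H) | rewrite (assoc_eq3 H)]; clear H; nrm.

(** * Covers of pastings *)

(** The 1-cells [f] and [g] need not be convertible; comparing components and total cells avoids
    transporting covers. *)
Definition cov_eq (x y : K) (V : cob x) (W : cob y) (f g : hom x y)
  (c : cov V W f) (d : cov V W g) : Prop :=
  f = g /\ (forall X, cn c X = cn d X) /\ ⟪cθ c⟫ = ⟪cθ d⟫.

Lemma cov_eq_sym (x y : K) (V : cob x) (W : cob y) (f g : hom x y)
  (c : cov V W f) (d : cov V W g) : cov_eq c d -> cov_eq d c.
Proof. intros [H1 [H2 H3]]. split; [|split]; congruence. Qed.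

Lemma cov_eq_trans (x y : K) (V : cob x) (W : cob y) (f g h : hom x y)
  (c : cov V W f) (d : cov V W g) (e : cov V W h) :
  cov_eq c d -> cov_eq d e -> cov_eq c e.
Proof. intros [H1 [H2 H3]] [H4 [H5 H6]]. split; [|split]; congruence. Qed.

Lemma cov_eq_good (x y : K) (V : cob x) (W : cob y) (f g : hom x y)
  (c : cov V W f) (d : cov V W g) : f = g -> good c d ⟦f⟧ -> cov_eq c d.
Proof.
intros H1 [H2 H3]. split; [|split]; try easy.
rewrite <- H3, <- im_comp. now rewrite vt_idr.
Qed.

Lemma cov_eq_comp (x y z : K) (V : cob x) (W : cob y) (Z : cob z)
  (g g' : hom y z) (f f' : hom x y) (d : cov W Z g) (d' : cov W Z g')
  (c : cov V W f) (c' : cov V W f') :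
  cov_eq d d' -> cov_eq c c' -> cov_eq (cov_comp d c) (cov_comp d' c').
Proof.
intros [H1 [H2 H3]] [H4 [H5 H6]]. subst. split; [|split]; [easy|..].
- intros X. cbn. congruence.
- assert (E : ⟦cn c I⟧ = ⟦cn c' I⟧) by now rewrite H5.
  now rewrite <- !cov_compE, H3, E, H6.
Qed.

Lemma cov_eq_tens (x y x' y' : K) (V : cob x) (W : cob y) (V' : cob x')
  (W' : cob y') (f f' : hom x x') (g g' : hom y y') (c : cov V V' f)
  (c' : cov V V' f') (d : cov W W' g) (d' : cov W W' g') :
  cov_eq c c' -> cov_eq d d' -> cov_eq (cov_tens c d) (cov_tens c' d').
Proof.
intros [H1 [H2 H3]] [H4 [H5 H6]]. subst. split; [|split]; [easy|..].
- intros X. cbn. congruence.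
- now rewrite !cov_tensE, H3, H6.
Qed.

Lemma good_eqc (x y : K) (V : cob x) (W : cob y) (f f' g g' : hom x y)
  (c : cov V W f) (c' : cov V W f') (d : cov V W g) (d' : cov V W g')
  (t : tcell x y) : cov_eq c c' -> cov_eq d d' -> good c d t -> good c' d' t.
Proof.
intros [_ [H1 H2]] [_ [H3 H4]] [H5 H6]. split; [congruence|].
now rewrite <- H2, <- H4.
Qed.

Lemma cov_eq_refl (x y : K) (V : cob x) (W : cob y) (f : hom x y) (c : cov V W f) :
  cov_eq c c.
Proof. now split; [|split]. Qed.

Lemma cov_eq_assoc (x y z t : K) (V : cob x) (W : cob y) (Z : cob z) (T : cob t)
  (h : hom z t) (g : hom y z) (f : hom x y) (e : cov Z T h) (d : cov W Z g)
  (c : cov V W f) : cov_eq (cov_comp (cov_comp e d) c) (cov_comp e (cov_comp d c)).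
Proof.
split; [|split]; [apply (assocE HK)|..].
- intros X. cbn. now nrm.
- rewrite <- (cov_compE (cov_comp e d) c), <- (cov_compE e (cov_comp d c)).
  rewrite <- (ht_vl (cn c I) (cov_compE e d)), <- (ht_vr h (cov_compE d c)).
  cbn [cn cov_comp snat_comp n]. rewrite !im_comp, <- !(ht_assoc HK). apply vt_assoc.
Qed.

Lemma cov_eq_idl (x y : K) (V : cob x) (W : cob y) (f : hom x y) (c : cov V W f) :
  cov_eq (cov_comp (cov_id W) c) c.
Proof.
split; [|split]; [apply (lunitE HK)|..].
- intros X. cbn. now nrm.
- rewrite <- cov_compE, cov_idE, (ht_idl HK), <- im_comp. apply vt_idl.
Qed.

Lemma cov_eq_idr (x y : K) (V : cob x) (W : cob y) (f : hom x y) (c : cov V W f) :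
  cov_eq (cov_comp c (cov_id V)) c.
Proof.
split; [|split]; [apply (runitE HK)|..].
- intros X. cbn. now nrm.
- rewrite <- cov_compE, cov_idE. cbn [cn cov_id snat_id n].
  rewrite (ht_idr HK), <- im_comp. apply vt_idr.
Qed.

Lemma cov_eq_Fcomp (x y z x' y' z' : K) (V : cob x) (W : cob y) (Z : cob z)
  (V' : cob x') (W' : cob y') (Z' : cob z') (g : hom y z) (f : hom x y)
  (g' : hom y' z') (f' : hom x' y') (d : cov W Z g) (c : cov V W f)
  (d' : cov W' Z' g') (c' : cov V' W' f') :
  cov_eq (cov_comp (cov_tens d d') (cov_tens c c'))
      (cov_tens (cov_comp d c) (cov_comp d' c')).
Proof. apply cov_eq_good; [apply tens_comp|apply good_Fcomp]. Qed.

Lemma cov_eq_Fid (x y : K) (V : cob x) (W : cob y) :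
  cov_eq (cov_id (ctens V W)) (cov_tens (cov_id V) (cov_id W)).
Proof. apply cov_eq_good; [symmetry; apply tens_id|apply good_Fid]. Qed.

Definition cov_cast (x y : K) (V : cob x) (W : cob y) (f g : hom x y) (e : f = g)
  (c : cov V W f) : cov V W g :=
  match e in _ = g return cov V W g with eq_refl => c end.

Lemma cov_eq_cast (x y : K) (V : cob x) (W : cob y) (f g : hom x y) (e : f = g)
  (c : cov V W f) : cov_eq (cov_cast e c) c.
Proof. destruct e. apply cov_eq_refl. Qed.

(** The presentations of the intermediate objects are recorded, so that a pasting can be checked one
    2-cell at a time. *)
Inductive cpath : forall x y : K, cob x -> cob y -> path x y -> Type :=
| cnil : forall x (V : cob x), cpath V V pnil
| ccons : forall x y z (V : cob x) (W : cob y) (Z : cob z) (f : hom x y)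
    (p : path y z), cov V W f -> cpath W Z p -> cpath V Z (pcons f p).

Arguments cnil {x} V.
Arguments ccons {x y z V W Z f p} c cp.

Fixpoint cpcov (x y : K) (V : cob x) (W : cob y) (p : path x y)
  (cp : cpath V W p) : cov V W (pcomp p) :=
  match cp in @cpath x y V W p return cov V W (pcomp p) with
  | cnil V => cov_id V
  | @ccons _ _ _ _ _ _ f p c cp =>
      cov_cast (eq_sym (pcomp_cons HK f p)) (cov_comp (cpcov cp) c)
  end.

Fixpoint capp (x y : K) (V : cob x) (W : cob y) (p : path x y) (cp : cpath V W p) :
  forall (z : K) (Z : cob z) (v : path y z), cpath W Z v -> cpath V Z (papp p v) :=
  match cp in @cpath x y V W p
    return forall (z : K) (Z : cob z) (v : path y z),
      cpath W Z v -> cpath V Z (papp p v) with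
  | cnil V => fun _ _ _ cv => cv
  | ccons c cp => fun _ _ _ cv => ccons c (capp cp cv)
  end.

Definition pgood (x y : K) (V : cob x) (W : cob y) (p q : path x y)
  (cp : cpath V W p) (cq : cpath V W q) (t : tcell x y) : Prop :=
  good (cpcov cp) (cpcov cq) t.

Lemma cpcov_cons (x y z : K) (V : cob x) (W : cob y) (Z : cob z) (f : hom x y)
  (p : path y z) (c : cov V W f) (cp : cpath W Z p) :
  cov_eq (cpcov (ccons c cp)) (cov_comp (cpcov cp) c).
Proof. apply cov_eq_cast. Qed.

Lemma cpcov_app (x y z : K) (V : cob x) (W : cob y) (Z : cob z) (p : path x y)
  (v : path y z) (cp : cpath V W p) (cv : cpath W Z v) :
  cov_eq (cpcov (capp cp cv)) (cov_comp (cpcov cv) (cpcov cp)).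
Proof.
revert z Z v cv. induction cp as [x V|x y y' V W W' f p c cp IH]; intros z Z v cv.
- apply cov_eq_sym, cov_eq_idr.
- eapply cov_eq_trans; [apply (cpcov_cons c (capp cp cv))|].
  eapply cov_eq_trans; [apply cov_eq_comp; [apply IH|apply cov_eq_refl]|].
  eapply cov_eq_trans; [apply cov_eq_assoc|].
  apply cov_eq_comp; [apply cov_eq_refl|apply cov_eq_sym, cpcov_cons].
Qed.

Lemma pgood_v (x y : K) (V : cob x) (W : cob y) (p q u : path x y)
  (cp : cpath V W p) (cq : cpath V W q) (cu : cpath V W u)
  (γ : pcell p q) (δ : pcell q u) :
  pgood cp cq ⟪γ⟫ -> pgood cq cu ⟪δ⟫ -> pgood cp cu ⟪pvcomp γ δ⟫.
Proof. intros H1 H2. unfold pgood. rewrite pk_pvcomp. eapply good_v; eassumption. Qed.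

Lemma pgood_inv (x y : K) (V : cob x) (W : cob y) (p q : path x y)
  (cp : cpath V W p) (cq : cpath V W q) (γ : pcell p q) :
  pgood cp cq ⟪γ⟫ -> pgood cq cp ⟪pinv γ⟫.
Proof. apply good_inv. Qed.

Lemma pgood_skip (x y z : K) (V : cob x) (W : cob y) (Z : cob z) (f : hom x y)
  (p q : path y z) (c : cov V W f) (cp : cpath W Z p) (cq : cpath W Z q)
  (α : pcell p q) :
  pgood cp cq ⟪α⟫ -> pgood (ccons c cp) (ccons c cq) ⟪skip (f := f) α⟫.
Proof.
intros H. unfold pgood. rewrite (pk_skip HK).
eapply good_eqc; [apply cov_eq_sym, cpcov_cons|apply cov_eq_sym, cpcov_cons|].
apply (good_h (good_refl c) H).
Qed.

Lemma pgood_here (x y z : K) (V : cob x) (W : cob y) (Z : cob z) (p q : path x y)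
  (v : path y z) (cp : cpath V W p) (cq : cpath V W q) (cv : cpath W Z v)
  (α : pcell p q) :
  pgood cp cq ⟪α⟫ -> pgood (capp cp cv) (capp cq cv) ⟪here (v := v) α⟫.
Proof.
intros H. unfold pgood. rewrite (pk_here HK).
eapply good_eqc; [apply cov_eq_sym, cpcov_app|apply cov_eq_sym, cpcov_app|].
apply (good_h H (good_refl (cpcov cv))).
Qed.

Lemma pgood_eq (x y : K) (V : cob x) (W : cob y) (p q : path x y)
  (cp : cpath V W p) (cq : cpath V W q) (γ δ : pcell p q) :
  pgood cp cq ⟪γ⟫ -> pgood cp cq ⟪δ⟫ -> eq_pcell p q γ δ.
Proof. apply good_unique. Qed.

Definition wl (d x y : K) (D : cob d) (V : cob x) (W : cob y) (f : hom x y)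
  (c : cov V W f) : cov (ctens D V) (ctens D W) (d ◁ f) := cov_tens (cov_id D) c.

Definition wr (d x y : K) (V : cob x) (W : cob y) (f : hom x y)
  (c : cov V W f) (D : cob d) : cov (ctens V D) (ctens W D) (f ▷ d) :=
  cov_tens c (cov_id D).

Fixpoint cmapl (d : K) (D : cob d) (x y : K) (V : cob x) (W : cob y) (p : path x y)
  (cp : cpath V W p) : cpath (ctens D V) (ctens D W) (pmap (ltens M d) p) :=
  match cp in @cpath x y V W p
    return cpath (ctens D V) (ctens D W) (pmap (ltens M d) p) with
  | cnil V => cnil (ctens D V)
  | ccons c cp => ccons (wl D c) (cmapl D cp)
  end.

Fixpoint cmapr (d : K) (D : cob d) (x y : K) (V : cob x) (W : cob y) (p : path x y)
  (cp : cpath V W p) : cpath (ctens V D) (ctens W D) (pmap (rtens M d) p) :=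
  match cp in @cpath x y V W p
    return cpath (ctens V D) (ctens W D) (pmap (rtens M d) p) with
  | cnil V => cnil (ctens V D)
  | ccons c cp => ccons (wr c D) (cmapr D cp)
  end.

Lemma cpcov_mapl (d : K) (D : cob d) (x y : K) (V : cob x) (W : cob y) (p : path x y)
  (cp : cpath V W p) : cov_eq (cpcov (cmapl D cp)) (cov_tens (cov_id D) (cpcov cp)).
Proof.
induction cp as [x V|x y y' V W W' f p c cp IH].
- apply cov_eq_Fid.
- eapply cov_eq_trans; [apply (cpcov_cons _ (cmapl D cp))|].
  eapply cov_eq_trans; [apply cov_eq_comp; [apply IH|apply cov_eq_refl]|].
  eapply cov_eq_trans; [apply cov_eq_Fcomp|].
  apply cov_eq_tens; [apply cov_eq_idl|apply cov_eq_sym, cpcov_cons].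
Qed.

Lemma cpcov_mapr (d : K) (D : cob d) (x y : K) (V : cob x) (W : cob y) (p : path x y)
  (cp : cpath V W p) : cov_eq (cpcov (cmapr D cp)) (cov_tens (cpcov cp) (cov_id D)).
Proof.
induction cp as [x V|x y y' V W W' f p c cp IH].
- apply cov_eq_Fid.
- eapply cov_eq_trans; [apply (cpcov_cons _ (cmapr D cp))|].
  eapply cov_eq_trans; [apply cov_eq_comp; [apply IH|apply cov_eq_refl]|].
  eapply cov_eq_trans; [apply cov_eq_Fcomp|].
  apply cov_eq_tens; [apply cov_eq_sym, cpcov_cons|apply cov_eq_idl].
Qed.

Lemma pgood_mapl (d : K) (D : cob d) (x y : K) (V : cob x) (W : cob y)
  (p q : path x y) (cp : cpath V W p) (cq : cpath V W q) (α : pcell p q) :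
  pgood cp cq ⟪α⟫ -> pgood (cmapl D cp) (cmapl D cq) ⟪pmap_cell (ltens M d) α⟫.
Proof.
intros H. unfold pgood. rewrite (pk_pmap_cell HK (strict_ltens d)).
eapply good_eqc; [apply cov_eq_sym, cpcov_mapl|apply cov_eq_sym, cpcov_mapl|].
exact (good_tens (good_refl (cov_id D)) H).
Qed.

Lemma pgood_mapr (d : K) (D : cob d) (x y : K) (V : cob x) (W : cob y)
  (p q : path x y) (cp : cpath V W p) (cq : cpath V W q) (α : pcell p q) :
  pgood cp cq ⟪α⟫ -> pgood (cmapr D cp) (cmapr D cq) ⟪pmap_cell (rtens M d) α⟫.
Proof.
intros H. unfold pgood. rewrite (pk_pmap_cell HK (strict_rtens d)).
eapply good_eqc; [apply cov_eq_sym, cpcov_mapr|apply cov_eq_sym, cpcov_mapr|].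
exact (good_tens H (good_refl (cov_id D))).
Qed.
Lemma cpcov1 (x y : K) (V : cob x) (W : cob y) (f : hom x y) (c : cov V W f) :
  cov_eq (cpcov (ccons c (cnil W))) c.
Proof. eapply cov_eq_trans; [apply cpcov_cons|apply cov_eq_idl]. Qed.

Lemma cpcov2 (x y z : K) (V : cob x) (W : cob y) (Z : cob z) (f : hom x y)
  (g : hom y z) (c : cov V W f) (d : cov W Z g) :
  cov_eq (cpcov (ccons c (ccons d (cnil Z)))) (cov_comp d c).
Proof.
eapply cov_eq_trans; [apply cpcov_cons|].
apply cov_eq_comp; [apply cpcov1|apply cov_eq_refl].
Qed.

Lemma cpcov3 (x y z t : K) (V : cob x) (W : cob y) (Z : cob z) (T : cob t)
  (f : hom x y) (g : hom y z) (h : hom z t) (c : cov V W f) (d : cov W Z g)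
  (e : cov Z T h) :
  cov_eq (cpcov (ccons c (ccons d (ccons e (cnil T))))) (cov_comp (cov_comp e d) c).
Proof.
eapply cov_eq_trans; [apply cpcov_cons|].
apply cov_eq_comp; [apply cpcov2|apply cov_eq_refl].
Qed.

Lemma good_of_eqc (x y : K) (V : cob x) (W : cob y) (f g : hom x y)
  (c : cov V W f) (d : cov V W g) (γ : cell f g) :
  cov_eq c d -> id_cell γ -> good c d ⟪γ⟫.
Proof.
intros [H1 [H2 H3]] H4. rewrite H4. now apply good_strict.
Qed.

(** Covers whose 2-cell is an identity. They are closed under composition and tensoring, and for
    them [cov_eq] reduces to equal 1-cells and equal transformations. *)
Definition scov (x y : K) (V : cob x) (W : cob y) (f : hom x y) (c : cov V W f) :
  Prop := ⟪cθ c⟫ = ⟦cu W ∘ cn c I⟧.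

Lemma scov_comp (x y z : K) (V : cob x) (W : cob y) (Z : cob z) (f : hom x y)
  (g : hom y z) (d : cov W Z g) (c : cov V W f) :
  scov d -> scov c -> scov (cov_comp d c).
Proof.
unfold scov. intros H1 H2. rewrite <- cov_compE, H1, H2, <- !im_comp.
rewrite <- (assocE HK), (pk_tgt H1 : g ∘ cu W = _). cbn. nrm. apply vt_im.
Qed.

Lemma scov_id (x : K) (V : cob x) : scov (cov_id V).
Proof. unfold scov. rewrite cov_idE. cbn. now nrm. Qed.

Lemma scov_tens (x y x' y' : K) (V : cob x) (W : cob y) (V' : cob x')
  (W' : cob y') (f : hom x x') (g : hom y y') (c : cov V V' f) (d : cov W W' g) :
  scov c -> scov d -> scov (cov_tens c d).
Proof.
unfold scov. intros H1 H2. rewrite cov_tensE, H1, H2, tt_im, <- im_comp.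
apply f_equal. cbn. rewrite (assocE HK), w_snat_h, <- (assocE HK), tens_comp.
reflexivity.
Qed.

Lemma scov_a (x y z : K) (V : cob x) (W : cob y) (Z : cob z) : scov (cov_a V W Z).
Proof.
unfold scov. rewrite (cov_aE V W Z), <- (cu_assoc V W Z). cbn [cn cov_a snat_assoc n].
apply f_equal. symmetry. apply (runitE HK).
Qed.

Lemma scov_wl (d x y : K) (D : cob d) (V : cob x) (W : cob y) (f : hom x y)
  (c : cov V W f) : scov c -> scov (wl D c).
Proof. intros H. apply scov_tens; [apply scov_id|exact H]. Qed.

Lemma scov_wr (d x y : K) (D : cob d) (V : cob x) (W : cob y) (f : hom x y)
  (c : cov V W f) : scov c -> scov (wr c D).
Proof. intros H. apply scov_tens; [exact H|apply scov_id]. Qed.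

Ltac scov_tac := repeat lazymatch goal with
  | |- scov (cov_comp _ _) => apply scov_comp
  | |- scov (cov_tens _ _) => apply scov_tens
  | |- scov (cov_id _) => apply scov_id
  | |- scov (cov_a _ _ _) => apply scov_a
  | |- scov (wl _ _) => apply scov_wl
  | |- scov (wr _ _) => apply scov_wr
  end.

Lemma cov_eq_strict (x y : K) (V : cob x) (W : cob y) (f g : hom x y)
  (c : cov V W f) (d : cov V W g) :
  f = g -> (forall X, cn c X = cn d X) -> scov c -> scov d -> cov_eq c d.
Proof.
intros H1 H2 H3 H4. split; [|split]; try easy. now rewrite H3, H4, H2.
Qed.

Lemma cov_eq_a_nat (x y z x' y' z' : K) (V : cob x) (W : cob y) (Z : cob z)
  (V' : cob x') (W' : cob y') (Z' : cob z') (f : hom x x') (g : hom y y')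
  (h : hom z z') (c : cov V V' f) (d : cov W W' g) (e : cov Z Z' h) :
  cov_eq (cov_comp (cov_tens c (cov_tens d e)) (cov_a V W Z))
      (cov_comp (cov_a V' W' Z') (cov_tens (cov_tens c d) e)).
Proof. apply cov_eq_good; [symmetry; apply a_nat|apply good_a_nat]. Qed.

Lemma pgood_a1 (x x' y z : K) (V : cob x) (V' : cob x') (W : cob y) (Z : cob z)
  (f : hom x x') (c : cov V V' f) :
  pgood (ccons (wr (wr c W) Z) (ccons (cov_a V' W Z) (cnil _)))
    (ccons (cov_a V W Z) (ccons (wr c (ctens W Z)) (cnil _))) ⟪a_nat1 M f y z⟫.
Proof.
apply good_of_eqc; [|apply id_cell_a_nat1].
eapply cov_eq_trans; [apply cpcov2|].
eapply cov_eq_trans; [apply cov_eq_sym, cov_eq_a_nat|].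
eapply cov_eq_trans; [|apply cov_eq_sym, cpcov2].
apply cov_eq_comp; [|apply cov_eq_refl]. apply cov_eq_tens; [apply cov_eq_refl|].
apply cov_eq_sym, cov_eq_Fid.
Qed.

Lemma pgood_a2 (x y y' z : K) (V : cob x) (W : cob y) (W' : cob y') (Z : cob z)
  (f : hom y y') (c : cov W W' f) :
  pgood (ccons (wr (wl V c) Z) (ccons (cov_a V W' Z) (cnil _)))
    (ccons (cov_a V W Z) (ccons (wl V (wr c Z)) (cnil _))) ⟪a_nat2 M x f z⟫.
Proof.
apply good_of_eqc; [|apply id_cell_a_nat2].
eapply cov_eq_trans; [apply cpcov2|].
eapply cov_eq_trans; [apply cov_eq_sym, cov_eq_a_nat|apply cov_eq_sym, cpcov2].
Qed.

Lemma pgood_a3 (x y z z' : K) (V : cob x) (W : cob y) (Z : cob z) (Z' : cob z')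
  (f : hom z z') (c : cov Z Z' f) :
  pgood (ccons (wl (ctens V W) c) (ccons (cov_a V W Z') (cnil _)))
    (ccons (cov_a V W Z) (ccons (wl V (wl W c)) (cnil _))) ⟪a_nat3 M x y f⟫.
Proof.
apply good_of_eqc; [|apply id_cell_a_nat3].
eapply cov_eq_trans; [apply cpcov2|].
eapply cov_eq_trans; [|apply cov_eq_sym, cpcov2].
eapply cov_eq_trans; [|apply cov_eq_sym, cov_eq_a_nat].
apply cov_eq_comp; [apply cov_eq_refl|]. apply cov_eq_tens; [|apply cov_eq_refl].
apply cov_eq_Fid.
Qed.

Lemma pgood_exchange (x x' y y' : K) (V : cob x) (V' : cob x') (W : cob y)
  (W' : cob y') (f : hom x x') (g : hom y y') (c : cov V V' f) (d : cov W W' g) :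
  pgood (ccons (wr c W) (ccons (wl V' d) (cnil _)))
    (ccons (wl V d) (ccons (wr c W') (cnil _))) ⟪tens_exchange M f g⟫.
Proof.
apply good_of_eqc.
- eapply cov_eq_trans; [apply cpcov2|]. eapply cov_eq_trans; [apply cov_eq_Fcomp|].
  eapply cov_eq_trans; [|apply cov_eq_sym, cpcov2].
  eapply cov_eq_trans; [|apply cov_eq_sym, cov_eq_Fcomp].
  apply cov_eq_tens; (eapply cov_eq_trans; [|apply cov_eq_sym]); first
    [apply cov_eq_idl|apply cov_eq_idr].
- assert (E : forall u v k u' v' k' (g : hom v k) (f : hom u v) (g' : hom v' k')
    (f' : hom u' v'), id_cell (@Fcomp _ _ (tensor M) (u, u') (v, v') (k, k')
      (g, g') (f, f'))).
  { intros. apply (pk_Fcomp (strict_2functor (skew_tensor Hskew))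
      (x := (u, u')) (y := (v, v')) (z := (k, k'))). }
  apply id_cell_v; [apply E|]. apply id_cell_v; [|apply id_cell_bwd, E].
  apply id_cell_tens2; (apply id_cell_v; [|apply id_cell_bwd]); unfold id_cell; cbn;
    rewrite ?(pk_lunit HK), ?(pk_runit HK); now nrm.
Qed.

(** * Covers of the inverse associator and of the pentagon cell *)

Context (MB : monoidal_bicategory M) (HMB : has_strict_coherence MB).

Lemma η_nat (x x' y y' z z' : K) (f : hom x x') (g : hom y y') (h : hom z z') :
  ⟦(f ⊠ g) ⊠ h⟧ ⊛ ⟪η MB x y z⟫ ⊳
    ⟪@tr2 _ _ _ _ (massoc_inv MB) (x, y, z) (x', y', z') (f, g, h)⟫ ⊛ ⟦a x y z⟧ =
  ⟪η MB x' y' z'⟫ ⊛ ⟦(f ⊠ g) ⊠ h⟧.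
Proof.
pose proof (f_equal pk (@md_nat _ _ _ _ _ _ (ae_unit (mb_a MB))
  (x, y, z) (x', y', z') (f, g, h))) as H.
rewrite !pk_v in H.
assert (E := pk_tcomp HK (massoc M) (massoc_inv MB)
  (x := (x, y, z)) (y := (x', y', z')) (f, g, h)).
rewrite id_cell_a, <- im_comp in E.
set (t := @tr2 _ _ _ _ (massoc_inv MB) (x, y, z) (x', y', z') (f, g, h)) in *.
change (⟦(f ⊠ g) ⊠ h⟧ ⊛ ⟪η MB x y z⟫ ⊳ ⟪tr2 (massoc M ;; massoc_inv MB)
    (x := (x, y, z)) (y := (x', y', z')) (f, g, h)⟫ =
  ⟪tr2 (tid (ob31 ⊗p ob32 ⊗p ob33)) (x := (x, y, z)) (y := (x', y', z')) (f, g, h)⟫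
    ⊳ ⟪η MB x' y' z' ⋆ id2 ((f ⊠ g) ⊠ h)⟫) in H.
rewrite E, (pk_tid HK) in H.
rewrite vt_idl_eq in H by now rewrite (lunitE HK).
change (⟪t⟫ ⊛ ⟦massoc M (x, y, z)⟧) with ⟪t ⋆ id2 (a x y z)⟫ in H.
rewrite vt_idr_eq in H by now rewrite (assocE HK). exact H.
Qed.

Lemma tri_l (x y z : K) :
  ⟦a x y z⟧ ⊛ ⟪η MB x y z⟫ ⊳ ⟪ε MB x y z⟫ ⊛ ⟦a x y z⟧ = ⟦a x y z⟧.
Proof.
pose proof (f_equal pk (ae_triangle_l (mb_a MB) (x, y, z))) as H. cbv zeta in H.
etransitivity; [|exact H]. symmetry. etransitivity; [apply pk_v|].
apply f_equal2.
- exact (pk_here HK [massoc M (x, y, z)]%path (η MB x y z)).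
- etransitivity; [apply (pk_skip HK)|].
  apply (f_equal (fun t => t ⊛ ⟦a x y z⟧)).
  etransitivity; [exact (pk_here HK pnil (ε MB x y z))|]. apply (ht_idl HK).
Qed.

(** The unit gives an isomorphism from the evaluation for (V W) Z to itself followed by a and its
    pseudo-inverse; by [cu_assoc], the evaluation followed by a is the one for V (W Z). *)
Definition cov_as (x y z : K) (V : cob x) (W : cob y) (Z : cob z) :
  cov (ctens V (ctens W Z)) (ctens (ctens V W) Z) (asc MB x y z).
Proof.
refine (@Cov _ _ (ctens V (ctens W Z)) (ctens (ctens V W) Z) _
  (snat_assoc_inv (cs V) (cs W) (cs Z))
  (castI (f' := cu (ctens (ctens V W) Z) ∘ id1 _) _ _
    (iso_hcomp (η MB x y z) (iso_id (cu (ctens (ctens V W) Z)))))).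
- abstract (cbn [pcomp]; now nrm).
- abstract (rewrite (cu_assoc V W Z); cbn [pcomp extend]; now nrm).
Defined.

Lemma cov_asE (x y z : K) (V : cob x) (W : cob y) (Z : cob z) :
  ⟪cθ (cov_as V W Z)⟫ = ⟪η MB x y z⟫ ⊛ ⟦cu (ctens (ctens V W) Z)⟧.
Proof. cbn [cθ cov_as]. now rewrite pk_castI. Qed.

Lemma pgood_η (x y z : K) (V : cob x) (W : cob y) (Z : cob z) :
  pgood (cnil _) (ccons (cov_a V W Z) (ccons (cov_as V W Z) (cnil _)))
    ⟪η MB x y z⟫.
Proof.
eapply good_eqc; [apply cov_eq_refl|apply cov_eq_sym, cpcov2|]. cbn [cpcov].
split; [intros X; cbn; now nrm|].
rewrite <- cov_compE, cov_idE, (cov_aE V W Z), (cov_asE V W Z).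
cbn [cn cov_a snat_assoc n]. rewrite (ht_idr HK), <- im_comp.
change (⟦cu (ctens (ctens V W) Z)⟧ ⊳ ⟪η MB x y z ⋆ id2 (cu (ctens (ctens V W) Z))⟫ =
  ⟪η MB x y z ⋆ id2 (cu (ctens (ctens V W) Z))⟫ ⊳
  ⟦asc MB x y z ∘ (a x y z ∘ cu (ctens (ctens V W) Z))⟧).
rewrite vt_idl_eq, vt_idr_eq; [easy| |now nrm]. cbn [pcomp extend]. now nrm.
Qed.

(** Since [cov_as] is built from η, compatibility of ε is the triangle identity whiskered by the
    evaluation. *)
Lemma pgood_ε (x y z : K) (V : cob x) (W : cob y) (Z : cob z) :
  pgood (ccons (cov_as V W Z) (ccons (cov_a V W Z) (cnil _))) (cnil _)
    ⟪ε MB x y z⟫.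
Proof.
eapply good_eqc; [apply cov_eq_sym, cpcov2|apply cov_eq_refl|]. cbn [cpcov].
split; [intros X; cbn; now nrm|].
rewrite <- cov_compE, cov_idE, (cov_aE V W Z), (cov_asE V W Z).
cbn [cn cov_as snat_assoc_inv n]. rewrite (ht_idr HK), (cu_assoc V W Z).
rewrite vt_assoc, !im_comp.
rewrite <- !(ht_assoc HK).
pose proof (ht_vl (β := id2 (a x y z)) (cu (ctens (ctens V W) Z)) (tri_l x y z)) as H.
etransitivity; [apply f_equal; exact H|].
change (⟪id2 (a x y z)⟫) with ⟦a x y z⟧. rewrite <- im_comp. apply vt_im.
Qed.

(** Again through η: naturality of the unit, followed by an exchange of η with the 2-cell of the
    tensored covers. *)
Lemma good_as_nat (x y z x' y' z' : K) (V : cob x) (W : cob y) (Z : cob z)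
  (V' : cob x') (W' : cob y') (Z' : cob z') (f : hom x x') (g : hom y y')
  (h : hom z z') (c : cov V V' f) (d : cov W W' g) (e : cov Z Z' h) :
  good (cov_comp (cov_tens (cov_tens c d) e) (cov_as V W Z))
       (cov_comp (cov_as V' W' Z') (cov_tens c (cov_tens d e)))
    ⟪@tr2 _ _ _ _ (massoc_inv MB) (x, y, z) (x', y', z') (f, g, h)⟫.
Proof.
assert (E : forall X, cn (cov_tens (cov_tens c d) e) X =
  cn (cov_tens c (cov_tens d e)) X).
{ intros X. cbn. nrm. now rewrite sm_comp. }
split; [intros X; pose proof (E X) as EX; cbn in *; rewrite EX; now nrm|].
rewrite <- !cov_compE, (cov_asE V W Z), (cov_asE V' W' Z'), (tens_assoc_θ c d e).
set (θ := cθ (cov_tens (cov_tens c d) e)).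
set (u := cu (ctens (ctens V W) Z)).
assert (E' : ⟦cn (cov_tens c (cov_tens d e)) I⟧ = ⟦cn (cov_tens (cov_tens c d) e) I⟧)
  by now rewrite E.
rewrite E'. cbn [cn cov_as snat_assoc_inv n]. rewrite (ht_idr HK).
rewrite (cu_assoc V W Z). fold u.
rewrite (im_comp (a x y z)), vt_assoc, <- !(ht_assoc HK).
pose proof (ht_vl (β := η MB x' y' z' ⋆ id2 ((f ⊠ g) ⊠ h)) u (η_nat f g h)) as H.
etransitivity; [apply f_equal; exact H|].
pose proof (ht_exchange (η MB x' y' z') θ) as H'.
rewrite (ht_idl HK), !im_comp in H'.
change (⟪η MB x' y' z' ⋆ id2 ((f ⊠ g) ⊠ h)⟫) with
  (⟪η MB x' y' z'⟫ ⊛ ⟦(f ⊠ g) ⊠ h⟧).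
rewrite (ht_assoc HK). etransitivity; [exact H'|].
change (pcomp [a x' y' z'; asc MB x' y' z']) with (asc MB x' y' z' ∘ a x' y' z').
rewrite (im_comp (asc MB x' y' z')). apply f_equal2; [|reflexivity].
symmetry. apply (ht_assoc HK).
Qed.

Lemma pgood_as1 (x x' y z : K) (V : cob x) (V' : cob x') (W : cob y) (Z : cob z)
  (f : hom x x') (c : cov V V' f) :
  pgood (ccons (wr c (ctens W Z)) (ccons (cov_as V' W Z) (cnil _)))
    (ccons (cov_as V W Z) (ccons (wr (wr c W) Z) (cnil _))) ⟪as_nat1 MB f y z⟫.
Proof.
set (t := @tr2 _ _ _ _ (massoc_inv MB) (x, y, z) (x', y, z) (f, id1 y, id1 z)).
assert (E : ⟪as_nat1 MB f y z⟫ = ⟪bwd t⟫).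
{ unfold as_nat1. rewrite pk_iso_comp.
  match goal with |- ⟪?A⟫ ⊳ _ = _ => assert (H : id_cell A) end.
  { apply id_cell_h; [apply id_cell_id|].
    apply id_cell_tens2; [apply id_cell_id|apply id_cell_Fid]. }
  rewrite (id_cell_tgt H). apply vt_idl. }
rewrite E.
eapply good_eqc; [apply cov_eq_sym, cpcov2|apply cov_eq_sym, cpcov2|].
eapply good_eqc; [|apply cov_eq_refl|].
2: apply good_inv, (good_as_nat c (cov_id W) (cov_id Z)).
apply cov_eq_comp; [apply cov_eq_refl|]. apply cov_eq_tens; [apply cov_eq_refl|].
apply cov_eq_sym, cov_eq_Fid.
Qed.

Lemma pgood_as2 (x y y' z : K) (V : cob x) (W : cob y) (W' : cob y') (Z : cob z)
  (f : hom y y') (c : cov W W' f) :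
  pgood (ccons (wl V (wr c Z)) (ccons (cov_as V W' Z) (cnil _)))
    (ccons (cov_as V W Z) (ccons (wr (wl V c) Z) (cnil _))) ⟪as_nat2 MB x f z⟫.
Proof.
eapply good_eqc; [apply cov_eq_sym, cpcov2|apply cov_eq_sym, cpcov2|].
apply (good_inv (good_as_nat (cov_id V) c (cov_id Z))).
Qed.

Lemma pgood_as3 (x y z z' : K) (V : cob x) (W : cob y) (Z : cob z) (Z' : cob z')
  (f : hom z z') (c : cov Z Z' f) :
  pgood (ccons (wl V (wl W c)) (ccons (cov_as V W Z') (cnil _)))
    (ccons (cov_as V W Z) (ccons (wl (ctens V W) c) (cnil _))) ⟪as_nat3 MB x y f⟫.
Proof.
set (t := @tr2 _ _ _ _ (massoc_inv MB) (x, y, z) (x, y, z') (id1 x, id1 y, f)).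
assert (E : ⟪as_nat3 MB x y f⟫ = ⟪bwd t⟫).
{ unfold as_nat3. rewrite pk_iso_comp.
  match goal with |- _ ⊳ ⟪?A⟫ = _ => assert (H : id_cell A) end.
  { apply id_cell_h; [|apply id_cell_id].
    apply id_cell_tens2; [apply id_cell_bwd, (id_cell_Fid)|apply id_cell_id]. }
  rewrite H. apply vt_idr. }
rewrite E.
eapply good_eqc; [apply cov_eq_sym, cpcov2|apply cov_eq_sym, cpcov2|].
eapply good_eqc; [apply cov_eq_refl| |].
2: apply good_inv, (good_as_nat (cov_id V) (cov_id W) c).
apply cov_eq_comp; [|apply cov_eq_refl]. apply cov_eq_tens; [|apply cov_eq_refl].
apply cov_eq_sym, cov_eq_Fid.
Qed.

Lemma id_cell_π (x y z t : K) : id_cell (π MB x y z t).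
Proof. destruct HMB as [H _]. apply pk_id2, H. Qed.

Lemma pgood_π (x y z t : K) (V : cob x) (W : cob y) (Z : cob z) (T : cob t) :
  pgood (ccons (wr (cov_a V W Z) T) (ccons (cov_a V (ctens W Z) T)
      (ccons (wl V (cov_a W Z T)) (cnil _))))
    (ccons (cov_a (ctens V W) Z T) (ccons (cov_a V W (ctens Z T)) (cnil _)))
    ⟪π MB x y z t⟫.
Proof.
apply good_of_eqc; [|apply id_cell_π].
eapply cov_eq_trans; [apply cpcov3|]. eapply cov_eq_trans; [|apply cov_eq_sym, cpcov2].
apply cov_eq_strict.
- symmetry. apply (skew_pentagon Hskew).
- intros X. cbn. nrm. rewrite ?sm_id. now nrm.
- scov_tac.
- scov_tac.
Qed.

(** The splitting of the covers into initial segment and remainder appears as equations, so that it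
    can be solved after the covers of the segment are known. *)
Lemma pgood_here_eq (x y z : K) (V : cob x) (W : cob y) (Z : cob z) (p q : path x y)
  (v : path y z) (cp : cpath V W p) (cq : cpath V W q) (cv : cpath W Z v) C D
  (α : pcell p q) :
  pgood cp cq ⟪α⟫ -> C = capp cp cv -> D = capp cq cv -> pgood C D ⟪here (v := v) α⟫.
Proof. intros H -> ->. now apply pgood_here. Qed.

Lemma cn_comp (x y z : K) (V : cob x) (W : cob y) (Z : cob z) (g : hom y z)
  (f : hom x y) (d : cov W Z g) (c : cov V W f) (X : K) :
  cn (cov_comp d c) X = cn d X ∘ cn c X.
Proof. reflexivity. Qed.

Lemma cn_tens (x y x' y' : K) (V : cob x) (W : cob y) (V' : cob x')
  (W' : cob y') (f : hom x x') (g : hom y y') (c : cov V V' f) (d : cov W W' g)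
  (X : K) : cn (cov_tens c d) X = cn d (cs V' X) ∘ sm (cs W) (cn c X).
Proof. reflexivity. Qed.

Lemma cn_wl (d x y : K) (D : cob d) (V : cob x) (W : cob y) (f : hom x y)
  (c : cov V W f) (X : K) : cn (wl D c) X = cn c (cs D X).
Proof. cbn. now rewrite sm_id, (runitE HK). Qed.

Lemma cn_wr (d x y : K) (D : cob d) (V : cob x) (W : cob y) (f : hom x y)
  (c : cov V W f) (X : K) : cn (wr c D) X = sm (cs D) (cn c X).
Proof. cbn. now rewrite (lunitE HK). Qed.

Lemma cn_id (x : K) (V : cob x) (X : K) : cn (cov_id V) X = id1 (cs V X).
Proof. reflexivity. Qed.

Lemma cn_a (x y z : K) (V : cob x) (W : cob y) (Z : cob z) (X : K) :
  cn (cov_a V W Z) X = id1 (cs Z (cs W (cs V X))).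
Proof. reflexivity. Qed.

Lemma cn_as (x y z : K) (V : cob x) (W : cob y) (Z : cob z) (X : K) :
  cn (cov_as V W Z) X = id1 (cs Z (cs W (cs V X))).
Proof. reflexivity. Qed.

Lemma cn_b (x y : K) (V : cob x) (W : cob y) (B : swap (cs V) (cs W)) (X : K) :
  cn (cov_b B) X = B X.
Proof. reflexivity. Qed.

Lemma cn_cnil (x : K) (V : cob x) (X : K) : cn (cpcov (cnil V)) X = id1 (cs V X).
Proof. reflexivity. Qed.

Lemma cn_ccons (x y z : K) (V : cob x) (W : cob y) (Z : cob z) (f : hom x y)
  (p : path y z) (c : cov V W f) (cp : cpath W Z p) (X : K) :
  cn (cpcov (ccons c cp)) X = cn (cpcov cp) X ∘ cn c X.
Proof. destruct (cpcov_cons c cp) as [_ [H _]]. apply H. Qed.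

Ltac cnE := rewrite ?cn_ccons, ?cn_cnil, ?cn_comp, ?cn_wl, ?cn_wr, ?cn_tens,
  ?cn_id, ?cn_a, ?cn_as, ?cn_b; cbn [cs ctens sf sm scomp]; nrm;
  rewrite ?sm_id; nrm.

(** The counterpart of [swap_comp] in the first variable: on atoms, ((X A) B) C → ((X A) C) B → ((X
    C) A) B. *)
Definition swap_left (S S' T : sfun) (B : swap S T) (B' : swap S' T) :
  swap (scomp S S') T.
Proof.
unshelve refine (@Swap (scomp S S') T
  (@Snat (scomp (scomp S S') T) (scomp T (scomp S S'))
  (fun x => sm S' (B x) ∘ B' (S x)) _ _) _); intros; cbn; nrm.
- pose proof (n_nat B f) as H. pose proof (n_nat B' (sm S f)) as H'. cbn in H, H'.
  rewrite H'. rw (eq_sym (sm_comp S' (B y) (sm T (sm S f)))).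
  rewrite H, sm_comp. now nrm.
- pose proof (n_st B x y) as H. pose proof (n_st B' x (S y)) as H'.
  pose proof (n_nat B' (st S x y)) as H''. cbn in H, H', H''. nrm_in H'. nrm_in H.
  rewrite sm_comp. nrm.
  rw (eq_sym (sm_comp S' (sm S (st T x y)) (B (x ⊗ y)))).
  rw (eq_sym (sm_comp S' (st S x (T y)) (sm S (st T x y) ∘ B (x ⊗ y)))).
  rewrite H, !sm_comp. nrm. rw (st_nat S' (id1 x) (B y)).
  rw (eq_sym H''). rw H'. now rewrite tens_r, (assocE HK).
- pose proof (swap_sd B x z) as H. pose proof (swap_sd B' (S x) z) as H'.
  pose proof (n_nat B' (sd S x z)) as H''. cbn in H''. cbn in *.
  rw H'. rw (eq_sym (sm_comp S' (sd S x (T z)) (st T (S x) z))).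
  rewrite H, !sm_comp. nrm. rw (eq_sym H''). reflexivity.
Defined.

Definition swap_compat (S S' T T' : sfun) (m : snat S S') (m' : snat T T')
  (B : swap S T) (B' : swap S' T') : Prop :=
  forall X, snat_h m' m X ∘ B X = B' X ∘ snat_h m m' X.

Lemma swap_compat_comp (S S' T T' U U' : sfun) (m : snat S S') (m' : snat T T')
  (m'' : snat U U') (B : swap S T) (B' : swap S' T') (C : swap S U) (C' : swap S' U') :
  swap_compat m m' B B' -> swap_compat m m'' C C' ->
  swap_compat m (snat_h m' m'') (swap_comp B C) (swap_comp B' C').
Proof.
intros H1 H2 X. specialize (H1 X). specialize (H2 (T' X)). cbn in *.
pose proof (n_nat C (m' X)) as H3. cbn in H3.
rewrite sm_comp. nrm. nrm_in H1. nrm_in H2.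
rw (eq_sym H3). rw H2. rw (eq_sym (n_nat m'' (B' X))).
rewrite <- !(sm_comp U). nrm. now rewrite H1.
Qed.

Lemma swap_compat_left (S S' T T' U U' : sfun) (m : snat S S') (m' : snat T T')
  (m'' : snat U U') (B : swap S U) (B' : swap S' U') (C : swap T U) (C' : swap T' U') :
  swap_compat m m'' B B' -> swap_compat m' m'' C C' ->
  swap_compat (snat_h m m') m'' (swap_left B C) (swap_left B' C').
Proof.
intros H1 H2 X. specialize (H1 X). specialize (H2 (S X)). cbn in *.
pose proof (n_nat C' (m X)) as H3. cbn in H3.
rewrite sm_comp. nrm. nrm_in H1. nrm_in H2.
rewrite <- (sm_comp U), (n_nat m' (m X)), (sm_comp U). nrm.
rw (n_nat m'' (sm T' (m X))). rw H3. rw (eq_sym H2).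
rw (eq_sym (sm_comp T' (B' X) (sm U' (m X)))).
rw (eq_sym (n_nat m' (B' X ∘ sm U' (m X)))).
rw (eq_sym (sm_comp T (B' X ∘ sm U' (m X)) (m'' (S X)))).
rewrite <- (n_nat m'' (m X)), <- H1, !sm_comp. now nrm.
Qed.

Lemma swap_compat_atoms (x y : K) (V : cob x) (W : cob y) (B : swap (cs V) (cs W)) :
  swap_compat (cmap_atom V) (cmap_atom W) B (swap_atoms x y).
Proof. intros X. symmetry. exact (atom_pair_swap B X). Qed.

Lemma cmap_atom_comp (x : K) (V V' : cob x) (m : cmap V V') (X : K) :
  cmap_atom V' X ∘ m X = cmap_atom V X.
Proof.
cbn. nrm. rewrite (n_w m X), <- (assocE HK), tens_comp, cmap_cu. now nrm.
Qed.

Lemma cnat_b (x y : K) (V V' : cob x) (W W' : cob y) (m : cmap V V')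
  (m' : cmap W W') (B : swap (cs V) (cs W)) (B' : swap (cs V') (cs W')) :
  swap_compat m m' B B' ->
  cnat (cmap_tens m m') (cmap_tens m' m) (cov_b B) (cov_b B').
Proof.
intros H. split; [exact H|].
rewrite !cov_bE, (ht_assoc HK), <- im_comp. apply f_equal, f_equal.
change (cmap_atom W (I ⊗ x) ∘ sm (cs W) (cmap_atom V I) =
  (cmap_atom W' (I ⊗ x) ∘ sm (cs W') (cmap_atom V' I)) ∘
  (m' (cs V' I) ∘ sm (cs W) (m I))).
nrm. rw (eq_sym (n_nat m' (cmap_atom V' I))).
now rewrite <- (assocE HK (cmap_atom W' _)), cmap_atom_comp, <- sm_comp, cmap_atom_comp.
Qed.

Lemma cnat_as (x y z : K) (V V' : cob x) (W W' : cob y) (Z Z' : cob z)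
  (mV : cmap V V') (mW : cmap W W') (mZ : cmap Z Z') :
  cnat (cmap_tens mV (cmap_tens mW mZ)) (cmap_tens (cmap_tens mV mW) mZ)
    (cov_as V W Z) (cov_as V' W' Z').
Proof.
split.
- intros X. cbn. nrm. now rewrite sm_comp.
- rewrite (cov_asE V W Z), (cov_asE V' W' Z'), (ht_assoc HK), <- im_comp.
  apply f_equal, f_equal. rewrite <- (cmap_cu (cmap_tens (cmap_tens mV mW) mZ)).
  apply f_equal. cbn. now rewrite sm_comp, (assocE HK).
Qed.

Lemma cnat_wl (d x y : K) (D D' : cob d) (V V' : cob x) (W W' : cob y) (f : hom x y)
  (mD : cmap D D') (m : cmap V V') (m' : cmap W W') (c : cov V W f) (c' : cov V' W' f) :
  cnat m m' c c' -> cnat (cmap_tens mD m) (cmap_tens mD m') (wl D c) (wl D' c').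
Proof. intros H. apply cnat_tens; [apply cnat_id|exact H]. Qed.

Lemma cnat_wr (d x y : K) (D D' : cob d) (V V' : cob x) (W W' : cob y) (f : hom x y)
  (mD : cmap D D') (m : cmap V V') (m' : cmap W W') (c : cov V W f) (c' : cov V' W' f) :
  cnat m m' c c' -> cnat (cmap_tens m mD) (cmap_tens m' mD) (wr c D) (wr c' D').
Proof. intros H. apply cnat_tens; [exact H|apply cnat_id]. Qed.

Lemma cnat_ccons (x y z : K) (V V' : cob x) (W W' : cob y) (Z Z' : cob z)
  (f : hom x y) (p : path y z) (m : cmap V V') (m' : cmap W W') (m'' : cmap Z Z')
  (c : cov V W f) (c' : cov V' W' f) (cp : cpath W Z p) (cp' : cpath W' Z' p) :
  cnat m m' c c' -> cnat m' m'' (cpcov cp) (cpcov cp') ->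
  cnat m m'' (cpcov (ccons c cp)) (cpcov (ccons c' cp')).
Proof.
intros H1 H2. pose proof (cnat_comp H1 H2) as [H3 H4].
destruct (cpcov_cons c cp) as [_ [H5 H6]], (cpcov_cons c' cp') as [_ [H7 H8]].
split; [congruence|]. now rewrite H6, H8.
Qed.

Lemma cnat_cnil (x : K) (V V' : cob x) (m : cmap V V') :
  cnat m m (cpcov (cnil V)) (cpcov (cnil V')).
Proof. apply cnat_id. Qed.

Lemma pgood_b1 (x x' y : K) (V : cob x) (V' : cob x') (W : cob y) (f : hom x x')
  (c : cov V V' f) (B : swap (cs V) (cs W)) (B' : swap (cs V') (cs W)) :
  (forall X, cn c (cs W X) ∘ B X = B' X ∘ sm (cs W) (cn c X)) ->
  pgood (ccons (wr c W) (ccons (cov_b B') (cnil _)))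
    (ccons (cov_b B) (ccons (wl W c) (cnil _))) ⟪b_nat1 β f y⟫.
Proof.
intros H. eapply good_eqc; [apply cov_eq_sym, cpcov2|apply cov_eq_sym, cpcov2|].
refine (good_inv (γ := bt f (id1 y)) (good_b_nat (c := c) (d := cov_id W) _)).
intros X. specialize (H X). cbn. rewrite sm_id. nrm. exact H.
Qed.

Lemma pgood_b2 (x y y' : K) (V : cob x) (W : cob y) (W' : cob y') (g : hom y y')
  (d : cov W W' g) (B : swap (cs V) (cs W)) (B' : swap (cs V) (cs W')) :
  (forall X, sm (cs V) (cn d X) ∘ B X = B' X ∘ cn d (cs V X)) ->
  pgood (ccons (wl V d) (ccons (cov_b B') (cnil _)))
    (ccons (cov_b B) (ccons (wr d V) (cnil _))) ⟪b_nat2 β x g⟫.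
Proof.
intros H. eapply good_eqc; [apply cov_eq_sym, cpcov2|apply cov_eq_sym, cpcov2|].
refine (good_inv (γ := bt (id1 x) g) (good_b_nat (c := cov_id V) (d := d) _)).
intros X. specialize (H X). cbn. rewrite sm_id. nrm. exact H.
Qed.

(** Every 1-cell has a cover between the standard presentations, because ℓ is strictly natural.
    Modification laws at arbitrary 1-cells thereby come within reach of covers. *)
Definition cov_atom (x y : K) (f : hom x y) : cov (catom x) (catom y) f.
Proof.
unshelve refine (@Cov _ _ (catom x) (catom y) f
  (@Snat (satom x) (satom y) (fun X => id1 X ⊠ f) _ _)
  (castI (eq_refl (l y ∘ (id1 I ⊠ f))) _ (iso_id (l y ∘ (id1 I ⊠ f))))).
- intros X Y g. cbn. rewrite !tens_comp. now nrm.
- intros X Y. cbn. rewrite <- tens_id. apply a_nat.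
- symmetry. apply l_nat.
Defined.

Lemma swap_compat_atom_maps (x x' y y' : K) (f : hom x x') (g : hom y y') :
  swap_compat (cn (cov_atom f)) (cn (cov_atom g)) (swap_atoms x y) (swap_atoms x' y').
Proof.
intros X. cbn. rewrite !tens_comp. nrm. symmetry. apply s_nat.
Qed.

Lemma good_v_cast (x y : K) (V : cob x) (W : cob y) (f g h f' f'' : hom x y)
  (c : cov V W f) (d : cov V W g) (e : cov V W h) (γ : cell f f') (δ : cell f'' h) :
  f' = f'' -> good c d ⟪γ⟫ -> good d e ⟪δ⟫ -> good c e (⟪γ⟫ ⊳ ⟪δ⟫).
Proof. intros e1. subst f''. apply good_v. Qed.

(** * Modifications from covers *)

Section TransCovers.

Context (J : bicat).

Definition good_trans (F G : pfun J K) (σ : trans F G) (x y : J) (f : hom x y)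
  (V : cob (F x)) (W : cob (F y)) (V' : cob (G x)) (W' : cob (G y))
  (cF : cov V W (F1 F f)) (cG : cov V' W' (F1 G f)) (cx : cov V V' (σ x))
  (cy : cov W W' (σ y)) : Prop :=
  good (cov_comp cG cx) (cov_comp cy cF) ⟪tr2 σ f⟫.

Lemma good_trans_comp (F G H : pfun J K) (σ : trans F G) (τ : trans G H) (x y : J)
  (f : hom x y) (V : cob (F x)) (W : cob (F y)) (V' : cob (G x)) (W' : cob (G y))
  (V'' : cob (H x)) (W'' : cob (H y)) (cF : cov V W (F1 F f))
  (cG : cov V' W' (F1 G f)) (cH : cov V'' W'' (F1 H f)) (cx : cov V V' (σ x))
  (cy : cov W W' (σ y)) (dx : cov V' V'' (τ x)) (dy : cov W' W'' (τ y)) :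
  good_trans cF cG cx cy -> good_trans cG cH dx dy ->
  good_trans (σ := σ ;; τ) cF cH (cov_comp dx cx) (cov_comp dy cy).
Proof.
intros H1 H2. unfold good_trans. rewrite (pk_tcomp HK).
eapply good_eqc; [apply cov_eq_assoc|apply cov_eq_sym, cov_eq_assoc|].
refine (good_v_cast (d := cov_comp (cov_comp dy cG) cx)
  (γ := tr2 τ f ⋆ id2 (σ x)) (δ := id2 (τ y) ⋆ tr2 σ f) (assocE HK _ _ _) _ _).
- exact (good_h (good_refl cx) H2).
- eapply good_eqc; [apply cov_eq_sym, cov_eq_assoc|apply cov_eq_refl|].
  exact (good_h H1 (good_refl dy)).
Qed.

Lemma good_trans_tens (F F' G G' : pfun J K) (σ : trans F F') (τ : trans G G') (x y : J)
  (f : hom x y) (V : cob (F x)) (W : cob (F y)) (V' : cob (F' x)) (W' : cob (F' y))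
  (U : cob (G x)) (Z : cob (G y)) (U' : cob (G' x)) (Z' : cob (G' y))
  (cF : cov V W (F1 F f)) (cF' : cov V' W' (F1 F' f))
  (cG : cov U Z (F1 G f)) (cG' : cov U' Z' (F1 G' f)) (cx : cov V V' (σ x))
  (cy : cov W W' (σ y)) (dx : cov U U' (τ x)) (dy : cov Z Z' (τ y)) :
  good_trans cF cF' cx cy -> good_trans cG cG' dx dy ->
  good_trans (σ := ttens M σ τ) (cov_tens cF cG) (cov_tens cF' cG') (cov_tens cx dx)
    (cov_tens cy dy).
Proof.
intros H1 H2. unfold good_trans. rewrite pk_ttens.
eapply good_eqc; [apply cov_eq_sym, cov_eq_Fcomp|apply cov_eq_sym, cov_eq_Fcomp|].
exact (good_tens H1 H2).
Qed.

Lemma good_trans_id (F : pfun J K) (x y : J) (f : hom x y) (V : cob (F x))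
  (W : cob (F y)) (cF : cov V W (F1 F f)) :
  good_trans (σ := tid F) cF cF (cov_id V) (cov_id W).
Proof.
apply good_of_eqc; [|apply strict_tid].
eapply cov_eq_trans; [apply cov_eq_idr|apply cov_eq_sym, cov_eq_idl].
Qed.

Lemma good_trans_a (F G H : pfun J K) (x y : J) (f : hom x y) (V : cob (F x))
  (V' : cob (F y)) (W : cob (G x)) (W' : cob (G y)) (Z : cob (H x)) (Z' : cob (H y))
  (cF : cov V V' (F1 F f)) (cG : cov W W' (F1 G f)) (cH : cov Z Z' (F1 H f)) :
  good_trans (σ := ta M F G H) (cov_tens (cov_tens cF cG) cH)
    (cov_tens cF (cov_tens cG cH)) (cov_a V W Z) (cov_a V' W' Z').
Proof.
apply good_of_eqc; [|apply strict_ta]. exact (cov_eq_a_nat cF cG cH).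
Qed.

Lemma good_trans_as (F G H : pfun J K) (x y : J) (f : hom x y) (V : cob (F x))
  (V' : cob (F y)) (W : cob (G x)) (W' : cob (G y)) (Z : cob (H x)) (Z' : cob (H y))
  (cF : cov V V' (F1 F f)) (cG : cov W W' (F1 G f)) (cH : cov Z Z' (F1 H f)) :
  good_trans (σ := tas MB F G H) (cov_tens cF (cov_tens cG cH))
    (cov_tens (cov_tens cF cG) cH) (cov_as V W Z) (cov_as V' W' Z').
Proof. exact (good_as_nat cF cG cH). Qed.

Lemma good_trans_b (F G : pfun J K) (x y : J) (f : hom x y) (V : cob (F x))
  (V' : cob (F y)) (W : cob (G x)) (W' : cob (G y)) (cF : cov V V' (F1 F f))
  (cG : cov W W' (F1 G f)) (B : swap (cs V) (cs W)) (B' : swap (cs V') (cs W')) :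
  swap_compat (cn cF) (cn cG) B B' ->
  good_trans (σ := tb β F G) (cov_tens cF cG) (cov_tens cG cF) (cov_b B) (cov_b B').
Proof. intros H. exact (good_b_nat (c := cF) (d := cG) H). Qed.

(** Both sides of the modification law are compatible with the same pair of covers, so [good_unique]
    identifies them. *)
Lemma md_nat_of_good (F G : pfun J K) (σ τ : trans F G) (x y : J) (f : hom x y)
  (V : cob (F x)) (W : cob (F y)) (V' : cob (G x)) (W' : cob (G y))
  (cF : cov V W (F1 F f)) (cG : cov V' W' (F1 G f)) (cx : cov V V' (σ x))
  (cy : cov W W' (σ y)) (dx : cov V V' (τ x)) (dy : cov W W' (τ y))
  (mx : iso2 (σ x) (τ x)) (my : iso2 (σ y) (τ y)) :
  good_trans cF cG cx cy -> good_trans cF cG dx dy ->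
  good cx dx ⟪mx⟫ -> good cy dy ⟪my⟫ ->
  (id2 (F1 G f) ⋆ mx) • tr2 τ f = tr2 σ f • (my ⋆ id2 (F1 F f)).
Proof.
intros H1 H2 H3 H4.
apply good_unique with (c := cov_comp cG cx) (d := cov_comp dy cF); rewrite pk_v.
- exact (good_v (good_h H3 (good_refl cG)) H2).
- exact (good_v H1 (good_h (good_refl cF) H4)).
Qed.

End TransCovers.

(** In the braiding of x with y ⊗ z, the second object is presented by the composite of two atoms
    and not by - ⊗ (y ⊗ z); then both paths are covered by the same composite of two s. *)
Definition good_R (x y z : K) (t : tcell (x ⊗ y ⊗ z) (y ⊗ (z ⊗ x))) : Prop :=
  pgood (ccons (wr (cov_b (swap_atoms x y)) (catom z))
      (ccons (cov_a (catom y) (catom x) (catom z))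
      (ccons (wl (catom y) (cov_b (swap_atoms x z))) (cnil _))))
    (ccons (cov_a (catom x) (catom y) (catom z))
      (ccons (cov_b (W := ctens (catom y) (catom z))
        (swap_comp (swap_atoms x y) (swap_atoms x z)))
      (ccons (cov_a (catom y) (catom z) (catom x)) (cnil _)))) t.
Arguments good_R : clear implicits.

Definition good_S (x y z : K) (t : tcell (x ⊗ (y ⊗ z)) (z ⊗ x ⊗ y)) : Prop :=
  pgood (ccons (wl (catom x) (cov_b (swap_atoms y z)))
      (ccons (cov_as (catom x) (catom z) (catom y))
      (ccons (wr (cov_b (swap_atoms x z)) (catom y)) (cnil _))))
    (ccons (cov_as (catom x) (catom y) (catom z))
      (ccons (cov_b (V := ctens (catom x) (catom y))
        (swap_left (swap_atoms x z) (swap_atoms y z)))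
      (ccons (cov_as (catom z) (catom x) (catom y)) (cnil _)))) t.
Arguments good_S : clear implicits.

Definition good_ν (x y : K) (t : tcell (x ⊗ y) (x ⊗ y)) : Prop :=
  pgood (ccons (cov_b (swap_atoms x y)) (ccons (cov_b (swap_atoms y x)) (cnil _)))
    (cnil _) t.
Arguments good_ν : clear implicits.

Lemma R_ex (x y z : K) :
  exists R : pcell [b x y ▷ z; a y x z; y ◁ b x z] [a x y z; b x (y ⊗ z); a y z x],
  good_R x y z ⟪R⟫.
Proof. unfold good_R. apply good_ex. intros X. cnE. reflexivity. Qed.

Lemma S_ex (x y z : K) :
  exists S : pcell [x ◁ b y z; asc MB x z y; b x z ▷ y]
    [asc MB x y z; b (x ⊗ y) z; asc MB z x y],
  good_S x y z ⟪S⟫.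
Proof. unfold good_S. apply good_ex. intros X. cnE. reflexivity. Qed.

Lemma ν_ex (x y : K) :
  exists N : pcell [b x y; b y x] [ ],
  good_ν x y ⟪N⟫.
Proof.
unfold good_ν. apply good_ex. intros X. cnE. apply (sym_Sym Hsym).
Qed.

(** The cell is chosen for atoms, but the axioms use it at tensor products. All constituents are
    natural for the maps to atoms, so [good_rel] carries compatibility over. *)
Lemma pgood_R (x y z : K) (V : cob x) (W : cob y) (Z : cob z) (B : swap (cs V) (cs W))
  (B' : swap (cs V) (cs Z)) (t : tcell _ _) :
  good_R x y z t ->
  pgood (ccons (wr (cov_b B) Z) (ccons (cov_a W V Z) (ccons (wl W (cov_b B'))
      (cnil _))))
    (ccons (cov_a V W Z) (ccons (cov_b (W := ctens W Z) (swap_comp B B'))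
      (ccons (cov_a W Z V) (cnil _)))) t.
Proof.
set (mV := cmap_atom V). set (mW := cmap_atom W). set (mZ := cmap_atom Z).
apply good_rel with (m := cmap_tens (cmap_tens mV mW) mZ)
  (m' := cmap_tens mW (cmap_tens mZ mV)).
- eapply cnat_ccons; [apply cnat_wr, cnat_b, swap_compat_atoms|].
  eapply cnat_ccons; [apply cnat_a|].
  eapply cnat_ccons; [apply cnat_wl, cnat_b, swap_compat_atoms|]. apply cnat_cnil.
- eapply cnat_ccons; [apply cnat_a|].
  eapply cnat_ccons; [apply cnat_b|].
  + exact (swap_compat_comp (swap_compat_atoms B) (swap_compat_atoms B')).
  + eapply cnat_ccons; [apply cnat_a|]. apply cnat_cnil.
- intros X. cnE. reflexivity.
Qed.

Lemma pgood_S (x y z : K) (V : cob x) (W : cob y) (Z : cob z) (B : swap (cs V) (cs Z))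
  (B' : swap (cs W) (cs Z)) (t : tcell _ _) :
  good_S x y z t ->
  pgood (ccons (wl V (cov_b B')) (ccons (cov_as V Z W) (ccons (wr (cov_b B) W)
      (cnil _))))
    (ccons (cov_as V W Z) (ccons (cov_b (V := ctens V W) (swap_left B B'))
      (ccons (cov_as Z V W) (cnil _)))) t.
Proof.
set (mV := cmap_atom V). set (mW := cmap_atom W). set (mZ := cmap_atom Z).
apply good_rel with (m := cmap_tens mV (cmap_tens mW mZ))
  (m' := cmap_tens (cmap_tens mZ mV) mW).
- eapply cnat_ccons; [apply cnat_wl, cnat_b, swap_compat_atoms|].
  eapply cnat_ccons; [apply cnat_as|].
  eapply cnat_ccons; [apply cnat_wr, cnat_b, swap_compat_atoms|]. apply cnat_cnil.
- eapply cnat_ccons; [apply cnat_as|].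
  eapply cnat_ccons; [apply cnat_b|].
  + exact (swap_compat_left (swap_compat_atoms B) (swap_compat_atoms B')).
  + eapply cnat_ccons; [apply cnat_as|]. apply cnat_cnil.
- intros X. cnE. reflexivity.
Qed.

Lemma pgood_ν (x y : K) (V : cob x) (W : cob y) (B : swap (cs V) (cs W))
  (B' : swap (cs W) (cs V)) (t : tcell _ _) :
  (forall X, B' X ∘ B X = id1 _) ->
  good_ν x y t ->
  pgood (ccons (cov_b B) (ccons (cov_b B') (cnil _))) (cnil _) t.
Proof.
intros H. set (mV := cmap_atom V). set (mW := cmap_atom W).
apply good_rel with (m := cmap_tens mV mW) (m' := cmap_tens mV mW).
- eapply cnat_ccons; [apply cnat_b, swap_compat_atoms|].
  eapply cnat_ccons; [apply cnat_b, swap_compat_atoms|]. apply cnat_cnil.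
- apply cnat_cnil.
- intros X. cnE. apply H.
Qed.

Lemma modif_R :
  exists R : modif (ttens M (tb β ob31 ob32) (tid ob33) ;; ta M ob32 ob31 ob33
      ;; ttens M (tid ob32) (tb β ob31 ob33))
    (ta M ob31 ob32 ob33 ;; tb β ob31 (ob32 ⊗p ob33) ;; ta M ob32 ob33 ob31),
  forall x y z : K,
  good_R x y z ⟪R (x, y, z)⟫.
Proof.
pose (R x y z := constructive_indefinite_description _ (R_ex x y z)).
lazymatch goal with |- exists R : modif ?σ ?τ, _ =>
  unshelve eexists (@Modif _ _ _ _ σ τ
  (fun x : K × K × K => proj1_sig (R (fst (fst x)) (snd (fst x)) (snd x))) _) end.
- intros [[x y] z] [[x' y'] z'] [[f g] h].
  (* The law at (f, g, h) is checked with the covers of f, g and h between atoms; strict naturality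
     of s provides their compatibility with the swaps. *)
  pose proof (swap_compat_atom_maps f g) as Hfg.
  pose proof (swap_compat_atom_maps f h) as Hfh.
  set (cf := cov_atom f) in *. set (cg := cov_atom g) in *. set (ch := cov_atom h) in *.
  clearbody cf cg ch.
  pose (m := ((f, g, h) : @hom (K × K × K) (x, y, z) (x', y', z'))).
  refine (md_nat_of_good (f := m)
    (good_trans_comp
      (good_trans_tens
          (good_trans_b (F := ob31) (G := ob32) (f := m) (cF := cf) (cG := cg) Hfg)
        (good_trans_id (F := ob33) (f := m) ch))
      (good_trans_comp
        (good_trans_a (F := ob32) (G := ob31) (H := ob33) (f := m) cg cf ch)
        (good_trans_tens (good_trans_id (F := ob32) (f := m) cg)
          (good_trans_b (F := ob31) (G := ob33) (f := m) (cF := cf) (cG := ch) Hfh))))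
    (good_trans_comp
        (good_trans_a (F := ob31) (G := ob32) (H := ob33) (f := m) cf cg ch)
      (good_trans_comp
        (good_trans_b (F := ob31) (G := ob32 ⊗p ob33) (f := m) (cF := cf)
        (cG := cov_tens cg ch)
        (swap_compat_comp Hfg Hfh))
        (good_trans_a (F := ob32) (G := ob33) (H := ob31) (f := m) cg ch cf))) _ _);
  (eapply good_eqc; [apply cpcov3|apply cpcov3|apply (proj2_sig (R _ _ _))]).
- intros x y z. exact (proj2_sig (R x y z)).
Qed.

Lemma modif_S :
  exists S : modif (ttens M (tid ob31) (tb β ob32 ob33) ;; tas MB ob31 ob33 ob32
      ;; ttens M (tb β ob31 ob33) (tid ob32))
    (tas MB ob31 ob32 ob33 ;; tb β (ob31 ⊗p ob32) ob33 ;; tas MB ob33 ob31 ob32),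
  forall x y z : K,
  good_S x y z ⟪S (x, y, z)⟫.
Proof.
pose (S x y z := constructive_indefinite_description _ (S_ex x y z)).
lazymatch goal with |- exists S : modif ?σ ?τ, _ =>
  unshelve eexists (@Modif _ _ _ _ σ τ
  (fun x : K × K × K => proj1_sig (S (fst (fst x)) (snd (fst x)) (snd x))) _) end.
- intros [[x y] z] [[x' y'] z'] [[f g] h].
  pose proof (swap_compat_atom_maps f h) as Hfh.
  pose proof (swap_compat_atom_maps g h) as Hgh.
  set (cf := cov_atom f) in *. set (cg := cov_atom g) in *. set (ch := cov_atom h) in *.
  clearbody cf cg ch.
  pose (m := ((f, g, h) : @hom (K × K × K) (x, y, z) (x', y', z'))).
  refine (md_nat_of_good (f := m)
    (good_trans_comp (good_trans_tens (good_trans_id (F := ob31) (f := m) cf)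
        (good_trans_b (F := ob32) (G := ob33) (f := m) (cF := cg) (cG := ch) Hgh))
      (good_trans_comp
        (good_trans_as (F := ob31) (G := ob33) (H := ob32) (f := m) cf ch cg)
        (good_trans_tens
          (good_trans_b (F := ob31) (G := ob33) (f := m) (cF := cf) (cG := ch) Hfh)
          (good_trans_id (F := ob32) (f := m) cg))))
    (good_trans_comp
        (good_trans_as (F := ob31) (G := ob32) (H := ob33) (f := m) cf cg ch)
      (good_trans_comp
        (good_trans_b (F := ob31 ⊗p ob32) (G := ob33) (f := m) (cF := cov_tens cf cg)
          (cG := ch) (swap_compat_left Hfh Hgh))
        (good_trans_as (F := ob33) (G := ob31) (H := ob32) (f := m) ch cf cg))) _ _);
  (eapply good_eqc; [apply cpcov3|apply cpcov3|apply (proj2_sig (S _ _ _))]).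
- intros x y z. exact (proj2_sig (S x y z)).
Qed.

Lemma modif_ν :
  exists N : modif (tb β ob21 ob22 ;; tb β ob22 ob21) (tid (ob21 ⊗p ob22)),
  forall x y : K,
  good_ν x y ⟪N (x, y)⟫.
Proof.
pose (N x y := constructive_indefinite_description _ (ν_ex x y)).
lazymatch goal with |- exists S : modif ?σ ?τ, _ =>
  unshelve eexists (@Modif _ _ _ _ σ τ
  (fun x : K × K => proj1_sig (N (fst x) (snd x))) _) end.
- intros [x y] [x' y'] [f g].
  pose proof (swap_compat_atom_maps f g) as Hfg.
  pose proof (swap_compat_atom_maps g f) as Hgf.
  set (cf := cov_atom f) in *. set (cg := cov_atom g) in *. clearbody cf cg.
  pose (m := ((f, g) : @hom (K × K) (x, y) (x', y'))).
  refine (md_nat_of_good (f := m)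
    (good_trans_comp
        (good_trans_b (F := ob21) (G := ob22) (f := m) (cF := cf) (cG := cg) Hfg)
      (good_trans_b (F := ob22) (G := ob21) (f := m) (cF := cg) (cG := cf) Hgf))
    (good_trans_id (F := ob21 ⊗p ob22) (f := m) (cov_tens cf cg)) _ _);
  (eapply good_eqc; [apply cpcov2|apply cov_eq_refl|apply (proj2_sig (N _ _))]).
- intros x y. exact (proj2_sig (N x y)).
Qed.

Lemma pseudo_swap : is_pseudonatural β -> is_pseudonatural (tb β ob22 ob21).
Proof.
intros Hβ. constructor.
- intros [x x'] [y y'] [f f'] [g g'] [α α'].
  exact (tr2_nat Hβ (x := (x', x)) (y := (y', y)) (f := (f', f)) (g := (g', g))
    (α', α)).
- intros [x y]. exact (tr2_id Hβ (y, x)).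
- intros [x x'] [y y'] [z z'] [g g'] [f f'].
  exact (tr2_comp Hβ (x := (x', x)) (y := (y', y)) (z := (z', z)) (g', g) (f', f)).
Qed.

(** The inverse of the braiding is the braiding with its arguments exchanged, with unit ν⁻¹ and
    counit ν. The triangle identities hold because both sides are compatible with the cover of b. *)
Lemma braiding_adj_equiv
  (N : modif (tb β ob21 ob22 ;; tb β ob22 ob21) (tid (ob21 ⊗p ob22))) :
  (forall x y : K,
  good_ν x y ⟪N (x, y)⟫) ->
  is_pseudonatural β -> inhabited (adj_equiv β).
Proof.
intros HN Hβ.
pose (ν x y := N (x, y) : pcell [b x y; b y x] [ ]).
assert (Hν : forall x y, pgood (cnil _) (ccons (cov_b (swap_atoms x y))
  (ccons (cov_b (swap_atoms y x)) (cnil _))) ⟪pinv (ν x y)⟫)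
  by (intros x y; exact (pgood_inv (γ := ν x y) (HN x y))).
assert (Hη : exists η : modif (tid (ob21 ⊗p ob22)) (β ;; tb β ob22 ob21),
  forall x y, η (x, y) = pinv (ν x y)).
{ unshelve eexists (@Modif _ _ _ _ (tid (ob21 ⊗p ob22)) (β ;; tb β ob22 ob21)
    (fun x => match x with (x, y) => pinv (ν x y) end) _); [|easy].
  intros [x y] [x' y'] [f g].
  pose proof (swap_compat_atom_maps f g) as Hfg.
  pose proof (swap_compat_atom_maps g f) as Hgf.
  set (cf := cov_atom f) in *. set (cg := cov_atom g) in *. clearbody cf cg.
  pose (m := ((f, g) : @hom (K × K) (x, y) (x', y'))).
  refine (md_nat_of_good (f := m)
    (good_trans_id (F := ob21 ⊗p ob22) (f := m) (cov_tens cf cg))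
    (good_trans_comp
        (good_trans_b (F := ob21) (G := ob22) (f := m) (cF := cf) (cG := cg) Hfg)
      (good_trans_b (F := ob22) (G := ob21) (f := m) (cF := cg) (cG := cf) Hgf)) _ _);
  (eapply good_eqc; [apply cov_eq_refl|apply cpcov2|exact (Hν _ _)]). }
assert (Hε : exists ε : modif (tb β ob22 ob21 ;; β) (tid (ob22 ⊗p ob21)),
  forall x y, ε (x, y) = ν y x).
{ unshelve eexists (@Modif _ _ _ _ (tb β ob22 ob21 ;; β) (tid (ob22 ⊗p ob21))
    (fun x => match x with (x, y) => ν y x end) _); [|easy].
  intros [x y] [x' y'] [f g].
  pose proof (swap_compat_atom_maps f g) as Hfg.
  pose proof (swap_compat_atom_maps g f) as Hgf.
  set (cf := cov_atom f) in *. set (cg := cov_atom g) in *. clearbody cf cg.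
  pose (m := ((f, g) : @hom (K × K) (x, y) (x', y'))).
  refine (md_nat_of_good (f := m)
    (good_trans_comp
        (good_trans_b (F := ob22) (G := ob21) (f := m) (cF := cg) (cG := cf) Hgf)
      (good_trans_b (F := ob21) (G := ob22) (f := m) (cF := cf) (cG := cg) Hfg))
    (good_trans_id (F := ob22 ⊗p ob21) (f := m) (cov_tens cg cf)) _ _);
  (eapply good_eqc; [apply cpcov2|apply cov_eq_refl|exact (HN _ _)]). }
destruct Hη as [η Hη], Hε as [ε Hε]. constructor.
refine (@AdjEquiv _ _ _ _ β Hβ (tb β ob22 ob21) (pseudo_swap Hβ) η ε _ _).
- intros [x y]. cbv zeta. rewrite (Hη x y), (Hε x y).
  refine (pgood_eq (cp := ccons (cov_b (swap_atoms x y)) (cnil _))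
    (cq := ccons (cov_b (swap_atoms x y)) (cnil _))
    (δ := iso_id (b x y)) _ (good_refl _)).
  exact (pgood_v (pgood_here (ccons (cov_b (swap_atoms x y)) (cnil _)) (Hν x y))
    (pgood_skip _ (pgood_here (cnil _) (HN y x)))).
- intros [x y]. cbv zeta. rewrite (Hη x y), (Hε x y).
  refine (pgood_eq (cp := ccons (cov_b (swap_atoms y x)) (cnil _))
    (cq := ccons (cov_b (swap_atoms y x)) (cnil _))
    (δ := iso_id (b y x)) _ (good_refl _)).
  exact (pgood_v (pgood_skip _ (pgood_here (cnil _) (Hν x y)))
    (pgood_here (ccons (cov_b (swap_atoms y x)) (cnil _)) (HN y x))).
Qed.

Lemma cov_eq_b (x y : K) (V : cob x) (W : cob y) (B B' : swap (cs V) (cs W)) :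
  (forall X, B X = B' X) -> cov_eq (cov_b B) (cov_b B').
Proof.
intros H. split; [easy|]. split; [exact H|]. now rewrite !cov_bE.
Qed.

Lemma pgood_b2_a (x y z t : K) (V : cob x) (W : cob y) (Z : cob z) (T : cob t)
  (B : swap (cs V) (cs W)) (C : swap (cs V) (cs Z)) (D : swap (cs V) (cs T)) :
  pgood (ccons (wl V (cov_a W Z T))
      (ccons (cov_b (W := ctens W (ctens Z T)) (swap_comp B (swap_comp C D))) (cnil _)))
    (ccons (cov_b (W := ctens (ctens W Z) T) (swap_comp (swap_comp B C) D))
      (ccons (wr (cov_a W Z T) V) (cnil _))) ⟪b_nat2 β x (a y z t)⟫.
Proof.
apply pgood_b2. intros X. cbn. rewrite !sm_id, !sm_comp. now nrm.
Qed.

Lemma pgood_b1_as (x y z t : K) (V : cob x) (W : cob y) (Z : cob z) (T : cob t)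
  (B : swap (cs V) (cs T)) (C : swap (cs W) (cs T)) (D : swap (cs Z) (cs T)) :
  pgood (ccons (wr (cov_as V W Z) T) (ccons
      (cov_b (V := ctens (ctens V W) Z) (swap_left (swap_left B C) D)) (cnil _)))
    (ccons (cov_b (V := ctens V (ctens W Z)) (swap_left B (swap_left C D)))
      (ccons (wl T (cov_as V W Z)) (cnil _))) ⟪b_nat1 β (asc MB x y z) t⟫.
Proof.
apply pgood_b1. intros X. cbn. rewrite !sm_id, !sm_comp. now nrm.
Qed.

(** The condition on transformations demanded by [pgood_b2] is axiom (B1), the Yang-Baxter equation
    for s. *)
Lemma pgood_b2_b (x y z : K) :
  pgood (ccons (wl (catom x) (cov_b (swap_atoms y z))) (ccons
      (cov_b (W := ctens (catom z) (catom y))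
        (swap_comp (swap_atoms x z) (swap_atoms x y))) (cnil _)))
    (ccons (cov_b (W := ctens (catom y) (catom z))
        (swap_comp (swap_atoms x y) (swap_atoms x z)))
      (ccons (wr (cov_b (swap_atoms y z)) (catom x)) (cnil _))) ⟪b_nat2 β x (b y z)⟫.
Proof.
apply pgood_b2. intros X. cbn. pose proof (sym_B1 Hsym X x y z) as H. nrm_in H.
nrm. symmetry. exact H.
Qed.

Lemma pgood_b1_b (x y z : K) :
  pgood (ccons (wr (cov_b (swap_atoms x y)) (catom z)) (ccons
      (cov_b (V := ctens (catom y) (catom x))
        (swap_left (swap_atoms y z) (swap_atoms x z))) (cnil _)))
    (ccons (cov_b (V := ctens (catom x) (catom y))
        (swap_left (swap_atoms x z) (swap_atoms y z)))
      (ccons (wl (catom z) (cov_b (swap_atoms x y))) (cnil _))) ⟪b_nat1 β (b x y) z⟫.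
Proof.
apply pgood_b1. intros X. cbn. pose proof (sym_B1 Hsym X x y z) as H. nrm_in H.
nrm. exact H.
Qed.

(** Two applications of (Sym), the inner one tensored with z, show that the two composite swaps are
    mutually inverse in this order. *)
Lemma pgood_ν_comp (x y z : K) (t : tcell _ _) :
  good_ν x (y ⊗ z) t ->
  pgood (ccons (cov_b (W := ctens (catom y) (catom z))
        (swap_comp (swap_atoms x y) (swap_atoms x z)))
      (ccons (cov_b (V := ctens (catom y) (catom z))
        (swap_left (swap_atoms y x) (swap_atoms z x))) (cnil _))) (cnil _) t.
Proof.
apply pgood_ν. intros X. cbn. nrm.
rw (sym_Sym Hsym (X ⊗ y) x z).
transitivity ((s X y x ∘ s X x y) ⊠ (id1 z ∘ id1 z)); [apply tens_comp|].
rewrite (sym_Sym Hsym X x y), (lunitE HK). apply tens_id.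
Qed.

Lemma pgood_ν_left (x y z : K) (t : tcell _ _) :
  good_ν (x ⊗ y) z t ->
  pgood (ccons (cov_b (V := ctens (catom x) (catom y))
        (swap_left (swap_atoms x z) (swap_atoms y z)))
      (ccons (cov_b (W := ctens (catom x) (catom y))
        (swap_comp (swap_atoms z x) (swap_atoms z y))) (cnil _))) (cnil _) t.
Proof.
apply pgood_ν. intros X. cbn. nrm.
pose proof (tens_comp (s X z x) (s X x z) (id1 y) (id1 y)) as H.
rewrite (sym_Sym Hsym X x z), (lunitE HK), tens_id in H.
rw H. apply (sym_Sym Hsym).
Qed.

Lemma cov_eq_ccons (x y z : K) (V : cob x) (W : cob y) (Z : cob z) (f : hom x y)
  (p : path y z) (c c' : cov V W f) (cp cp' : cpath W Z p) :
  cov_eq c c' -> cov_eq (cpcov cp) (cpcov cp') ->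
  cov_eq (cpcov (ccons c cp)) (cpcov (ccons c' cp')).
Proof.
intros H H'. eapply cov_eq_trans; [apply cpcov_cons|].
eapply cov_eq_trans; [|apply cov_eq_sym, cpcov_cons]. now apply cov_eq_comp.
Qed.

(** Two objects can be moved past two others in either order; the results differ by naturality of
    one swap. *)
Lemma swap_interchange (S S' T T' : sfun) (B : swap S T) (C : swap S T') (B' : swap S' T)
  (C' : swap S' T') (X : K) :
  swap_comp (swap_left B B') (swap_left C C') X =
  swap_left (swap_comp B C) (swap_comp B' C') X.
Proof.
cbn. pose proof (n_nat C' (B X)) as H. cbn in H. rewrite !sm_comp. nrm.
rw (eq_sym H). reflexivity.
Qed.
(* Otherwise unification unfolds covers when [gpaste] infers those of intermediate paths. *)
Opaque cov_comp cov_tens cov_id cov_a cov_as cov_b wl wr.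

(** The covers of the source path are known. [gwhere] follows the whiskerings to the place of the
    active 2-cell and [gcell] looks up its compatibility lemma; unification then yields the covers
    of the next path for [gpaste]. *)
Ltac gwhere tac :=
  lazymatch goal with
  | |- pgood ?C _ (pk (fwd ?c)) =>
      lazymatch c with
      | @skip _ ?x ?y ?z ?f ?p ?q ?α =>
          lazymatch C with
          | ccons ?c ?cp =>
              refine (@pgood_skip x y z _ _ _ f p q c cp _ α _); gwhere tac
          end
      | @here _ ?x ?y ?z ?p ?q ?v ?α =>
          refine (@pgood_here_eq x y z _ _ _ p q v _ _ _ _ _ α _ _ _);
          [tac|cbn [capp cmapl cmapr]; reflexivity|cbn [capp cmapl cmapr]; reflexivity]
      end
  end.

Ltac gcell0 c :=
  lazymatch c with
  | η MB _ _ _ => apply pgood_η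
  | ε MB _ _ _ => apply pgood_ε
  | π MB _ _ _ _ => apply pgood_π
  end.

Ltac gcell :=
  idtac; lazymatch goal with
  | |- pgood _ _ (pk (fwd ?c)) =>
      lazymatch c with
      | pinv ?α => refine (@pgood_inv _ _ _ _ _ _ _ _ α _); gcell
      | @pmap_cell _ _ (ltens M _) ?x ?y ?p ?q ?α =>
          refine (@pgood_mapl _ _ x y _ _ p q _ _ α _); gcell
      | @pmap_cell _ _ (rtens M _) ?x ?y ?p ?q ?α =>
          refine (@pgood_mapr _ _ x y _ _ p q _ _ α _); gcell
      | _ => gcell0 c
      end
  end.

Ltac gpaste :=
  lazymatch goal with
  | |- pgood _ _ (pk (fwd ?c)) =>
      lazymatch c with
      | pvcomp _ _ => refine (pgood_v _ _); [gwhere gcell|];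
          cbn [capp cmapl cmapr]; gpaste
      | _ => gwhere gcell
      end
  end.

(** * Mates of the pentagon cell *)

Lemma pgood_π1 (x y z t : K) (V : cob x) (W : cob y) (Z : cob z) (T : cob t) :
  pgood (ccons (wl V (cov_as W Z T)) (ccons (cov_as V (ctens W Z) T)
      (ccons (wr (cov_as V W Z) T) (cnil _))))
    (ccons (cov_as V W (ctens Z T)) (ccons (cov_as (ctens V W) Z T) (cnil _)))
    ⟪π1 MB x y z t⟫.
Proof.
unfold π1. gpaste.
Qed.

Ltac gcell0 c ::=
  lazymatch c with
  | η MB _ _ _ => apply pgood_η
  | ε MB _ _ _ => apply pgood_ε
  | π MB _ _ _ _ => apply pgood_π
  | π1 MB _ _ _ _ => apply pgood_π1
  end.

Lemma pgood_π2 (x y z t : K) (V : cob x) (W : cob y) (Z : cob z) (T : cob t) :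
  pgood (ccons (wl V (cov_a W Z T)) (ccons (cov_as V W (ctens Z T)) (cnil _)))
    (ccons (cov_as V (ctens W Z) T) (ccons (wr (cov_as V W Z) T)
      (ccons (cov_a (ctens V W) Z T) (cnil _)))) ⟪π2 MB x y z t⟫.
Proof. unfold π2. gpaste. Qed.

Lemma pgood_π3 (x y z t : K) (V : cob x) (W : cob y) (Z : cob z) (T : cob t) :
  pgood (ccons (cov_as (ctens V W) Z T) (ccons (wr (cov_a V W Z) T) (cnil _)))
    (ccons (cov_a V W (ctens Z T)) (ccons (wl V (cov_as W Z T))
      (ccons (cov_as V (ctens W Z) T) (cnil _)))) ⟪π3 MB x y z t⟫.
Proof. unfold π3. gpaste. Qed.

Lemma pgood_π4 (x y z t : K) (V : cob x) (W : cob y) (Z : cob z) (T : cob t) :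
  pgood (ccons (wl V (cov_a W Z T)) (ccons (cov_as V W (ctens Z T))
      (ccons (cov_as (ctens V W) Z T) (ccons (wr (cov_a V W Z) T) (cnil _)))))
    (ccons (cov_as V (ctens W Z) T) (cnil _)) ⟪π4 MB x y z t⟫.
Proof. unfold π4. gpaste. Qed.

Lemma pgood_π5 (x y z t : K) (V : cob x) (W : cob y) (Z : cob z) (T : cob t) :
  pgood (ccons (wr (cov_as V W Z) T) (ccons (cov_a (ctens V W) Z T)
      (ccons (cov_a V W (ctens Z T)) (ccons (wl V (cov_as W Z T)) (cnil _)))))
    (ccons (cov_a V (ctens W Z) T) (cnil _)) ⟪π5 MB x y z t⟫.
Proof. unfold π5. gpaste. Qed.

(** * The coherence axioms *)

Section Laws.

Context (E : adj_equiv β)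
  (R : modif (ttens M (tb β ob31 ob32) (tid ob33) ;; ta M ob32 ob31 ob33
      ;; ttens M (tid ob32) (tb β ob31 ob33))
    (ta M ob31 ob32 ob33 ;; tb β ob31 (ob32 ⊗p ob33) ;; ta M ob32 ob33 ob31))
  (HR : forall x y z : K,
  good_R x y z ⟪R (x, y, z)⟫)
  (S : modif (ttens M (tid ob31) (tb β ob32 ob33) ;; tas MB ob31 ob33 ob32
      ;; ttens M (tb β ob31 ob33) (tid ob32))
    (tas MB ob31 ob32 ob33 ;; tb β (ob31 ⊗p ob32) ob33 ;; tas MB ob33 ob31 ob32))
  (HS : forall x y z : K,
  good_S x y z ⟪S (x, y, z)⟫)
  (N : modif (tb β ob21 ob22 ;; tb β ob22 ob21) (tid (ob21 ⊗p ob22)))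
  (HN : forall x y : K,
  good_ν x y ⟪N (x, y)⟫).

Local Notation X := (@BraidedData K M MB β E R S).

Ltac gcell0 c ::=
  lazymatch c with
  | η MB _ _ _ => apply pgood_η
  | ε MB _ _ _ => apply pgood_ε
  | π MB _ _ _ _ => apply pgood_π
  | π1 MB _ _ _ _ => apply pgood_π1
  | π2 MB _ _ _ _ => apply pgood_π2
  | π3 MB _ _ _ _ => apply pgood_π3
  | π4 MB _ _ _ _ => apply pgood_π4
  | π5 MB _ _ _ _ => apply pgood_π5
  | a_nat1 _ _ _ _ => apply pgood_a1
  | a_nat2 _ _ _ _ => apply pgood_a2
  | a_nat3 _ _ _ _ => apply pgood_a3
  | as_nat1 MB _ _ _ => apply pgood_as1
  | as_nat2 MB _ _ _ => apply pgood_as2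
  | as_nat3 MB _ _ _ => apply pgood_as3
  | tens_exchange _ _ _ => apply pgood_exchange
  | hexR _ _ _ _ => refine (pgood_R _ _ (HR _ _ _))
  | hexS _ _ _ _ => refine (pgood_S _ _ (HS _ _ _))
  | b_nat2 _ _ (ac _ _ _ _) => apply pgood_b2_a
  | b_nat2 _ _ (bc _ _ _) => apply pgood_b2_b
  | b_nat1 _ (asc _ _ _ _) _ => apply pgood_b1_as
  | b_nat1 _ (bc _ _ _) _ => apply pgood_b1_b
  | syl _ (tens0 _ _ _) _ => refine (pgood_ν_left (HN _ _))
  | syl _ _ (tens0 _ _ _) => refine (pgood_ν_comp (HN _ _))
  | syl _ _ _ => exact (HN _ _)
  end.

(** For each axiom only the covers of the common source and target are prescribed; both pastings are
    then traversed mechanically. *)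
Lemma skew_is_braided : is_braided X.
Proof.
constructor.
- intros A B C D. cbn [bd_monoidal bd_b].
  set (cA := catom A). set (cB := catom B). set (cC := catom C). set (cD := catom D).
  refine (pgood_eq (cp :=
    ccons (wr (wr (cov_b (swap_atoms A B)) cC) cD) (ccons (wr (cov_a cB cA cC) cD)
    (ccons (wr (wl cB (cov_b (swap_atoms A C))) cD) (ccons (cov_a cB (ctens cC cA) cD)
    (ccons (wl cB (cov_a cC cA cD)) (ccons (wl cB (wl cC (cov_b (swap_atoms A D))))
    (cnil _))))))) (cq :=
    ccons (cov_a (ctens cA cB) cC cD) (ccons (cov_a cA cB (ctens cC cD))
    (ccons (cov_b (V := cA) (W := ctens cB (ctens cC cD))
      (swap_comp (swap_atoms A B) (swap_comp (swap_atoms A C) (swap_atoms A D))))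
    (ccons (cov_a cB (ctens cC cD) cA) (ccons (wl cB (cov_a cC cD cA)) (cnil _))))))
    _ _); gpaste.
- intros A B C D. cbn [bd_monoidal bd_b].
  set (cA := catom A). set (cB := catom B). set (cC := catom C). set (cD := catom D).
  refine (pgood_eq (cp :=
    ccons (wl cA (wl cB (cov_b (swap_atoms C D)))) (ccons (wl cA (cov_as cB cD cC))
    (ccons (wl cA (wr (cov_b (swap_atoms B D)) cC)) (ccons (cov_as cA (ctens cD cB) cC)
    (ccons (wr (cov_as cA cD cB) cC) (ccons (wr (wr (cov_b (swap_atoms A D)) cB) cC)
    (cnil _))))))) (cq :=
    ccons (cov_as cA cB (ctens cC cD)) (ccons (cov_as (ctens cA cB) cC cD)
    (ccons (cov_b (V := ctens (ctens cA cB) cC) (W := cD)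
      (swap_left (swap_left (swap_atoms A D) (swap_atoms B D)) (swap_atoms C D)))
    (ccons (cov_as cD (ctens cA cB) cC) (ccons (wr (cov_as cD cA cB) cC) (cnil _))))))
    _ _); gpaste.
- intros A B C D. cbn [bd_monoidal bd_b].
  set (cA := catom A). set (cB := catom B). set (cC := catom C). set (cD := catom D).
  (* The target is left open in its swap because the two pastings end in different ones: one moves
     each of A, B past C ⊗ D, the other moves A ⊗ B past C and then past D. *)
  pose (cq B := ccons (wl cA (cov_a cB cC cD)) (ccons (cov_as cA cB (ctens cC cD))
    (ccons (cov_b (V := ctens cA cB) (W := ctens cC cD) B)
    (ccons (cov_as (ctens cC cD) cA cB) (ccons (wr (cov_a cC cD cA) cB) (cnil _)))))).
  refine (pgood_eq (cp :=
    ccons (wl cA (wr (cov_b (swap_atoms B C)) cD)) (ccons (wl cA (cov_a cC cB cD))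
    (ccons (wl cA (wl cC (cov_b (swap_atoms B D)))) (ccons (cov_as cA cC (ctens cD cB))
    (ccons (cov_as (ctens cA cC) cD cB) (ccons (wr (wr (cov_b (swap_atoms A C)) cD) cB)
    (ccons (wr (cov_a cC cA cD) cB) (ccons (wr (wl cC (cov_b (swap_atoms A D))) cB)
    (cnil _))))))))) (cq := cq (swap_left (swap_comp (swap_atoms A C) (swap_atoms A D))
      (swap_comp (swap_atoms B C) (swap_atoms B D)))) _ _).
  + unfold cq. gpaste.
  (* [swap_interchange] identifies the two target covers before the second pasting is traversed. *)
  + refine (good_eqc (d := cpcov (cq (swap_comp
      (swap_left (swap_atoms A C) (swap_atoms B C))
      (swap_left (swap_atoms A D) (swap_atoms B D))))) (cov_eq_refl _) _ _); unfold cq.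
    * do 2 (apply cov_eq_ccons; [apply cov_eq_refl|]).
      apply cov_eq_ccons; [|apply cov_eq_refl]. apply cov_eq_b, swap_interchange.
    * match goal with |- good (cpcov ?cp) (cpcov ?cq) ?t => change (pgood cp cq t) end.
      gpaste.
- intros A B C. cbn [bd_monoidal bd_b].
  set (cA := catom A). set (cB := catom B). set (cC := catom C).
  refine (pgood_eq (cp :=
    ccons (wr (cov_b (swap_atoms A B)) cC) (ccons (cov_a cB cA cC)
    (ccons (wl cB (cov_b (swap_atoms A C))) (ccons (cov_as cB cC cA)
    (ccons (wr (cov_b (swap_atoms B C)) cA) (ccons (cov_a cC cB cA) (cnil _))))))) (cq :=
    ccons (cov_a cA cB cC) (ccons (wl cA (cov_b (swap_atoms B C)))
    (ccons (cov_as cA cC cB) (ccons (wr (cov_b (swap_atoms A C)) cB)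
    (ccons (cov_a cC cA cB) (ccons (wl cC (cov_b (swap_atoms A B))) (cnil _)))))))
    _ _); gpaste.
Qed.

Lemma skew_is_sylleptic : @is_sylleptic K M X N.
Proof.
constructor; intros A B C; cbn [bd_monoidal bd_b];
  set (cA := catom A); set (cB := catom B); set (cC := catom C).
- refine (pgood_eq (cp :=
    ccons (wr (cov_b (swap_atoms A B)) cC) (ccons (cov_a cB cA cC)
    (ccons (wl cB (cov_b (swap_atoms A C))) (ccons (wl cB (cov_b (swap_atoms C A)))
    (ccons (cov_as cB cA cC) (ccons (wr (cov_b (swap_atoms B A)) cC) (cnil _)))))))
    (cq := cnil _) _ _); gpaste.
- refine (pgood_eq (cp :=
    ccons (wl cA (cov_b (swap_atoms B C))) (ccons (cov_as cA cC cB)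
    (ccons (wr (cov_b (swap_atoms A C)) cB) (ccons (wr (cov_b (swap_atoms C A)) cB)
    (ccons (cov_a cA cC cB) (ccons (wl cA (cov_b (swap_atoms C B))) (cnil _)))))))
    (cq := cnil _) _ _); gpaste.
Qed.

Lemma skew_is_symmetric : @is_symmetric K M X N.
Proof.
intros A B. cbn [bd_monoidal bd_b].
refine (pgood_eq (cp := ccons (cov_b (swap_atoms A B)) (ccons (cov_b (swap_atoms B A))
  (ccons (cov_b (swap_atoms A B)) (cnil _))))
  (cq := ccons (cov_b (swap_atoms A B)) (cnil _))
  _ _); gpaste.
Qed.

End Laws.

Lemma symmetric_ex : is_pseudonatural β ->
  exists S : symmetric_monoidal_bicategory M, bd_monoidal S = MB /\ bd_b S = β.
Proof.
intros Hβ. destruct modif_R as [R HR], modif_S as [S HS], modif_ν as [N HN].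
destruct (braiding_adj_equiv HN Hβ) as [E].
pose (X := BraidedMonoidalBicategory (skew_is_braided E HR HS)).
pose (Y := @SyllepticMonoidalBicategory K M X N (skew_is_sylleptic E HR HS HN)).
now exists (@SymmetricMonoidalBicategory K M Y (skew_is_symmetric E R S HN)).
Qed.

End Braiding.

(** * The braiding *)

Section TransportedBraiding.

Context (lstar : forall A : K, hom A (I ⊗ A))
  (Hlstar : forall A : K, equivalence_inverse (l A) (lstar A)).

Definition braid (x y : K) : hom (x ⊗ y) (y ⊗ x) :=
  (l y ⊠ id1 x) ∘ s I x y ∘ (lstar x ⊠ id1 y).

(** The isomorphism 1 ≅ ℓ* ℓ, tensored with y and placed before (ℓ ⊗ 1) s. *)
Lemma braid_Θ (x y : K) :
  exists _ : iso2 ((l y ⊠ id1 x) ∘ s I x y) (braid x y ∘ (l x ⊠ id1 y)), True.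
Proof.
destruct (Hlstar x) as [[η] _].
assert (e1 : (l y ⊠ id1 x) ∘ s I x y ∘ (id1 (I ⊗ x) ⊠ id1 y) =
  (l y ⊠ id1 x) ∘ s I x y) by now rewrite tens_id, (runitE HK).
assert (e2 : (l y ⊠ id1 x) ∘ s I x y ∘ ((lstar x ∘ l x) ⊠ id1 y) =
  braid x y ∘ (l x ⊠ id1 y)) by (unfold braid; rewrite tens_l; now nrm).
now exists (castI e1 e2 (iso_hcomp (iso_id ((l y ⊠ id1 x) ∘ s I x y))
  (tens2 M η (iso_id (id1 y))))).
Qed.

(** The components are the prescribed composites; only the pseudonaturality cells are chosen, by
    transport along ℓ ⊗ 1. *)
Lemma braiding_ex :
  exists (β : braiding_data M)
    (Θ : forall x y : K, iso2 ((l y ⊠ id1 x) ∘ s I x y) (bc β x y ∘ (l x ⊠ id1 y))),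
  (forall x y, bc β x y = braid x y) /\ is_pseudonatural β /\
  forall (x x' y y' : K) (f : hom x x') (g : hom y y'),
    ⟦g ⊠ f⟧ ⊛ ⟪Θ x y⟫ ⊳ ⟪bt β f g⟫ ⊛ ⟦l x ⊠ id1 y⟧ =
    ⟪Θ x' y'⟫ ⊛ ⟦(id1 I ⊠ f) ⊠ g⟧.
Proof.
pose (Θ x y := proj1_sig (constructive_indefinite_description _ (braid_Θ x y))).
(* The auxiliary functor (x, y) ↦ (I x) y is the common source of the 2-natural ℓ ⊗ 1 and (ℓ ⊗ 1)
   s. *)
pose (F' := pf_const I ⊗p ob21 ⊗p ob22 : pfun (K × K) K).
pose (κ := fun x : K × K => l (fst x) ⊠ id1 (snd x) : hom (F' x) ((ob21 ⊗p ob22) x)).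
pose (ρ := fun x : K × K => (l (snd x) ⊠ id1 (fst x)) ∘ s I (fst x) (snd x)
  : hom (F' x) ((ob22 ⊗p ob21) x)).
assert (HF' : strict_pfun F')
  by (repeat first [apply strict_tens|apply strict_const|apply strict_21
    |apply strict_22]).
assert (HF : strict_pfun (ob21 ⊗p ob22 : pfun (K × K) K))
  by (repeat first [apply strict_tens|apply strict_21|apply strict_22]).
assert (HG : strict_pfun (ob22 ⊗p ob21 : pfun (K × K) K))
  by (repeat first [apply strict_tens|apply strict_21|apply strict_22]).
assert (κ_nat : forall (x y : K × K) (f g : hom x y) (α : cell f g),
  ⟪F2 (ob21 ⊗p ob22) α⟫ ⊛ ⟦κ x⟧ = ⟦κ y⟧ ⊛ ⟪F2 F' α⟫).
{ intros [x y] [x' y'] [f f'] [g g'] [α α'].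
  change ((⟪α⟫ ⊡ ⟪α'⟫) ⊛ ⟦l x ⊠ id1 y⟧ =
    ⟦l x' ⊠ id1 y'⟧ ⊛ ((⟦id1 I⟧ ⊡ ⟪α⟫) ⊡ ⟪α'⟫)).
  rewrite <- !tt_im, !tt_h, l_natT. now rewrite (ht_idl HK), (ht_idr HK). }
assert (ρ_nat : forall (x y : K × K) (f g : hom x y) (α : cell f g),
  ⟪F2 (ob22 ⊗p ob21) α⟫ ⊛ ⟦ρ x⟧ = ⟦ρ y⟧ ⊛ ⟪F2 F' α⟫).
{ intros [x y] [x' y'] [f f'] [g g'] [α α'].
  change ((⟪α'⟫ ⊡ ⟪α⟫) ⊛ ⟦(l y ⊠ id1 x) ∘ s I x y⟧ =
    ⟦(l y' ⊠ id1 x') ∘ s I x' y'⟧ ⊛ ((⟦id1 I⟧ ⊡ ⟪α⟫) ⊡ ⟪α'⟫)).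
  rewrite !im_comp, <- (ht_assoc HK), (ht_assoc HK ⟦l y' ⊠ id1 x'⟧), s_natT.
  rewrite <- (ht_assoc HK), <- !tt_im, !tt_h, l_natT.
  now rewrite (ht_idl HK), (ht_idr HK). }
assert (κ_adj : forall x : K × K, adjoint (κ x)).
{ intros x. apply adjoint_choice. apply equivalence_tens; [apply Hl|].
  apply equivalence_id. }
exists (transport HK κ_nat ρ_nat κ_adj
  (fun x : K × K => Θ (fst x) (snd x) : iso2 (ρ x) (braid (fst x) (snd x) ∘ κ x))), Θ.
split; [reflexivity|]. split; [now apply transport_pseudo|].
intros x x' y y' f g. exact (transportE HK κ_nat ρ_nat κ_adj
  (fun x : K × K => Θ (fst x) (snd x) : iso2 (ρ x) (braid (fst x) (snd x) ∘ κ x))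
  (x := (x, y)) (y := (x', y')) (f, g)).
Qed.

End TransportedBraiding.

End Skew.

Theorem proposition6p4 (K : bicat) (M : monoidal_data K) (s : symmetry_data M)
  (Hskew : is_skew_monoidal_2category M)
  (Hsym : is_symmetry s)
  (Ha : forall A B C : K, is_equivalence (ac M A B C))
  (Hl : forall A : K, is_equivalence (lc M A))
  (Hr : forall A : K, is_equivalence (rc M A))
  (lstar : forall A : K, hom A (munit M ⊗[M] A))
  (Hlstar : forall A : K, equivalence_inverse (lc M A) (lstar A)) :
  exists S : symmetric_monoidal_bicategory M,
    has_strict_coherence (bd_monoidal S) /\
    forall A B : K,
      bc (bd_b S) A B =
      (lc M B ⊠[M] id1 A) ∘ sc s (munit M) A B ∘ (lstar A ⊠[M] id1 B).
Proof.
destruct (braiding_ex Hskew Hl Hsym Hlstar) as (β & Θ & Hb & Hβ & H).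
destruct (symmetric_ex Hskew Ha Hl Hr Hsym H
    (skew_has_strict_coherence Hskew Ha Hl Hr) Hβ)
  as (S & HS & ES).
exists S. rewrite HS, ES. split; [apply skew_has_strict_coherence|exact Hb].
Qed.
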